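(* Let $n\geqslant 1$, $\beta>0$, and let $p>1$ satisfy $p<\infty$ if $n=1$, and $p<p_{\mathrm{Str}}(n)$ if $n\geqslant 2$. Let $(u_0,u_1,u_2)\in H^2(\mathbb{R}^n)\times H^1(\mathbb{R}^n)\times L^2(\mathbb{R}^n)$ be nonnegative and compactly supported functions with supports contained in $B_R$ for some $R>0$, such that $u_0$ is not identically zero. For $\varepsilon>0$, let $$u\in \mathcal{C}([0,T),H^2(\mathbb{R}^n))\cap \mathcal{C}^1([0,T),H^1(\mathbb{R}^n))\cap \mathcal{C}^2([0,T),L^2(\mathbb{R}^n))\cap L^p_{\mathrm{loc}}([0,T)\times\mathbb{R}^n)$$ be an energy solution on $[0,T)$ (in the sense defined in the context) to the Cauchy problem $$\begin{cases}\beta u_{ttt}+u_{tt}-\Delta u-\beta\Delta u_t=|u|^p, & x\in\mathbb{R}^n,\ t>0,\\ (u,u_t,u_{tt})(0,x)=\varepsilon(u_0,u_1,u_2)(x), & x\in\mathbb{R}^n,\end{cases}$$ with lifespan $T=T(\varepsilon)$, such that $\mathrm{supp}\,u(t,\cdot)\subset B_{R+t}$ for any $t\in(0,T)$. Then there exists a positive constant $\varepsilon_0=\varepsilon_0(u_0,u_1,u_2,n,p,R,\beta)$ such that for any $\varepsilon\in(0,\varepsilon_0]$ the solution $u$ blows up in finite time. Furthermore, the upper bound estimate for the lifespan $$T(\varepsilon)\leqslant C\varepsilon^{-\frac{2p(p-1)}{\theta(p,n)}}$$ holds, where $C$ is a positive constant independent of $\varepsilon$ and $\theta(p,n)\doteq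 2+(n+1)p-(n-1)p^2$.
   Context: $B_\rho$ denotes the ball in $\mathbb{R}^n$ centered at the origin with radius $\rho$. For $n\geqslant 2$, the Strauss exponent $p_{\mathrm{Str}}(n)$ is the positive root of the quadratic equation $(n-1)p^2-(n+1)p-2=0$. Energy solution. Let $(u_0,u_1,u_2)\in H^2(\mathbb{R}^n)\times H^1(\mathbb{R}^n)\times L^2(\mathbb{R}^n)$. A function $u\in \mathcal{C}([0,T),H^2(\mathbb{R}^n))\cap \mathcal{C}^1([0,T),H^1(\mathbb{R}^n))\cap \mathcal{C}^2([0,T),L^2(\mathbb{R}^n))\cap L^p_{\mathrm{loc}}([0,T)\times\mathbb{R}^n)$ is an energy solution on $[0,T)$ of the Cauchy problem if $u(0,\cdot)=\varepsilon u_0$ in $H^2(\mathbb{R}^n)$, $u_t(0,\cdot)=\varepsilon u_1$ in $H^1(\mathbb{R}^n)$, and $$\begin{aligned}&\beta\int_{\mathbb{R}^n}u_{tt}(t,x)\psi(t,x)\,\mathrm{d}x+\int_{\mathbb{R}^n}u_t(t,x)\psi(t,x)\,\mathrm{d}x-\beta\varepsilon\int_{\mathbb{R}^n}u_2(x)\psi(0,x)\,\mathrm{d}x-\varepsilon\int_{\mathbb{R}^n}u_1(x)\psi(0,x)\,\mathrm{d}x\\&\quad+\beta\int_0^t\int_{\mathbb{R}^n}\big(\nabla_x u_t(s,x)\cdot\nabla_x\psi(s,x)-u_{tt}(s,x)\psi_s(s,x)\big)\,\mathrm{d}x\,\mathrm{d}s\\&\quad+\int_0^t\int_{\mathbb{R}^n}\big(\nabla_x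 u(s,x)\cdot\nabla_x\psi(s,x)-u_t(s,x)\psi_s(s,x)\big)\,\mathrm{d}x\,\mathrm{d}s=\int_0^t\int_{\mathbb{R}^n}|u(s,x)|^p\psi(s,x)\,\mathrm{d}x\,\mathrm{d}s\end{aligned}$$ for any $\psi\in\mathcal{C}_0^\infty([0,T)\times\mathbb{R}^n)$ and any $t\in[0,T)$. The lifespan $T(\varepsilon)$ is the maximal existence time of $u$ as such an energy solution; ''$u$ blows up in finite time'' means $T(\varepsilon)<\infty$. The constants $\varepsilon_0$ and $C$ are fixed in terms of the data and parameters before $\varepsilon$ and $u$ are chosen. *)

(* Defs.v *)
From HB Require Import structures.
From mathcomp Require Import all_boot all_order all_algebra.
From mathcomp Require Import all_classical all_reals all_analysis.
From mathcomp Require Import ring.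

Set Implicit Arguments.
Unset Strict Implicit.
Unset Printing Implicit Defensive.

Import Order.TTheory GRing.Theory Num.Theory.
Import numFieldNormedType.Exports.

Local Open Scope classical_set_scope.
Local Open Scope ring_scope.

Section rV_measurable.
Context {R : realType} (n : nat).

Let coor (i : 'I_n) (x : 'rV[R]_n) : R := x ord0 i.

Let rV_set0 : g_sigma_preimage coor set0.
Proof. exact: sigma_algebra0. Qed.

Let rV_setC A : g_sigma_preimage coor A -> g_sigma_preimage coor (~` A).
Proof. exact: sigma_algebraC. Qed.

Let rV_bigcup (F : (set 'rV[R]_n)^nat) :
  (forall i, g_sigma_preimage coor (F i)) ->
  g_sigma_preimage coor (\bigcup_i (F i)).
Proof. exact: sigma_algebra_bigcup. Qed.

(* The sigma-algebra generated by the coordinates, i.e. the Borel sets of R^n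
   (the library has this only for n.-tuple, which carries no topology). *)
HB.instance Definition _ :=
  @isMeasurable.Build (measure_tuple_display default_measure_display)
  'rV[R]_n (g_sigma_preimage coor) rV_set0 rV_setC rV_bigcup.

End rV_measurable.

Section lebesgue_rV.
Context {R : realType}.

Definition rV_cons n (z : measurableTypeR R * 'rV[R]_n) : 'rV[R]_n.+1 :=
  row_mx (const_mx z.1 : 'rV[R]_1) z.2.

Lemma rV_cons0 n (z : measurableTypeR R * 'rV[R]_n) :
  rV_cons z ord0 ord0 = z.1.
Proof.
rewrite /rV_cons mxE; case: splitP => [j _|k]; first by rewrite mxE.
by move=> /eqP.
Qed.

Lemma rV_consS n (z : measurableTypeR R * 'rV[R]_n) (i : 'I_n) :
  rV_cons z ord0 (lift ord0 i) = z.2 ord0 i.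
Proof.
rewrite /rV_cons mxE; case: splitP => [[[|//] ?] /= /eqP //|k].
rewrite /= /bump /= !add1n => -[ik]; congr (z.2 _ _); exact/val_inj.
Qed.

Lemma measurable_coord n (i : 'I_n) :
  measurable_fun [set: 'rV[R]_n] (fun x => x ord0 i : measurableTypeR R).
Proof.
move=> _ Y mY; rewrite setTI; apply: sub_sigma_algebra => /=.
rewrite -bigcup_seq/=; exists i => /=; first by rewrite mem_index_enum.
by exists Y => //; rewrite setTI.
Qed.

Lemma measurable_fun_rV d (T : measurableType d) n (f : T -> 'rV[R]_n) :
  (forall i, measurable_fun [set: T] (fun x => f x ord0 i : measurableTypeR R)) ->
  measurable_fun [set: T] f.
Proof.
move=> mf _ Y mY; rewrite setTI.
have sf : sigma_algebra setT [set A | measurable (f @^-1` A)].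
  split => /=.
  - by rewrite preimage_set0.
  - by move=> A mA; rewrite setTD preimage_setC; exact: measurableC.
  - by move=> F mF; rewrite preimage_bigcup; exact: bigcupT_measurable.
apply: (mY [set A | measurable (f @^-1` A)]); split => //.
move=> A; rewrite -bigcup_seq/= => -[i _ [B mB <-]]; rewrite setTI/=.
by have := mf i measurableT B mB; rewrite setTI.
Qed.

Lemma measurable_rV_cons n :
  measurable_fun [set: measurableTypeR R * 'rV[R]_n] (@rV_cons n).
Proof.
apply: measurable_fun_rV => i.
have [->|[j ->]] : i = ord0 \/ exists j : 'I_n, i = lift ord0 j.
  by case: (unliftP ord0 i) => [j ->|->]; [right; exists j|left].
- apply: (eq_measurable_fun fst) => // z _; exact/esym/rV_cons0.
- apply: (eq_measurable_fun ((fun x : 'rV[R]_n => x ord0 j) \o snd)).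
    by move=> z _ /=; exact/esym/rV_consS.
  exact: (measurableT_comp (@measurable_coord n j)).
Qed.

Let rV_uncons n (x : 'rV[R]_n.+1) : measurableTypeR R * 'rV[R]_n :=
  (x ord0 ord0, \row_j x ord0 (lift ord0 j)).

Let rV_consK n : cancel (@rV_cons n) (@rV_uncons n).
Proof.
move=> [a x]; rewrite /rV_uncons rV_cons0; congr (_, _).
by apply/rowP => j; rewrite mxE rV_consS.
Qed.

Let measurable_rV_uncons n : measurable_fun setT (@rV_uncons n).
Proof.
apply: measurable_fun_pair; first exact: measurable_coord.
apply: measurable_fun_rV => i.
apply: (eq_measurable_fun (fun x : 'rV[R]_n.+1 => x ord0 (lift ord0 i))).
  by move=> x _; rewrite mxE.
exact: measurable_coord.
Qed.

Section lebesgue_rV_succ.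
Context n (m : {sigma_finite_measure set 'rV[R]_n -> \bar R}).

Definition lebesgue_rV_succ : set 'rV[R]_n.+1 -> \bar R :=
  pushforward (@lebesgue_measure R \x m)%E (@rV_cons n).

HB.instance Definition _ := Measure.copy lebesgue_rV_succ
  (measure_function_pushforward__canonical__measure_function_Measure
    (@lebesgue_measure R \x m)%E (@measurable_rV_cons n)).

Let lebesgue_rV_succ_sigma_finite : sigma_finite setT lebesgue_rV_succ.
Proof.
have /sigma_finiteP[F [TF ndF Foo]] := sigma_finiteT (@lebesgue_measure R).
have /sigma_finiteP[G [TG ndG Goo]] := sigma_finiteT m.
exists (fun k => @rV_uncons n @^-1` (F k `*` G k)).
  rewrite -preimage_bigcup; apply/esym; rewrite -subTset => x _.
  have [i _ Fi] : (\bigcup_i F i) (rV_uncons x).1 by rewrite -TF.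
  have [j _ Gj] : (\bigcup_i G i) (rV_uncons x).2 by rewrite -TG.
  exists (maxn i j) => //; split.
  - by move: Fi; exact/subsetPset/ndF/leq_maxl.
  - by move: Gj; exact/subsetPset/ndG/leq_maxr.
move=> k; have [mF Fk] := Foo k; have [mG Gk] := Goo k; split.
  rewrite -[X in measurable X]setTI; apply: measurable_rV_uncons => //.
  exact: measurableX.
rewrite /lebesgue_rV_succ /pushforward -comp_preimage.
rewrite (_ : _ \o _ = id) ?preimage_id//.
  by rewrite product_measure1E// lte_mul_pinfty// ge0_fin_numE.
by apply/funext => z; exact: rV_consK.
Qed.

HB.instance Definition _ := Measure_isSigmaFinite.Build _ _ _
  lebesgue_rV_succ lebesgue_rV_succ_sigma_finite.

End lebesgue_rV_succ.

(* Lebesgue measure on R^n, by iterated products over the coordinates. *)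
Fixpoint lebesgue_rV n : {sigma_finite_measure set 'rV[R]_n -> \bar R} :=
  if n is n'.+1 then lebesgue_rV_succ (lebesgue_rV n') else \d_(0 : 'rV[R]_0).


Lemma lebesgue_rV_box n (A : 'I_n -> set (measurableTypeR R)) :
  (forall i, measurable (A i)) ->
  lebesgue_rV n [set x | forall i, A i (x ord0 i)] =
  (\prod_(i < n) lebesgue_measure (A i))%E.
Proof.
elim: n A => [|n IHn] A mA.
  by rewrite big_ord0 /= diracE mem_set//= => -[].
rewrite big_ord_recl -IHn//.
have mB : measurable [set x : 'rV[R]_n | forall i, A (lift ord0 i) (x ord0 i)].
  rewrite (_ : [set x | _] = \bigcap_(i in [set: 'I_n])
      ((fun x : 'rV[R]_n => x ord0 i) @^-1` A (lift ord0 i))); last first.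
    by apply/seteqP; split => x /= Ax i; [move=> _; exact: Ax|exact: Ax].
  apply: fin_bigcap_measurable => // i _; rewrite -[X in measurable X]setTI.
  by apply: measurable_coord => //; exact: mA.
rewrite -(product_measure1E (@lebesgue_measure R) (lebesgue_rV n))//.
rewrite [LHS]/= /lebesgue_rV_succ /pushforward; congr product_measure1.
apply/seteqP; split => -[a x] /= Ax.
  split; first by have := Ax ord0; rewrite rV_cons0.
  by move=> i; have := Ax (lift ord0 i); rewrite rV_consS.
move=> i; case: (unliftP ord0 i) => [j ->|->].
  by rewrite (@rV_consS n (a, x) j); exact: Ax.2.
by rewrite rV_cons0; exact: Ax.1.
Qed.

End lebesgue_rV.

(* Smooth functions, as those whose iterated directional derivatives all exist
   and are continuous; this is used for the finite-dimensional spaces R^n and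
   R * R^n only. *)
Section smooth.
Context {R : realType} {V : normedModType R}.

Fixpoint class_C (m : nat) (f : V -> R) : Prop :=
  continuous f /\
  if m is m'.+1 then
    forall v, (forall x, derivable f x v) /\ class_C m' (fun x => 'D_v f x)
  else True.

Definition smooth (f : V -> R) := forall m, class_C m f.

Definition supp (f : V -> R) : set V := closure [set x | f x != 0].

Definition test_function (f : V -> R) := smooth f /\ compact (supp f).

End smooth.

Section sobolev.
Context {R : realType} {n : nat}.
Implicit Types (f g : 'rV[R]_n -> R) (k : nat).

Local Notation mu := (@lebesgue_rV R n).

Definition is_weak_partial (i : 'I_n) f g := forall phi : 'rV[R]_n -> R,
  test_function phi ->
  \int[mu]_x (f x * 'D_('e_i) phi x) = - \int[mu]_x (g x * phi x).

(* A square-integrable representative of the i-th weak partial derivative of f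
   (unique a.e.), or 0 if there is none. *)
Definition weak_partial (i : 'I_n) f : 'rV[R]_n -> R :=
  xget (cst 0) [set g | g \in Lfun mu 2%:E /\ is_weak_partial i f g].

(* H^k(R^n), with H^0 = L^2. *)
Fixpoint sobolev k f : Prop :=
  f \in Lfun mu 2%:E /\
  if k is k'.+1 then
    forall i : 'I_n, exists2 g, is_weak_partial i f g & sobolev k' g
  else True.

Fixpoint sobolev_sqnorm k f : \bar R :=
  ('N[mu]_2%:E[EFin \o f] ^+ 2 +
   if k is k'.+1 then \sum_(i < n) sobolev_sqnorm k' (weak_partial i f)
   else 0)%E.

Definition sobolev_norm k f : \bar R := sqrte (sobolev_sqnorm k f).

(* The support of a class of a.e. equal functions. *)
Definition ess_supp f : set 'rV[R]_n :=
  [set x | forall r, 0 < r -> ~ {ae mu, forall y, ball x r y -> f y = 0}].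

Definition eucl_norm (x : 'rV[R]_n) : R := Num.sqrt (\sum_i x ord0 i ^+ 2).

Definition eucl_ball (rho : R) : set 'rV[R]_n := [set x | eucl_norm x <= rho].

End sobolev.

Section time_dependent.
Context {R : realType} {n : nat}.
Implicit Types (T : \bar R) (k : nat) (u v : R -> 'rV[R]_n -> R).

Local Notation mu := (@lebesgue_rV R n).

(* [0, T), with T possibly infinite. *)
Definition lifetime T : set R := [set t | 0 <= t /\ (t%:E < T)%E].

Definition continuous_H k T u := forall t, lifetime T t ->
  sobolev k (u t) /\
  sobolev_norm k (u s \- u t) @[s --> within (lifetime T) (nbhs t)] --> 0%E.

(* v is the derivative of u : [0, T) -> H^k (one-sided at 0). *)
Definition derivative_H k T u v := forall t, lifetime T t ->
  sobolev k (v t) /\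
  sobolev_norm k (fun x => (s - t)^-1 * (u s x - u t x) - v t x)
    @[s --> within (lifetime T) t^'] --> 0%E.

(* u belongs to C^m([0, T), H^k(R^n)). *)
Fixpoint class_CH (m : nat) k T u : Prop :=
  continuous_H k T u /\
  if m is m'.+1 then exists2 v, derivative_H k T u v & class_CH m' k T v
  else True.

(* u belongs to L^p_loc([0, T) * R^n). *)
Definition Lp_loc (p : R) T u :=
  let U := fun z : measurableTypeR R * 'rV[R]_n => u z.1 z.2 in
  let Q := lifetime T `*` [set: 'rV[R]_n] in
  measurable_fun Q U /\
  forall K : set (R * 'rV[R]_n), compact K -> K `<=` Q ->
    (\int[@lebesgue_measure R \x mu]_(z in K) (`|U z| `^ p)%:E < +oo)%E.

(* Restrictions to [0, T) * R^n of elements of C_0^oo([0, T) * R^n): functions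
   smooth up to t = 0 are restrictions of functions smooth for all times, and
   no vanishing is imposed at t = 0. *)
Definition spacetime_test T (psi : R * 'rV[R]_n -> R) :=
  test_function psi /\ supp psi `<=` [set z | (z.1%:E < T)%E].

Definition dt (psi : R * 'rV[R]_n -> R) (s : R) (x : 'rV[R]_n) : R :=
  'D_((1, 0) : R * 'rV[R]_n) psi (s, x).

Definition dx (i : 'I_n) (psi : R * 'rV[R]_n -> R) (s : R) (x : 'rV[R]_n) : R :=
  'D_((0, 'e_i) : R * 'rV[R]_n) psi (s, x).

(* Energy solutions on [0, T) of
     beta u_ttt + u_tt - Delta u - beta Delta u_t = |u|^p,
     (u, u_t, u_tt)(0) = eps (u0, u1, u2). *)
Definition energy_solution (beta p eps : R) (u0 u1 u2 : 'rV[R]_n -> R) T u :=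
  [/\ class_CH 0 2 T u, class_CH 1 1 T u, class_CH 2 0 T u & Lp_loc p T u] /\
  exists ut utt : R -> 'rV[R]_n -> R,
  [/\ derivative_H 1 T u ut,
      derivative_H 0 T ut utt,
      {ae mu, forall x, u 0 x = eps * u0 x},
      {ae mu, forall x, ut 0 x = eps * u1 x} &
      forall psi, spacetime_test T psi -> forall t, lifetime T t ->
        beta * \int[mu]_x (utt t x * psi (t, x))
        + \int[mu]_x (ut t x * psi (t, x))
        - beta * eps * \int[mu]_x (u2 x * psi (0, x))
        - eps * \int[mu]_x (u1 x * psi (0, x))
        + beta * \int[lebesgue_measure]_(s in `[0, t]) \int[mu]_x
            (\sum_(i < n) weak_partial i (ut s) x * dx i psi s x
             - utt s x * dt psi s x)
        + \int[lebesgue_measure]_(s in `[0, t]) \int[mu]_x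
            (\sum_(i < n) weak_partial i (u s) x * dx i psi s x
             - ut s x * dt psi s x)
        = \int[lebesgue_measure]_(s in `[0, t]) \int[mu]_x
            (`|u s x| `^ p * psi (s, x))].

(* supp u(t, .) is contained in B_(r + t) for all t in (0, T). *)
Definition supp_in_cone (r : R) T u := forall t, 0 < t -> (t%:E < T)%E ->
  ess_supp (u t) `<=` eucl_ball (r + t).

(* T is the lifespan of an energy solution u on [0, T): u cannot be continued beyond T
   within the class of energy solutions supported in the cone. *)
Definition is_lifespan (beta p eps r : R) (u0 u1 u2 : 'rV[R]_n -> R) T u :=
  forall T' v, (T < T')%E -> energy_solution beta p eps u0 u1 u2 T' v ->
    supp_in_cone r T' v ->
    ~ (forall t, lifetime T t -> {ae mu, forall x, v t x = u t x}).

End time_dependent.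

Section strauss.
Context {R : realType}.

Definition strauss_exponent (n : nat) : R :=
  xget 0 [set q | 0 < q /\ (n%:R - 1) * q ^+ 2 - (n%:R + 1) * q - 2 = 0].

Lemma strauss_exponentP (n : nat) : (2 <= n)%N ->
  0 < strauss_exponent n /\
  (n%:R - 1) * strauss_exponent n ^+ 2 - (n%:R + 1) * strauss_exponent n - 2 = 0.
Proof.
move=> n2; rewrite /strauss_exponent.
have a0 : 0 < n%:R - 1 :> R by rewrite subr_gt0 (ltr_nat R 1 n).
case: xgetP => [q _ //|noroot].
pose a : R := n%:R - 1; pose b : R := n%:R + 1.
pose D := b ^+ 2 + 8 * a; pose q := (b + Num.sqrt D) / (2 * a).
have b0 : 0 < b by rewrite ltr_wpDl.
have D0 : 0 <= D by rewrite addr_ge0 ?sqr_ge0// mulr_ge0// ltW.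
exfalso; apply: (noroot q); split.
  by rewrite divr_gt0 ?mulr_gt0// ltr_wpDr// sqrtr_ge0.
rewrite -/a -/b; have aN0 : a != 0 by rewrite gt_eqF.
have -> : a * q ^+ 2 - b * q - 2 =
    (Num.sqrt D ^+ 2 - b ^+ 2 - 8 * a) / (4 * a) by rewrite /q; field.
by rewrite sqr_sqrtr// /D; field.
Qed.

Definition theta (p : R) (n : nat) : R :=
  2 + (n%:R + 1) * p - (n%:R - 1) * p ^+ 2.

End strauss.

(* Main.v *)
Require Import Defs.
From mathcomp Require Import all_boot all_order all_algebra.
From mathcomp Require Import all_classical all_reals all_analysis measurable_realfun.
From mathcomp Require Import ring lra.

(** The proof is by the test function method. Fix a time [T1] between 1 and [T] and test
    the equation with products [z (t) phi (x)], where [z] vanishes at [T1] together with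
    its first two derivatives and [phi] satisfies [Laplacian phi = c phi] on the light
    cone that contains the support of [u], with [c = 0] or [c = 1]. Moving all the
    derivatives onto the test function ([weak_identity], [tested_identity]), and dropping
    nonnegative contributions of the data ([tested_le]), one finds that the integral of
    [|u| ^ p z phi], plus [c eps] times the integral of [u0 phi], is at most the absolute
    value of the integral of [u phi] against [z] transformed by the adjoint of the equation
    in time.

    For [c = 0] take [phi = 1] on the cone and for [z] a cutoff [eta] in the variable
    [t / T1]. The adjoint produces a factor [T1 ^ -2], and the Young inequality absorbs half
    of the integral [I] of [eta |u| ^ p]. With [q] conjugate to [p], what remains is
    [I <= C T1 ^ (n + 1 - 2 q)] ([power_integral_le]).

    For [c = 1] take for [phi] the radial eigenfunction, which grows like
    [exp |x| |x| ^ (- (n - 1) / 2)] ([eigen_fun_growth]), and [z = exp (- t) eta]. The adjoint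
    annihilates [exp (- t)], so a factor [1 / T1] is gained from [eta]. The mass of
    [(exp (- t) phi) ^ q] in the cone at time [t] concentrates near the sphere [|x| = t] and
    is of order [t ^ a], [a = (n - 1) (1 - q / 2)] ([cone_weight_integral]). The Young
    inequality with a free parameter [k] then bounds [eps] times a positive constant by
    [k ^ p I + C k ^ (- q) T1 ^ (1 + a - q)] ([data_integral_le]).

    Inserting the bound of [I] and choosing for [k] the best power of [T1] gives
    [eps <= C T1 ^ (- theta / (2 p (p - 1)))] ([lifespan_inequality]). As [theta > 0] below
    the Strauss exponent ([theta_gt0]), this bounds [T1], and [T1 < T] was arbitrary. *)

Set Implicit Arguments.
Unset Strict Implicit.
Unset Printing Implicit Defensive.

Import Order.TTheory GRing.Theory Num.Theory.
Import numFieldNormedType.Exports.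

Local Open Scope classical_set_scope.
Local Open Scope ring_scope.

(** * Smooth functions *)

Section class_C_theory.
Context {R : realType} {V : normedModType R}.
Implicit Types (f g : V -> R).

Lemma class_C_continuous m f : class_C m f -> continuous f.
Proof. by case: m => [|m] []. Qed.

Lemma class_CS m f : class_C m.+1 f -> class_C m f.
Proof.
elim: m f => [|m IH] f [cf Df]; first by [].
by split => // v; have [dv Cv] := Df v; split => //; exact: IH.
Qed.

(** Smoothness quantifies over all orders of iterated derivatives; exhibiting a family
    that is closed under directional derivatives avoids an induction on the order each
    time. *)
Lemma smooth_coinduction (S : set (V -> R)) :
  (forall f, S f -> continuous f /\ forall v,
     (forall x, derivable f x v) /\ S (fun x => 'D_v f x)) ->
  S `<=` smooth.
Proof.
move=> HS f Sf m; elim: m f Sf => [|m IH] f /HS[cf Df]; first by split.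
by split => // v; have [dv Sv] := Df v; split => //; exact: IH.
Qed.

Lemma smoothP f : smooth f <-> continuous f /\ forall v,
  (forall x, derivable f x v) /\ smooth (fun x => 'D_v f x).
Proof.
split=> [sf|[cf Df] [|m]]; last by split => // v; have [] := Df v.
  split; first exact: class_C_continuous (sf 0%N).
  move=> v; split=> [|m]; first by have [_ /(_ v)[]] := sf 1%N.
  by have [_ /(_ v)[]] := sf m.+1.
by split.
Qed.

Lemma class_C_cst m (k : R) : class_C m (fun _ : V => k).
Proof.
move: m; apply: (@smooth_coinduction [set f | exists k, f = (fun=> k)]); last first.
  by exists k.
move=> _ [c ->]; split; first exact: cst_continuous.
move=> v; split=> [x|]; first exact: derivable_cst.
by exists 0; apply/funext => x; exact: derive_cst.
Qed.

Lemma class_CD m f g : class_C m f -> class_C m g -> class_C m (fun x => f x + g x).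
Proof.
elim: m f g => [|m IH] f g [cf Df] [cg Dg]; split=> //;
  try (by move=> x; apply: continuousD; [exact: cf|exact: cg]).
move=> v.
have [dfv Cfv] := Df v; have [dgv Cgv] := Dg v; split=> [x|].
  exact: derivableD.
by under eq_fun do rewrite deriveD//; exact: IH.
Qed.

Lemma class_CM m f g : class_C m f -> class_C m g -> class_C m (fun x => f x * g x).
Proof.
elim: m f g => [|m IH] f g Cf Cg; have [cf Df] := Cf; have [cg Dg] := Cg;
  split=> //; try (by move=> x; apply: continuousM; [exact: cf|exact: cg]).
move=> v.
have [dfv Cfv] := Df v; have [dgv Cgv] := Dg v; split=> [x|].
  exact: derivableM.
under eq_fun do rewrite deriveM//; rewrite /= .
by apply: class_CD; apply: IH => //; exact: class_CS.
Qed.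

Lemma class_C_sum m I (s : seq I) (F : I -> V -> R) :
  (forall i, class_C m (F i)) -> class_C m (fun x => \sum_(i <- s) F i x).
Proof.
move=> CF; elim: s => [|i s IH].
  by under eq_fun do rewrite big_nil; exact: class_C_cst.
by under eq_fun do rewrite big_cons; exact: class_CD.
Qed.

Lemma is_derive_scalar f x v : scalar f -> is_derive x v f (f v).
Proof.
move=> lf.
have Df h : h != 0 -> h^-1 *: ((f \o shift x) (h *: v) - f x) = f v.
  move=> h0; rewrite /= lf addrK /=.
  by rewrite /GRing.scale/= mulrA mulVf// mul1r.
have cvgf : h^-1 *: ((f \o shift x) (h *: v) - f x) @[h --> 0^'] --> f v.
  apply: (@cvg_trans _ ((fun=> f v) @ (0 : R)^')); last exact: cvg_cst.
  apply: near_eq_cvg; near=> h; rewrite Df//.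
  by near: h; exact: nbhs_dnbhs_neq.
split; last exact/cvg_lim.
by apply/cvg_ex; exists (f v); exact: cvgf.
Unshelve. all: by end_near. Qed.

Lemma smooth_scalar f : scalar f -> continuous f -> smooth f.
Proof.
move=> lf cf [|m]; split => // v; split=> [x|]; first by have [] := is_derive_scalar x v lf.
rewrite (_ : (fun x => 'D_v f x) = fun=> f v); first exact: class_C_cst.
by apply/funext => x; have [] := is_derive_scalar x v lf.
Qed.

(** A derivative in a fixed direction only sees the restriction of the function
    to a line, so the chain rule for one real variable is enough. *)
Lemma is_derive_comp (f : V -> R) (g : R -> R) x v df dg :
  is_derive x v f df -> is_derive (f x) 1 g dg ->
  is_derive x v (g \o f) (dg * df).
Proof.
move=> [dvf Ef] [dvg Eg].
pose l (h : R) := f (h *: v + x).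
have El (k : V -> R) : (fun h : R => h^-1 *: ((k \o shift x) (h *: v) - k x)) =
    (fun h : R => h^-1 *: (((fun h => k (h *: v + x)) \o shift 0) (h *: 1) - k (0 *: v + x))).
  by apply/funext => h /=; rewrite scale0r add0r addr0 /GRing.scale/= mulr1.
have il : is_derive (0 : R) 1 l df.
  by split; rewrite /derivable /derive -(El f).
have l0 : l 0 = f x by rewrite /l scale0r add0r.
have ig : is_derive (l 0) 1 g dg by rewrite l0.
have := is_derive1_comp ig il; rewrite /GRing.scale/= => -[d E]; split.
  by rewrite /derivable (El (g \o f)).
rewrite /derive (El (g \o f)). exact: E.
Qed.

Lemma class_C_comp m f (g : R -> R) :
  class_C m g -> class_C m f -> class_C m (g \o f).
Proof.
elim: m f g => [|m IH] f g Cg Cf; have [cf Df] := Cf; have [cg Dg] := Cg;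
  split => //; try (by move=> x; apply: continuous_comp; [exact: cf|exact: cg]).
move=> v.
have [dfv Cfv] := Df v; have [dg1 Cg1] := Dg 1.
have idc x : is_derive x v (g \o f) ('D_1 g (f x) * 'D_v f x).
  by apply: is_derive_comp; apply: derivableP.
split=> [x|]; first by have [] := idc x.
rewrite (_ : (fun x => _) = fun x => 'D_1 g (f x) * 'D_v f x).
  by apply: class_CM => //; apply: (IH f (fun y => 'D_1 g y)) => //; exact: class_CS.
by apply/funext => x; have [] := idc x.
Qed.

End class_C_theory.

Section smooth_theory.
Context {R : realType} {V : normedModType R}.
Implicit Types (f g : V -> R).

Lemma smooth_cst (k : R) : smooth (fun _ : V => k).
Proof. by move=> m; exact: class_C_cst. Qed.

Lemma smoothD f g : smooth f -> smooth g -> smooth (fun x => f x + g x).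
Proof. by move=> sf sg m; apply: class_CD. Qed.

Lemma smoothM f g : smooth f -> smooth g -> smooth (fun x => f x * g x).
Proof. by move=> sf sg m; apply: class_CM. Qed.

Lemma smooth_comp f (g : R -> R) : smooth g -> smooth f -> smooth (g \o f).
Proof. by move=> sg sf m; apply: class_C_comp. Qed.

Lemma smooth_derivable f x v : smooth f -> derivable f x v.
Proof. by move=> /smoothP[_ /(_ v)[]]. Qed.

Lemma smooth_derive f v : smooth f -> smooth (fun x => 'D_v f x).
Proof. by move=> /smoothP[_ /(_ v)[]]. Qed.

Lemma smooth_continuous f : smooth f -> continuous f.
Proof. by case/smoothP. Qed.

End smooth_theory.

Section smooth1.
Context {R : realType}.
Implicit Types f g : R -> R.

Lemma derive_real f (x v df : R) : is_derive x 1 f df -> is_derive x v f (v * df).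
Proof.
move=> [d E]; have df' : differentiable f x by exact/derivable1_diffP.
split; first exact: diff_derivable.
by rewrite deriveE// deriv1E// derive1E E.
Qed.

(** A family of functions of one variable that is stable under differentiation,
    up to constant factors, consists of smooth functions. *)
Lemma smooth_coinduction1 (S : set (R -> R)) :
  (forall f, S f -> exists2 g, S g & forall x, is_derive x (1:R) f (g x)) ->
  (forall f (k : R), S f -> S (fun x => k * f x)) ->
  S `<=` smooth.
Proof.
move=> HS HZ; apply: smooth_coinduction => f /HS[g Sg fg]; split.
  move=> x; apply: differentiable_continuous; apply/derivable1_diffP.
  by have [] := fg x.
move=> v; split=> [x|]; first by have [] := derive_real v (fg x).
rewrite (_ : (fun x => _) = fun x => v * g x); first exact: HZ.
by apply/funext => x; have [] := derive_real v (fg x).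
Qed.

Lemma smooth_horner (q : {poly R}) : smooth (horner q).
Proof.
apply: (@smooth_coinduction1 [set f | exists q : {poly R}, f = horner q]); last by exists q.
  by move=> _ [p ->]; exists (horner p^`()); [exists p^`()|move=> x; exact: is_derive_poly].
by move=> _ k [p ->]; exists (k%:P * p); apply/funext => x; rewrite hornerM hornerC.
Qed.

End smooth1.

(** * Smooth step functions *)

Section flat_functions.
Context {R : realType}.

Lemma exprn_le_expR (y : R) (i : nat) : 0 <= y -> y ^+ i <= i`!%:R * expR y.
Proof.
move=> y0; rewrite mulrC -ler_pdivrMr ?ltr0n ?fact_gt0//.
case: i => [|i]; first by rewrite expr0 fact0 divr1 -expR0 ler_expR.
by rewrite (le_trans _ (expR_ge1Dxn i y0))// lerDr.
Qed.

Lemma horner_le_expR (q : {poly R}) :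
  exists2 C, 0 <= C & forall y, 0 <= y -> `|q.[y]| <= C * expR y.
Proof.
exists (\sum_(i < size q) `|q`_i| * i`!%:R).
  by apply: sumr_ge0 => i _; rewrite mulr_ge0.
move=> y y0; rewrite horner_coef (le_trans (ler_norm_sum _ _ _))// mulr_suml.
apply: ler_sum => i _; rewrite normrM -mulrA ler_wpM2l// normrX ger0_norm//.
exact: exprn_le_expR.
Qed.

(** The derivatives of [exp (- 1 / x)] are of this form, with [q] a polynomial. *)
Definition flat (q : {poly R}) (x : R) : R :=
  if 0 < x then q.[x^-1] * expR (- x^-1) else 0.

(** The exponential beats every power of [1 / x]; a quadratic bound is all that the
    derivative at 0 requires. *)
Lemma flat_le_sqr q : exists2 C, 0 <= C & forall x, `|flat q x| <= C * x ^+ 2.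
Proof.
have [C C0 HC] := horner_le_expR (q * 'X^2); exists C => // x; rewrite /flat.
case: ifPn => x0; last by rewrite normr0 mulr_ge0// sqr_ge0.
have := HC x^-1; rewrite invr_ge0 ltW// => /(_ isT).
rewrite hornerM hornerXn normrM exprVn normfV (ger0_norm (sqr_ge0 x)).
rewrite ler_pdivrMr ?exprn_gt0// => H.
rewrite normrM (ger0_norm (expR_ge0 _)) expRN ler_pdivrMr ?expR_gt0//.
by rewrite mulrAC.
Qed.

Lemma is_derive_sqr_bound (g : R -> R) (x0 C : R) :
  (forall x, `|g x| <= C * (x - x0) ^+ 2) -> is_derive x0 (1:R) g 0.
Proof.
move=> H.
have g0 : g x0 = 0.
  by apply/eqP; rewrite -normr_le0 (le_trans (H _))// subrr expr0n mulr0.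
have C0 : 0 <= C by have := le_trans (normr_ge0 _) (H (x0 + 1)); rewrite addrAC subrr add0r expr1n mulr1.
have : h^-1 *: ((g \o shift x0) (h *: (1:R)) - g x0) @[h --> 0^'] --> (0 : R).
  apply/cvgr0Pnorm_le => e e0; near=> h.
  have h0 : h != 0 by near: h; exact: nbhs_dnbhs_neq.
  rewrite /= g0 subr0 /GRing.scale/= mulr1 normrM normfV ler_pdivrMl ?normr_gt0//.
  apply: le_trans (H _) _; rewrite addrK -real_normK ?num_real// expr2 mulrA mulrC.
  rewrite ler_wpM2l//.
  have : `|h| <= e / (C + 1).
    near: h; apply: dnbhs0_le; by rewrite divr_gt0// ltr_wpDl.
  move=> he; rewrite (le_trans (ler_wpM2l C0 he))// mulrCA ler_piMr ?(ltW e0)//.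
  by rewrite ler_pdivrMr ?ltr_wpDl// mul1r lerDl.
move=> cv; split; first by apply/cvg_ex; exists 0.
exact/cvg_lim.
Unshelve. all: by end_near. Qed.

Lemma is_derive_flat q x :
  is_derive x (1:R) (flat q) (flat ('X^2 * (q - q^`())) x).
Proof.
have [x0|x0|->] := ltgtP x 0.
- have -> : flat ('X^2 * (q - q^`())) x = 0 by rewrite /flat ltNge ltW.
  apply: (@near_eq_is_derive _ _ _ (cst 0)).
  by near=> y; rewrite /flat ltNge ltW//; near: y; exact: lt_nbhsl.
- have xN0 : x != 0 by rewrite gt_eqF.
  have dV : is_derive x (1:R) (fun y => y^-1) (- x ^- 2).
    split; first by apply: derivableV.
    by rewrite deriveV//= derive_id /GRing.scale/= mulr1.
  have d1 : is_derive x (1:R) (horner q \o (fun y => y^-1)) (q^`().[x^-1] * - x ^- 2).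
    exact: is_derive_comp.
  have d2 : is_derive x (1:R) (expR \o (fun y => - y^-1)) (expR (- x^-1) * x ^- 2).
    apply: is_derive_comp.
    by rewrite -[x ^- 2]opprK; apply: is_deriveN.
  have d3 := is_deriveM d1 d2.
  apply: (near_eq_is_derive _ (is_derive_eq d3 _)).
    by near=> y; rewrite /flat ifT//; near: y; exact: lt_nbhsr.
  by rewrite /flat x0 !hornerE /GRing.scale/= exprVn; ring.
- have [C C0 HC] := flat_le_sqr q.
  have -> : flat ('X^2 * (q - q^`())) 0 = 0 by rewrite /flat ltxx.
  by apply: (@is_derive_sqr_bound _ _ C) => y; rewrite subr0.
Unshelve. all: by end_near. Qed.

Lemma smooth_flat q : smooth (flat q).
Proof.
apply: (@smooth_coinduction1 R [set f | exists q, f = flat q]); last by exists q.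
  move=> _ [p ->]; exists (flat ('X^2 * (p - p^`()))); last exact: is_derive_flat.
  by exists ('X^2 * (p - p^`())).
move=> _ k [p ->]; exists (k%:P * p); apply/funext => x.
by rewrite /flat; case: ifP; rewrite ?mulr0// hornerM hornerC mulrA.
Qed.

Lemma flat_eq0 x : x <= 0 -> flat 1 x = 0.
Proof. by move=> x0; rewrite /flat ltNge x0. Qed.

Lemma flat_gt0 x : 0 < x -> 0 < flat 1 x.
Proof. by move=> x0; rewrite /flat x0 hornerC mul1r expR_gt0. Qed.

Lemma flat_ge0 x : 0 <= flat 1 x.
Proof. by have [/flat_eq0->//|/flat_gt0/ltW] := leP x 0. Qed.

Lemma le_flat : {homo flat 1 : x y / x <= y}.
Proof.
move=> x y xy; have [x0|x0] := leP x 0; first by rewrite (flat_eq0 x0) flat_ge0.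
have y0 := lt_le_trans x0 xy.
by rewrite /flat x0 y0 !hornerC !mul1r ler_expR lerN2 lef_pV2.
Qed.

(** A smooth function equal to 1 up to [a] and to 0 from [b] on: the inner flat
    function reaches the value [flat 1 (b - a)] exactly at [b]. *)
Definition smooth_step (a b x : R) : R :=
  flat 1 (flat 1 (b - a) - flat 1 (x - a)) / flat 1 (flat 1 (b - a)).

Lemma smooth_smooth_step a b : smooth (smooth_step a b).
Proof.
have -> : smooth_step a b = (fun x =>
    (flat 1 \o (fun x => flat 1 (b - a) + (horner (-1)%:P x) *
       ((flat 1 \o (horner ('X - a%:P))) x))) x * cst (flat 1 (flat 1 (b - a)))^-1 x).
  by apply/funext => x; rewrite /smooth_step /= !hornerE mulN1r.
apply: smoothM; last exact: smooth_cst.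
apply: smooth_comp; first exact: smooth_flat.
apply: smoothD; first exact: smooth_cst.
apply: smoothM; first exact: smooth_horner.
apply: smooth_comp; first exact: smooth_flat.
exact: smooth_horner.
Qed.

Lemma smooth_step1 a b x : a < b -> x <= a -> smooth_step a b x = 1.
Proof.
move=> ab xa; rewrite /smooth_step (@flat_eq0 (x - a)) ?subr_le0// subr0 divff//.
by rewrite gt_eqF// !flat_gt0// subr_gt0.
Qed.

Lemma smooth_step0 a b x : b <= x -> smooth_step a b x = 0.
Proof.
by move=> bx; rewrite /smooth_step flat_eq0 ?mul0r// subr_le0 le_flat// lerB.
Qed.

Lemma smooth_step_ge0 a b x : 0 <= smooth_step a b x.
Proof. by rewrite /smooth_step divr_ge0 ?flat_ge0. Qed.

Lemma smooth_step_le1 a b x : a < b -> smooth_step a b x <= 1.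
Proof.
move=> ab; rewrite /smooth_step ler_pdivrMr ?flat_gt0 ?subr_gt0//.
by rewrite mul1r le_flat// gerBl flat_ge0.
Qed.

End flat_functions.

(** * Entire series *)

Section entire_series.
Context {R : realType}.
Implicit Types (a b : R^nat).

(** Coefficients of an entire series, in a form stable under termwise
    differentiation. *)
Definition exp_bounded a :=
  exists C M : R, [/\ 0 <= C, 0 <= M & forall k, `|a k| <= C * (M ^+ k / k`!%:R)].

Definition series_sum a (x : R) : R := limn (pseries a x).

Lemma exp_bounded_cvg a x : exp_bounded a -> cvgn (pseries a x).
Proof.
move=> [C [M [C0 M0 aM]]]; apply: normed_cvg.
apply: (@series_le_cvg _ _ (C *: exp_coeff (M * `|x|))) => [n|n|n|] //=.
- by rewrite mulr_ge0// exp_coeff_ge0// mulr_ge0.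
- rewrite normrM normrX (_ : (C *: _) n = (C * (M ^+ n / n`!%:R)) * `|x| ^+ n).
    by rewrite ler_wpM2r// exprn_ge0.
  rewrite [LHS](_ : _ = C * ((M * `|x|) ^+ n / n`!%:R))//; rewrite exprMn; ring.
- by apply: is_cvg_seriesZ; exact: is_cvg_series_exp_coeff.
Qed.

Lemma exp_bounded_diffs a : exp_bounded a -> exp_bounded (pseries_diffs a).
Proof.
move=> [C [M [C0 M0 aM]]]; exists (C * M), M; split => //; first exact: mulr_ge0.
move=> k; rewrite /pseries_diffs normrM ger0_norm//.
rewrite (le_trans (ler_wpM2l _ (aM k.+1)))//.
rewrite le_eqVlt; apply/orP; left; apply/eqP.
have k0 : k.+1%:R != 0 :> R by rewrite pnatr_eq0.
rewrite factS natrM invfM exprS.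
rewrite [LHS](_ : _ = (k.+1%:R * k.+1%:R^-1) * (C * M * (M ^+ k / k`!%:R))); last by ring.
by rewrite divff// mul1r.
Qed.

Lemma is_derive_series_sum a x : exp_bounded a ->
  is_derive x (1:R) (series_sum a) (series_sum (pseries_diffs a) x).
Proof.
move=> ba; have b1 := exp_bounded_diffs ba; have b2 := exp_bounded_diffs b1.
apply: (@pseries_snd_diffs _ a (`|x| + 1)).
- exact: exp_bounded_cvg.
- exact: exp_bounded_cvg.
- exact: exp_bounded_cvg.
- by rewrite [ltRHS]ger0_norm ?ltrDl// addr_ge0.
Qed.

Lemma exp_boundedZ k a : exp_bounded a -> exp_bounded (fun i => k * a i).
Proof.
move=> [C [M [C0 M0 aM]]]; exists (`|k| * C), M; split => //; first exact: mulr_ge0.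
by move=> i; rewrite normrM -mulrA ler_wpM2l.
Qed.

(** Shifting replaces [k!] by [(k - 1)!]; the lost factor [k <= 2 ^ k] is absorbed
    into the geometric part of the bound. *)
Lemma exp_bounded_shift a : exp_bounded a ->
  exp_bounded (fun i => if i is j.+1 then a j else 0).
Proof.
move=> [C [M [C0 M0 aM]]]; exists C, (2 * (1 + M)); split => //.
  by rewrite mulr_ge0// addr_ge0.
case=> [|k]; first by rewrite normr0 expr0 fact0 divr1 mulr1.
rewrite (le_trans (aM k))// factS natrM. apply: ler_wpM2l => //.
rewrite ler_pdivlMr ?mulr_gt0 ?ltr0n ?fact_gt0//.
rewrite -mulrA [X in _ * X]mulrC -!mulrA divff ?pnatr_eq0 -?lt0n ?fact_gt0//.
rewrite mulr1 exprMn mulrC ler_pM ?exprn_ge0//.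
  by rewrite -natrX ler_nat ltnW// ltn_expl.
rewrite (@le_trans _ _ ((1 + M) ^+ k))//.
  by rewrite lerXn2r ?nnegrE ?addr_ge0// lerDr.
by rewrite exprS ler_peMl ?exprn_ge0 ?addr_ge0// lerDl.
Qed.

Lemma series_sumZ k a x : exp_bounded a ->
  series_sum (fun i => k * a i) x = k * series_sum a x.
Proof.
move=> ba; rewrite /series_sum.
have := @lim_seriesZ _ (fun i => a i * x ^+ i) k (exp_bounded_cvg (x:=x) ba).
rewrite /GRing.scale/= => <-; congr (limn _).
by apply/funext => m; rewrite /pseries /series/=; apply: eq_bigr => i _; rewrite -mulrA.
Qed.

Lemma series_sumD a b x : exp_bounded a -> exp_bounded b ->
  series_sum (fun i => a i + b i) x = series_sum a x + series_sum b x.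
Proof.
move=> ba bb; rewrite /series_sum.
have := @lim_seriesD _ (fun i => a i * x ^+ i) (fun i => b i * x ^+ i)
  (exp_bounded_cvg (x:=x) ba) (exp_bounded_cvg (x:=x) bb).
move=> <-; congr (limn _).
by apply/funext => m; rewrite /pseries /series/=; apply: eq_bigr => i _; rewrite mulrDl.
Qed.

Lemma series_sum_shift a x : exp_bounded a ->
  series_sum (fun i => if i is j.+1 then a j else 0) x = x * series_sum a x.
Proof.
move=> ba; rewrite /series_sum; apply/cvg_lim => //; rewrite -cvg_shiftS.
have -> : (fun n => pseries (fun i => if i is j.+1 then a j else 0) x n.+1) =
    (fun n => x * pseries a x n).
  apply/funext => m; rewrite /pseries /series/= big_nat_recl//= mul0r add0r.
  by rewrite mulr_sumr; apply: eq_bigr => i _; rewrite exprS mulrCA.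
by apply: cvgMr; exact: exp_bounded_cvg.
Qed.

Lemma smooth_series_sum a : exp_bounded a -> smooth (series_sum a).
Proof.
move=> ba; apply: (@smooth_coinduction1 R
    [set f | exists2 a, exp_bounded a & f = series_sum a]); last by exists a.
- move=> _ [b bb ->]; exists (series_sum (pseries_diffs b)).
    by exists (pseries_diffs b) => //; exact: exp_bounded_diffs.
  by move=> x; exact: is_derive_series_sum.
- move=> _ k [b bb ->]; exists (fun i => k * b i); last first.
    by apply/funext => x; rewrite series_sumZ.
  exact: exp_boundedZ.
Qed.

Lemma series_sum_ge0 a x : exp_bounded a -> (forall i, 0 <= a i) -> 0 <= x ->
  a 0%N <= series_sum a x.
Proof.
move=> ba a0 x0; apply: limr_ge; first exact: exp_bounded_cvg.
exists 1%N => // -[//|m] _ /=; rewrite /pseries /series/= big_nat_recl// expr0 mulr1.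
by rewrite lerDl sumr_ge0// => i _; rewrite mulr_ge0// exprn_ge0.
Qed.

End entire_series.

(** * The growing radial eigenfunction of the Laplacian *)

Section radial_eigenfunction.
Context {R : realType} (n : nat).
Hypothesis n_gt0 : (0 < n)%N.

(** Coefficients of the radial solution of [Laplacian Phi = Phi] on [R^n], as an
    entire series in [|x| ^ 2]; up to a constant it is the average of
    [exp (omega . x)] over unit vectors [omega]. *)
Fixpoint eigen_coef (k : nat) : R :=
  if k is k'.+1 then eigen_coef k' / (2 * k'.+1%:R * (2 * k' + n)%:R) else 1.

Lemma eigen_coef_gt0 k : 0 < eigen_coef k.
Proof.
by elim: k => [//|k IH] /=; rewrite divr_gt0// !mulr_gt0// ltr0n ?addn_gt0 ?n_gt0 ?orbT.
Qed.

Lemma eigen_coef_bounded : exp_bounded eigen_coef.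
Proof.
exists 1, 1; split => // k; rewrite mul1r expr1n mul1r ger0_norm ?(ltW (eigen_coef_gt0 k))//.
elim: k => [|k IH] /=; first by rewrite fact0 invr1.
have d0 : 0 < 2 * k.+1%:R * (2 * k + n)%:R :> R.
  by rewrite !mulr_gt0// ltr0n addn_gt0 n_gt0 orbT.
have ek := ltW (eigen_coef_gt0 k).
rewrite factS natrM [leRHS]invfM [leRHS]mulrC.
apply: ler_pM => //.
rewrite lef_pV2 ?posrE ?ltr0n//.
by rewrite -!natrM ler_nat mulnAC leq_pmull// muln_gt0 addn_gt0 n_gt0 orbT.
Qed.

Definition eigen_fun : R -> R := series_sum eigen_coef.

Let dfun := series_sum (pseries_diffs eigen_coef).
Let ddfun := series_sum (pseries_diffs (pseries_diffs eigen_coef)).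

Lemma smooth_eigen_fun : smooth eigen_fun.
Proof. exact/smooth_series_sum/eigen_coef_bounded. Qed.

(** For [phi x = f (|x| ^ 2)] one has
    [Laplacian phi = 4 s f'' + 2 n f'] at [s = |x| ^ 2], so this is the equation
    [Laplacian phi = phi]; it is checked coefficient by coefficient. *)
Lemma eigen_fun_ode : exists f1 f2 : R -> R,
  [/\ forall s, is_derive s (1:R) eigen_fun (f1 s),
      forall s, is_derive s (1:R) f1 (f2 s),
      forall s, 4 * s * f2 s + 2 * n%:R * f1 s = eigen_fun s &
      forall s, 0 <= s -> 0 <= f1 s].
Proof.
have b0 := eigen_coef_bounded; have b1 := exp_bounded_diffs b0.
have b2 := exp_bounded_diffs b1.
exists dfun, ddfun; split => [s|s|s|s s0].
- exact: is_derive_series_sum.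
- exact: is_derive_series_sum.
- have b3 := exp_bounded_shift b2.
  rewrite -mulrA /ddfun /dfun -series_sum_shift// -!series_sumZ//.
  rewrite -series_sumD; [|exact: exp_boundedZ..].
  congr (series_sum _ s); apply/funext => -[|k]; rewrite /pseries_diffs/=.
    by rewrite muln0 add0n; field; rewrite pnatr_eq0 -lt0n n_gt0.
  move: (eigen_coef k / _) => E; rewrite natrD natrM.
  have H1 : k.+2%:R != 0 :> R by rewrite pnatr_eq0.
  have H2 : 2 * k.+1%:R + n%:R != 0 :> R by rewrite gt_eqF// ltr_pwDl// mulr_gt0.
  by field; apply/andP.
- rewrite (le_trans _ (series_sum_ge0 b1 _ s0))//; last first.
    by move=> i; rewrite mulr_ge0// ltW// eigen_coef_gt0.
  by rewrite mulr_ge0// ltW// eigen_coef_gt0.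
Qed.

Lemma eigen_fun_ge1 s : 0 <= s -> 1 <= eigen_fun s.
Proof.
apply: series_sum_ge0 eigen_coef_bounded _ => i.
exact/ltW/eigen_coef_gt0.
Qed.

End radial_eigenfunction.

Section eigenfunction_growth.
Context {R : realType} (n : nat).
Hypothesis n_gt0 : (0 < n)%N.

Let b : R := (n%:R - 1) / 2.

Let b_ge0 : 0 <= b.
Proof. by rewrite divr_ge0// subr_ge0 ler1n. Qed.

Lemma eigen_fun_le (x y : R) : 0 <= x -> x <= y -> eigen_fun n x <= eigen_fun n y.
Proof.
have [f1 [f2 [d1 d2 _ f1_ge0]]] := @eigen_fun_ode R n n_gt0.
move=> x0 xy.
apply: (@ger0_derive1_ndecry _ (eigen_fun n) 0) => //.
- move=> z; rewrite in_itv/= andbT => /ltW z0.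
  by have [_] := d1 z; rewrite derive1E => ->; exact: f1_ge0.
- apply: continuous_subspaceT; apply: smooth_continuous; exact: smooth_eigen_fun.
Qed.

(** With [g rho = eigen_fun (rho ^ 2)], the equation [g'' + (n - 1) / rho g' = g]
    makes [rho ^ b * (g' + g + b / rho g)] grow like [exp rho]: up to an integrable
    correction [b ^ 2 / rho ^ 2] its logarithmic derivative is at most 1. *)
Lemma eigen_fun_growth : exists2 C : R, 0 < C & forall rho, 0 <= rho ->
  eigen_fun n (rho ^+ 2) <= C * expR rho * (1 + rho) `^ (- b).
Proof.
have [f1 [f2 [d1 d2 ode f1_ge0]]] := @eigen_fun_ode R n n_gt0.
pose f := @eigen_fun R n.
(* [L] is [g' + g + (b / x) g] for [g x = f (x ^ 2)]; the exponential in [W] is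
   [exp (- x) * x ^ b] times the integrating factor [exp (b ^ 2 / x)] that absorbs the
   error terms, so that [W] decreases. *)
pose L (x : R) := 2 * x * f1 (x ^+ 2) + f (x ^+ 2) + b * (x^-1 * f (x ^+ 2)).
pose W (x : R) := expR (- x + b * ln x + b ^+ 2 * x^-1) * L x.
have f_ge0 (x : R) : 0 <= f (x ^+ 2).
  by rewrite (le_trans ler01)// eigen_fun_ge1// sqr_ge0.
have gL (x : R) : 0 < x -> f (x ^+ 2) <= L x.
  move=> x0; rewrite /L -addrA addrCA lerDl addr_ge0//.
    by rewrite !mulr_ge0 ?(ltW x0)// f1_ge0// sqr_ge0.
  by apply: mulr_ge0 => //; apply: mulr_ge0 (f_ge0 x); rewrite invr_ge0 ltW.
have dsq (x : R) : is_derive x (1:R) (fun y : R => y ^+ 2) (2 * x).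
  have D := is_deriveM (is_derive_id x (1:R)) (is_derive_id x (1:R)).
  by apply: (is_derive_eq D); rewrite /GRing.scale/=; ring.
have dV (x : R) : 0 < x -> is_derive x (1:R) (fun y : R => y^-1) (- x ^- 2).
  move=> x0; have xN0 : x != 0 by rewrite gt_eqF.
  split; first by apply: derivableV.
  by rewrite deriveV//= derive_id /GRing.scale/= mulr1.
have df (x : R) : is_derive x (1:R) (f \o (fun y => y ^+ 2)) (f1 (x ^+ 2) * (2 * x)).
  by apply: is_derive_comp.
have df1 (x : R) : is_derive x (1:R) (f1 \o (fun y => y ^+ 2)) (f2 (x ^+ 2) * (2 * x)).
  by apply: is_derive_comp.
pose dL (x : R) := 2 * f1 (x ^+ 2) + 2 * x * (f2 (x ^+ 2) * (2 * x)) +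
  f1 (x ^+ 2) * (2 * x) +
  b * (x^-1 * (f1 (x ^+ 2) * (2 * x)) - x ^- 2 * f (x ^+ 2)).
have hL (x : R) : 0 < x -> is_derive x (1:R) L (dL x).
  move=> x0; have dVx := dV x x0.
  have dfx := df x; have df1x := df1 x.
  have D1 : is_derive x (1:R) (fun y : R => 2 * y) 2.
    by have := is_deriveZ (2:R) (is_derive_id x (1:R)); rewrite /GRing.scale/= mulr1.
  have D2 := is_deriveM D1 df1x.
  have D3 := is_deriveM dVx dfx.
  have D4 := is_deriveZ b D3.
  have := is_deriveD (is_deriveD D2 dfx) D4 => /is_derive_eq; apply.
  rewrite /dL /GRing.scale/=; ring.
pose dW (x : R) := expR (- x + b * ln x + b ^+ 2 * x^-1) *
  ((- 1 + b * x^-1 - b ^+ 2 * x ^- 2) * L x + dL x).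
have hW (x : R) : 0 < x -> is_derive x (1:R) W (dW x).
  move=> x0; have dVx := dV x x0.
  have D1 : is_derive x (1:R) (fun y => - y + b * ln y + b ^+ 2 * y^-1)
      (- 1 + b * x^-1 + b ^+ 2 * - x ^- 2).
    exact: (is_deriveD (is_deriveD (is_deriveNid x (1:R))
      (is_deriveZ b (is_derive1_ln x0))) (is_deriveZ (b ^+ 2) dVx)).
  have D2 := is_derive_comp D1 (is_derive_expR _).
  have D3 := is_deriveM D2 (hL x x0).
  apply: (is_derive_eq D3).
  rewrite /dW /GRing.scale/=; ring.
have dW_le0 (x : R) : 0 < x -> dW x <= 0.
  move=> x0; rewrite /dW pmulr_rle0 ?expR_gt0//.
  have xN0 : x != 0 by rewrite gt_eqF.
  have -> : (- 1 + b * x^-1 - b ^+ 2 * x ^- 2) * L x + dL x =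
      - (x ^- 2 * (b * f (x ^+ 2) + b ^+ 2 * (L x - f (x ^+ 2)))).
    rewrite /dL -(mulrC (2 * x)).
    have -> : 2 * x * (2 * x * f2 (x ^+ 2)) = f (x ^+ 2) - 2 * n%:R * f1 (x ^+ 2).
      by rewrite /f -ode; ring.
    have -> : n%:R = 2 * b + 1 by rewrite /b; field.
    rewrite /L; field; exact: xN0.
  rewrite oppr_le0 mulr_ge0 ?invr_ge0 ?sqr_ge0//.
  have := gL x x0; rewrite -subr_ge0 => Lf.
  by apply: addr_ge0; apply: mulr_ge0 => //; exact: sqr_ge0.
have W_le (x : R) : 1 <= x -> W x <= W 1.
  move=> x1; refine (@ler0_derive1_nincry _ W 1 _ _ _ 1 x (lexx 1) x1).
  - move=> y; rewrite in_itv/= andbT => y1.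
    by have [dW' _] := hW y (lt_trans ltr01 y1); exact: dW'.
  - move=> y; rewrite in_itv/= andbT => y1; have y0 := lt_trans ltr01 y1.
    have [_ eW] := hW y y0; rewrite derive1E eW; exact: dW_le0.
  - apply: derivable_within_continuous => y; rewrite in_itv/= andbT => y1.
    by have [dW' _] := hW y (lt_le_trans ltr01 y1); exact: dW'.
clear dW_le0 hW hL dW dL df1 df dV dsq.
have W1_ge0 : 0 <= W 1 by rewrite mulr_ge0 ?expR_ge0// (le_trans _ (gL 1 _)).
exists ((W 1 + f 1) * 2 `^ b).
  rewrite mulr_gt0 ?powR_gt0// ltr_wpDl// (lt_le_trans ltr01)//.
  exact: eigen_fun_ge1.
move=> x x0; rewrite [leRHS]mulrAC -!mulrA.
(* Below 1, [f] is bounded by its value at 1; beyond 1, [W] is bounded by [W 1]. *)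
have [x1|x1] := leP x 1.
  apply: (@le_trans _ _ (f 1 * 1)).
    by rewrite mulr1 eigen_fun_le ?sqr_ge0// exprn_ile1.
  apply: ler_pM => //; first by rewrite (le_trans ler01)// eigen_fun_ge1.
    by rewrite lerDr.
  have ex : 1 <= expR x by rewrite -[leLHS]expR0 ler_expR.
  have pw : 1 <= 2 `^ b * (1 + x) `^ (- b).
    rewrite powRN ler_pdivlMr ?powR_gt0 ?ltr_pwDl// mul1r.
    by rewrite ge0_ler_powR ?nnegrE ?addr_ge0//; lra.
  by rewrite mulrA -[leLHS]mulr1 ler_pM.
have x_gt0 : 0 < x by exact: lt_trans x1.
have := W_le x (ltW x1).
move: (W 1) W1_ge0 => W1 W1_ge0 H.
have {}H : expR (- x) * (x `^ b) * f (x ^+ 2) <= W1.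
  apply: le_trans H; rewrite /W !expRD /powR gt_eqF//.
  rewrite -[in leRHS]mulrA ler_wpM2l ?mulr_ge0 ?expR_ge0//.
  rewrite -[leLHS]mul1r; apply: ler_pM => //; last exact: gL.
  by rewrite -[leLHS]expR0 ler_expR mulr_ge0 ?sqr_ge0 ?invr_ge0.
have {}H : f (x ^+ 2) <= W1 * (expR x * x `^ (- b)).
  rewrite powRN -ler_pdivrMr ?divr_gt0 ?expR_gt0 ?powR_gt0// invfM invrK -expRN.
  by rewrite mulrC.
rewrite (le_trans H)// ler_pM ?mulr_ge0 ?expR_ge0 ?powR_ge0//.
  by rewrite lerDl (le_trans ler01)// eigen_fun_ge1.
rewrite [leRHS]mulrA [leRHS]mulrC ler_wpM2l ?expR_ge0//.
rewrite !powRN ler_pdivlMr ?powR_gt0 ?ltr_pwDl//.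
have x2 : 1 + x <= x * 2 by rewrite mulr_natr mulr2n lerD2r ltW.
rewrite ler_pdivrMl ?powR_gt0// -powRM ?(ltW x_gt0)//.
by apply: ge0_ler_powR => //; rewrite nnegrE ?addr_ge0 ?mulr_ge0.
Qed.

End eigenfunction_growth.

(** * Euclidean balls and Lebesgue measure *)

Section borel_rV.
Context {R : realType} {n : nat}.

(** Boxes with rational centre and size: a countable basis of the topology made
    of sets that are measurable for the coordinates. *)
Definition rat_box (c : 'rV[rat]_n * nat) : set 'rV[R]_n :=
  [set x | forall i, ball (ratr (c.1 ord0 i) : R) c.2.+1%:R^-1 (x ord0 i)].

Lemma measurable_rat_box c : measurable (rat_box c).
Proof.
rewrite (_ : rat_box c = \bigcap_(i in [set: 'I_n])
    ((fun x : 'rV[R]_n => x ord0 i) @^-1` (ball (ratr (c.1 ord0 i) : R) c.2.+1%:R^-1))).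
  apply: fin_bigcap_measurable => // i _; rewrite -[X in measurable X]setTI.
  by apply: measurable_coord => //; exact: measurable_ball.
by apply/seteqP; split => x /= H i; [move=> _; exact: H|exact: (H i)].
Qed.

Lemma rat_box_basis (x : 'rV[R]_n) (e : R) : 0 < e ->
  exists2 c, rat_box c x & rat_box c `<=` ball x e.
Proof.
move=> e0; have [k ke] : exists k : nat, 2 * k.+1%:R^-1 < e.
  have := @near_infty_natSinv_lt R (PosNum (divr_gt0 e0 (ltr0n R 2))).
  move=> [k _ /(_ k (leqnn k))] /= H; exists k.
  by rewrite mulrC -ltr_pdivlMr.
have /choice[c Hc] : forall i, exists q : rat,
    ratr q \in `](x ord0 i - k.+1%:R^-1), (x ord0 i + k.+1%:R^-1)[.
  by move=> i; apply: rat_in_itvoo; rewrite ltrBlDr -addrA ltrDl -mulr2n pmulrn_lgt0// invr_gt0.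
exists (\row_i c i, k).
  move=> i /=; rewrite mxE; have := Hc i; rewrite in_itv/= => /andP[c1 c2].
  by rewrite /ball/= distrC ltr_distlC c1 c2.
move=> y By; split => // j i; rewrite ord1.
have := Hc i; have := By i; rewrite /= mxE in_itv/= => yc /andP[c1 c2].
move: yc; rewrite /ball/=; move: (ratr _) c1 c2 => q c1 c2 yc.
have xq : `|x ord0 i - q| < k.+1%:R^-1.
  by rewrite ltr_distlC c1 c2.
apply: le_lt_trans (ler_distD q _ _) _; apply: lt_trans (ltrD xq yc) _.
by move: ke; rewrite mulr_natl mulr2n.
Qed.

Lemma open_measurable_rV (U : set 'rV[R]_n) : open U -> measurable U.
Proof.
move=> oU; pose F c := if `[< rat_box c `<=` U >] then rat_box c else set0.
rewrite (_ : U = \bigcup_c F c).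
  apply: countable_bigcupT_measurable; first exact: countableP.
  by move=> c; rewrite /F; case: ifP => // _; exact: measurable_rat_box.
apply/seteqP; split => [x Ux|x [c _]]; last by rewrite /F; case: asboolP => // + Bx; exact.
have /nbhs_ballP[e /= e0 xeU] : nbhs x U by exact: open_nbhs_nbhs.
have [c cx cU] := rat_box_basis x e0.
by exists c => //; rewrite /F ifT//; apply/asboolP => y /cU; exact: xeU.
Qed.

Lemma continuous_measurable_rV (f : 'rV[R]_n -> R) :
  continuous f -> measurable_fun [set: 'rV[R]_n] f.
Proof.
move=> /continuousP cf; apply: (measurability _ (RGenOpens.measurableE R)).
move=> _ [_ [a [b ->] <-]]; rewrite setTI; apply: open_measurable_rV.
exact/cf/interval_open.
Qed.

End borel_rV.

Section eucl_norm_theory.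
Context {R : realType} {n : nat}.
Implicit Types x : 'rV[R]_n.

Lemma eucl_norm_ge0 x : 0 <= eucl_norm x.
Proof. exact: sqrtr_ge0. Qed.

Lemma sqr_eucl_norm x : eucl_norm x ^+ 2 = \sum_i x ord0 i ^+ 2.
Proof. by rewrite sqr_sqrtr// sumr_ge0// => i _; exact: sqr_ge0. Qed.

Lemma eucl_normZ a x : 0 <= a -> eucl_norm (a *: x) = a * eucl_norm x.
Proof.
move=> a0; rewrite /eucl_norm -[in RHS](ger0_norm a0) -sqrtr_sqr -sqrtrM ?sqr_ge0//.
congr Num.sqrt; rewrite mulr_sumr; apply: eq_bigr => i _.
by rewrite mxE exprMn.
Qed.

Lemma coord_le_eucl_norm x i : `|x ord0 i| <= eucl_norm x.
Proof.
rewrite -sqrtr_sqr ler_wsqrtr// (bigD1 i)//= lerDl sumr_ge0// => j _.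
exact: sqr_ge0.
Qed.

Lemma scalar_coord (i : 'I_n) : scalar (fun x : 'rV[R]_n => x ord0 i).
Proof. by move=> a x y; rewrite !mxE. Qed.

Lemma smooth_sqr_eucl_norm_comp (V : normedModType R) (L : V -> 'rV[R]_n) :
  (forall i, smooth (fun z => L z ord0 i)) -> smooth (fun z => eucl_norm (L z) ^+ 2).
Proof.
move=> sL; under eq_fun do rewrite sqr_eucl_norm.
move=> m; apply: (@class_C_sum R _ m 'I_n _ (fun i z => L z ord0 i ^+ 2)) => i.
exact: (class_CM (sL i m) (sL i m)).
Qed.

Lemma smooth_sqr_eucl_norm : smooth (fun x : 'rV[R]_n => eucl_norm x ^+ 2).
Proof.
apply: smooth_sqr_eucl_norm_comp => i; apply: smooth_scalar; first exact: scalar_coord.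
exact: coord_continuous.
Qed.

Lemma is_derive_sqr_eucl_norm (V : normedModType R) (L : V -> 'rV[R]_n) z v :
  (forall i, scalar (fun z => L z ord0 i)) ->
  is_derive z v (fun z => eucl_norm (L z) ^+ 2)
    (2 * \sum_i L z ord0 i * L v ord0 i).
Proof.
move=> sL; have H i : is_derive z v (fun z => L z ord0 i ^+ 2) (2 * (L z ord0 i * L v ord0 i)).
  have D := is_derive_scalar z v (sL i).
  by apply: (is_derive_eq (is_deriveM D D)); rewrite /GRing.scale/=; ring.
have := is_derive_sum H; rewrite -mulr_sumr; congr (is_derive _ _ _ _).
by apply/funext => y; rewrite sqr_eucl_norm fct_sumE.
Qed.

Lemma continuous_eucl_norm : continuous (@eucl_norm R n).
Proof.
move=> x; rewrite (_ : @eucl_norm R n = Num.sqrt \o fun x => eucl_norm x ^+ 2).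
  apply: continuous_comp; last exact: sqrt_continuous.
  exact: (smooth_continuous smooth_sqr_eucl_norm).
by apply/funext => y /=; rewrite sqrtr_sqr ger0_norm// eucl_norm_ge0.
Qed.

Lemma measurable_eucl_norm : measurable_fun [set: 'rV[R]_n] (@eucl_norm R n).
Proof. by apply: continuous_measurable_rV; exact: continuous_eucl_norm. Qed.

Lemma measurable_eucl_ball r : measurable (@eucl_ball R n r).
Proof.
rewrite (_ : eucl_ball r = @eucl_norm R n @^-1` `]-oo, r]%classic).
  rewrite -[X in measurable X]setTI; by apply: measurable_eucl_norm.
by apply/seteqP; split => x /=; rewrite in_itv.
Qed.

Lemma eucl_ball_le r r' : r <= r' -> @eucl_ball R n r `<=` eucl_ball r'.
Proof. by move=> rr x /= /le_trans; apply. Qed.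

Lemma lebesgue_eucl_ball_le (r : R) : 0 <= r ->
  (lebesgue_rV n (eucl_ball r) <= ((2 * r) ^+ n)%:E)%E.
Proof.
move=> r0.
have -> : ((2 * r) ^+ n)%:E =
    lebesgue_rV n [set x : 'rV[R]_n | forall i, (`[- r, r]%classic : set (measurableTypeR R)) (x ord0 i)].
  rewrite (@lebesgue_rV_box _ n (fun=> `[- r, r]%classic))//.
  under eq_bigr => i _ do rewrite lebesgue_measure_itv /= lte_fin opprK.
  have [->|r1] := eqVneq r 0.
    case: n => [|m]; first by rewrite big_ord0 expr0.
    by rewrite mulr0 expr0n/= big_ord_recl /= oppr0 ltxx mul0e.
  rewrite ifT; last by rewrite gtrN// lt_neqAle eq_sym r1.
  by rewrite -EFinD -mulr2n prodEFin prodr_const card_ord mulr_natl.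
apply: le_measure; rewrite ?inE//; first exact: measurable_eucl_ball.
  rewrite (_ : [set x | _] = \bigcap_(i in [set: 'I_n])
      ((fun x : 'rV[R]_n => x ord0 i) @^-1` `[- r, r]%classic)).
    apply: fin_bigcap_measurable => // i _; rewrite -[X in measurable X]setTI.
    by apply: measurable_coord.
  by apply/seteqP; split => x /= Ax i; [move=> _; exact: Ax|exact: (Ax i)].
move=> x /= xr i; rewrite in_itv/= -ler_norml.
exact: le_trans (coord_le_eucl_norm x i) xr.
Qed.

End eucl_norm_theory.

Section scaling.
Context {R : realType} (a : R).
Hypothesis a_gt0 : 0 < a.

Let measurable_scale n : measurable_fun [set: 'rV[R]_n] ( *:%R a).
Proof.
apply: measurable_fun_rV => i.
apply: (eq_measurable_fun (fun x : 'rV[R]_n => a * x ord0 i)).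
  by move=> x _; rewrite mxE.
apply: measurable_funM; first exact: measurable_cst.
exact: measurable_coord.
Qed.

Let measurable_scale1 : measurable_fun [set: measurableTypeR R] ( *%R a).
Proof. by apply: measurable_funM => //; exact: measurable_cst. Qed.

(** The canonical measure on a pushforward needs the measurability proof, which cannot
    be inferred for an arbitrary map. *)
Let pushm d1 d2 (T1 : measurableType d1) (T2 : measurableType d2)
  (m : {measure set T1 -> \bar R}) (f : T1 -> T2) (mf : measurable_fun setT f) :
  {measure set T2 -> \bar R} :=
  measure_function_pushforward__canonical__measure_function_Measure m mf.

(** Both sides are measures in [A] that agree on half-open intervals. *)
Lemma lebesgue_measure_scale (A : set (measurableTypeR R)) : measurable A ->
  lebesgue_measure A = (a%:E * lebesgue_measure (( *%R a) @^-1` A))%E.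
Proof.
move=> mA.
pose m' : {measure set (measurableTypeR R) -> \bar R} :=
  mscale (NngNum (ltW a_gt0)) 
    (@pushm _ _ (measurableTypeR R) (measurableTypeR R) (@lebesgue_measure R)
       ( *%R a) measurable_scale1).
rewrite -[RHS]/(m' A); apply: lebesgue_measure_unique => // _ /ocitvP[->|[[c d] /= cd ->]].
  by rewrite !measure0.
rewrite -[RHS]/(a%:E * lebesgue_measure (( *%R a) @^-1` `]c, d]%classic))%E.
rewrite (_ : _ @^-1` _ = `]c / a, d / a]%classic); last first.
  apply/seteqP; split => x /=; rewrite !in_itv/= ltr_pdivrMr// ler_pdivlMr//;
    by rewrite [x * a]mulrC.
rewrite !lebesgue_measure_itv/= !lte_fin cd ltr_pM2r ?invr_gt0// cd.
by rewrite -!EFinD -EFinM; congr EFin; field; rewrite gt_eqF.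
Qed.

(** By induction on the dimension: both sides are measures on the product that agree on
    rectangles. *)
Lemma lebesgue_rV_scale n (A : set 'rV[R]_n) : measurable A ->
  lebesgue_rV n A = ((a ^+ n)%:E * lebesgue_rV n (( *:%R a) @^-1` A))%E.
Proof.
elim: n A => [|n IH] A mA.
  rewrite expr0 mul1e; congr (lebesgue_rV 0 _).
  by apply/seteqP; split => x /=; rewrite (_ : a *: x = x)//; apply/rowP; case.
pose sc (z : measurableTypeR R * 'rV[R]_n) : measurableTypeR R * 'rV[R]_n :=
  (a * z.1, a *: z.2).
have msc : measurable_fun setT sc.
  apply: measurable_fun_pair.
    by apply: (measurableT_comp measurable_scale1); exact: measurable_fst.
  by apply: (measurableT_comp (@measurable_scale n)); exact: measurable_snd.
have an0 : 0 <= a ^+ n.+1 by rewrite exprn_ge0// ltW.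
pose m' : {measure set (measurableTypeR R * 'rV[R]_n) -> \bar R} :=
  mscale (NngNum an0) (pushm (@lebesgue_measure R \x lebesgue_rV n)%E msc).
have mA' : measurable (@rV_cons R n @^-1` A).
  by rewrite -[X in measurable X]setTI; apply: measurable_rV_cons.
have -> : lebesgue_rV n.+1 A = m' (@rV_cons R n @^-1` A).
  rewrite -[LHS]/((@lebesgue_measure R \x lebesgue_rV n)%E (@rV_cons R n @^-1` A)).
  apply: product_measure_unique => // X Y mX mY.
  rewrite -[LHS]/((a ^+ n.+1)%:E * (@lebesgue_measure R \x lebesgue_rV n)
    ((( *%R a) @^-1` X) `*` (( *:%R a) @^-1` Y)))%E.
  rewrite product_measure1E.
  - have EX := lebesgue_measure_scale mX; have EY := IH _ mY.
    transitivity ((a%:E * lebesgue_measure ( *%R a @^-1` X)) *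
      ((a ^+ n)%:E * lebesgue_rV n ( *:%R a @^-1` Y)))%E; last first.
      by congr (_ * _)%E; exact: esym.
    by rewrite exprS EFinM -!muleA; congr (_ * _)%E; rewrite muleCA.
  - by rewrite -[X in measurable X]setTI; apply: measurable_scale1.
  - by rewrite -[X in measurable X]setTI; apply: measurable_scale.
have scE : sc @^-1` (@rV_cons R n @^-1` A) = @rV_cons R n @^-1` ( *:%R a @^-1` A).
  apply/funext => z; congr (A _); apply/rowP => i; rewrite [RHS]mxE.
  by case: (unliftP ord0 i) => [j ->|->]; rewrite ?rV_consS ?rV_cons0//= mxE.
rewrite -[LHS]/((a ^+ n.+1)%:E * (@lebesgue_measure R \x lebesgue_rV n)
  (sc @^-1` (@rV_cons R n @^-1` A)))%E.
by rewrite scE.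
Qed.

End scaling.

Section shells.
Context {R : realType} (n : nat).

Lemma lebesgue_eucl_ball_nat k : (0 < k)%N ->
  lebesgue_rV n (@eucl_ball R n k%:R) = ((k%:R ^+ n)%:E * lebesgue_rV n (@eucl_ball R n 1))%E.
Proof.
move=> k0; have k0' : 0 < k%:R :> R by rewrite ltr0n.
have E : *:%R k%:R @^-1` (@eucl_ball R n k%:R) = eucl_ball 1.
  apply/seteqP; split => x /=; rewrite /eucl_ball/= eucl_normZ//;
    by rewrite -{2}[k%:R]mulr1 ler_pM2l.
by rewrite (lebesgue_rV_scale k0' (measurable_eucl_ball _)) E.
Qed.

Definition shell (k : nat) : set 'rV[R]_n :=
  if k is 0%N then eucl_ball 1 else eucl_ball k.+1%:R `\` eucl_ball k%:R.

Lemma measurable_shell k : measurable (shell k).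
Proof. by case: k => [|k] /=; [|apply: measurableD]; exact: measurable_eucl_ball. Qed.

Lemma shellP k x : shell k x -> k%:R <= eucl_norm x <= k.+1%:R.
Proof.
case: k => [|k] /=; first by rewrite /eucl_ball/= eucl_norm_ge0.
by move=> [/= -> /negP]; rewrite -ltNge => /ltW->.
Qed.

Lemma eucl_ball_shells N x : eucl_ball N.+1%:R x -> exists2 k, (k < N.+1)%N & shell k x.
Proof.
elim: N => [|N IH] Hx; first by exists 0%N.
have [H|H] := pselect (eucl_ball N.+1%:R x); last by exists N.+1.
by have [k kN Hk] := IH H; exists k => //; rewrite ltnS ltnW.
Qed.

(** Scaling gives the volume of the shell as [(k + 1) ^ n - k ^ n] times that of the
    unit ball, which factors into [n] terms of size [k ^ (n - 1)]; no polar coordinates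
    are involved. *)
Lemma lebesgue_shell_le : (0 < n)%N -> exists2 V : R, 0 <= V & forall k,
  (lebesgue_rV n (shell k) <= (V * k.+1%:R ^+ n.-1)%:E)%E.
Proof.
move=> n0.
have fB r : 0 <= r -> lebesgue_rV n (@eucl_ball R n r) \is a fin_num.
  by move=> r0; rewrite ge0_fin_numE// (le_lt_trans (lebesgue_eucl_ball_le r0))// ltry.
pose v := fine (lebesgue_rV n (@eucl_ball R n 1)).
have vE : lebesgue_rV n (@eucl_ball R n 1) = v%:E by rewrite fineK// fB.
have v0 : 0 <= v by rewrite fine_ge0.
exists (n%:R * v); first by rewrite mulr_ge0.
case=> [|k] /=.
  by rewrite vE expr1n mulr1 lee_fin ler_peMl// ler1n.
rewrite measureD//; last 3 first.
- exact: measurable_eucl_ball.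
- exact: measurable_eucl_ball.
- by rewrite -ge0_fin_numE// fB.
rewrite setIidr; last by apply: eucl_ball_le; rewrite ler_nat.
rewrite -[leLHS]/(lebesgue_rV n (@eucl_ball R n k.+2%:R) -
  lebesgue_rV n (@eucl_ball R n k.+1%:R))%E.
rewrite !lebesgue_eucl_ball_nat// vE -!EFinM -EFinD lee_fin -mulrBl.
rewrite -mulrA mulrCA [leLHS]mulrC ler_wpM2l//.
rewrite [leRHS](_ : _ = \sum_(i < n) k.+2%:R ^+ n.-1); last first.
  by rewrite sumr_const card_ord mulr_natl.
rewrite subrXX -natrB// subSnn mul1r; apply: ler_sum => i _.
rewrite (@le_trans _ _ (k.+2%:R ^+ (n.-1 - i) * k.+2%:R ^+ i))//.
  by rewrite ler_wpM2l ?exprn_ge0// lerXn2r ?nnegrE// ler_nat.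
by rewrite -exprD subnK// -ltnS prednK.
Qed.

End shells.

(** * Exponential weights on the light cone *)

Section cone_integral.
Context {R : realType}.

(** Holds for exponents of either sign, as the comparison is two-sided. *)
Lemma powR_comparable (c x y a : R) : 0 < x -> 0 < y -> x <= c * y -> y <= c * x ->
  x `^ a <= c `^ `|a| * y `^ a.
Proof.
move=> x0 y0 xy yx.
have c0 : 0 < c by rewrite -(pmulr_lgt0 _ y0) (lt_le_trans x0).
have [a0|a0] := leP 0 a.
  by rewrite ger0_norm// -powRM ?(ltW c0) ?(ltW y0)// ge0_ler_powR// nnegrE ?mulr_ge0 ?ltW.
rewrite ltr0_norm// -[in x `^ a](opprK a) -[in y `^ a](opprK a).
have: 0 <= - a by rewrite oppr_ge0 ltW.
move: (- a) => e e0; rewrite !powRN ler_pdivlMr ?powR_gt0// ler_pdivrMl ?powR_gt0//.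
by rewrite -powRM ?(ltW c0) ?(ltW x0)// mulrC ge0_ler_powR// nnegrE ?mulr_ge0 ?ltW.
Qed.

Lemma geometric_sum_le (z : R) N : 0 <= z < 1 -> \sum_(j < N) z ^+ j <= (1 - z)^-1.
Proof.
move=> /andP[z0 z1]; rewrite -[leRHS]mul1r ler_pdivlMr ?subr_gt0//.
have := subrXX 1 z N; rewrite expr1n => E.
have -> : (\sum_(j < N) z ^+ j) * (1 - z) = 1 - z ^+ N.
  rewrite E mulrC; congr (_ * _); apply: eq_bigr => i _.
  by rewrite expr1n mul1r.
by rewrite gerBl exprn_ge0.
Qed.

Lemma powR_le_expR (a d : R) : 0 <= a -> 0 < d ->
  exists2 C : R, 0 <= C & forall y : R, 1 <= y -> y `^ a <= C * expR (d * y).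
Proof.
move=> a0 d0; pose m := (Num.truncn a).+1.
have am : a <= m%:R by rewrite ltW// truncnS_gt.
exists (m`!%:R * d ^- m); first by rewrite mulr_ge0// invr_ge0 exprn_ge0// ltW.
move=> y y1; have y0 : 0 <= y by exact: le_trans y1.
rewrite (le_trans (ler_powR y1 am))// powR_mulrn// mulrAC ler_pdivlMr ?exprn_gt0//.
by rewrite -exprMn mulrC exprn_le_expR// mulr_ge0// ltW.
Qed.

(** The weight decays exponentially away from the sphere of radius [rho], so only
    the shells close to that sphere contribute to the integral. *)
Lemma cone_weight_integral (n : nat) (q b : R) : (0 < n)%N -> 0 < q -> 0 <= b ->
  exists2 K : R, 0 <= K & forall rho : R, 0 <= rho ->
  (\int[lebesgue_rV n]_(x in eucl_ball rho)
    ((expR (eucl_norm x - rho) * (1 + eucl_norm x) `^ (- b)) `^ q)%:E <=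
   (K * (1 + rho) `^ ((n%:R - 1) - b * q))%:E)%E.
Proof.
move=> n0 q0 b0; have [V V0 HV] := @lebesgue_shell_le R n n0.
pose a : R := (n%:R - 1) - b * q.
have q2 : 0 < q / 2 by rewrite divr_gt0.
have [D D0 HD] := powR_le_expR (normr_ge0 a) q2.
pose z := expR (- (q / 2)).
have z01 : 0 <= z < 1 by rewrite expR_ge0 expR_lt1 oppr_lt0.
pose K := expR q * V * (D * expR (q / 2)) * (1 - z)^-1 * 2 `^ `|a|.
have z1 : 0 <= (1 - z)^-1 by rewrite invr_ge0 subr_ge0 ltW//; case/andP: z01.
exists K; first by rewrite !mulr_ge0 ?expR_ge0 ?powR_ge0.
move=> rho rho0; pose N := Num.truncn rho.
have /andP[N1 N2] : N%:R <= rho < N.+1%:R by exact: truncn_itv.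
pose c (k : nat) := expR q * expR (- (q * (N - k)%:R)) * k.+1%:R `^ (- (b * q)).
have c0 k : 0 <= c k by rewrite !mulr_ge0 ?expR_ge0 ?powR_ge0.
have mw : measurable_fun [set: 'rV[R]_n] (fun x : 'rV[R]_n =>
    ((expR (eucl_norm x - rho) * (1 + eucl_norm x) `^ (- b)) `^ q)%:E).
  apply/measurable_EFinP; apply: (measurableT_comp (measurable_powR q)).
  apply: measurable_funM.
    apply: (measurableT_comp (@measurable_expR R)).
    by apply: measurable_funB => //; exact: measurable_eucl_norm.
  apply: (measurableT_comp (measurable_powR (- b))).
  by apply: measurable_funD => //; exact: measurable_eucl_norm.
have mc (k : nat) : measurable_fun [set: 'rV[R]_n]
    (fun x => ((c k)%:E * (\1_(shell k) x)%:E)%E).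
  by apply: emeasurable_funM => //; apply/measurable_EFinP; apply: measurable_indic; exact: measurable_shell.
(* On the shell [k] the weight is at most [c k], as [|x| - rho <= k + 1 - N]. *)
have pw x : @eucl_ball R n rho x ->
    (((expR (eucl_norm x - rho) * (1 + eucl_norm x) `^ (- b)) `^ q)%:E <=
    \sum_(k < N.+1) (c k)%:E * (\1_(shell k) x)%:E)%E.
  move=> xr; have [k kN xk] := eucl_ball_shells (le_trans xr (ltW N2)).
  rewrite (bigD1 (Ordinal kN))//= indicE mem_set// mule1 -[leLHS]adde0 leeD//; last first.
    by apply: sume_ge0 => i _; rewrite mule_ge0 ?lee_fin// indicE.
  have /andP[k1 k2] := shellP xk.
  rewrite lee_fin powRM ?expR_ge0 ?powR_ge0// -powRrM -expRM /c mulNr ler_pM ?expR_ge0 ?powR_ge0//.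
    rewrite -expRD ler_expR natrB//.
    have -> : q + - (q * (N%:R - k%:R)) = (1 - (N%:R - k%:R)) * q by ring.
    rewrite ler_pM2r//; move: k2; rewrite -natr1 => k2; lra.
  rewrite !powRN lef_pV2 ?posrE ?powR_gt0// ?ltr_pwDl ?eucl_norm_ge0//.
  rewrite ge0_ler_powR ?nnegrE ?mulr_ge0 ?addr_ge0 ?eucl_norm_ge0 ?(ltW q0)//.
  by rewrite -natr1 addrC lerD2l.
apply: (@le_trans _ _ (\int[lebesgue_rV n]_x
    (\sum_(k < N.+1) (c k)%:E * (\1_(shell k) x)%:E)))%E.
  apply: (@le_trans _ _ (\int[lebesgue_rV n]_(x in eucl_ball rho)
    (\sum_(k < N.+1) (c k)%:E * (\1_(shell k) x)%:E)))%E.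
    apply: ge0_le_integral => //; first exact: measurable_eucl_ball.
    - by move=> x _; rewrite lee_fin powR_ge0.
    - exact: measurable_funTS.
    - by apply: measurable_funTS; apply: emeasurable_sum.
  apply: ge0_subset_integral => //; first exact: measurable_eucl_ball.
    by apply: emeasurable_sum.
  by move=> x _; apply: sume_ge0 => i _; rewrite mule_ge0 ?lee_fin// indicE.
rewrite ge0_integral_sum//; last first.
  by move=> k x _; rewrite mule_ge0 ?lee_fin// indicE.
apply: (@le_trans _ _ (\sum_(k < N.+1) (c k * (V * k.+1%:R ^+ n.-1))%:E)%E).
  apply: lee_sum => k _; rewrite ge0_integralZl_EFin//; last first.
    by apply/measurable_EFinP; apply: measurable_indic; exact: measurable_shell.
  rewrite integral_indic ?setIT//; last exact: measurable_shell.
  rewrite [leRHS]EFinM lee_wpmul2l//; [rewrite lee_fin; exact: c0|exact: HV].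
rewrite sumEFin lee_fin.
(* [k + 1] and [N + 1] are comparable up to the factor [N - k + 1], whose power is paid
   by half of the exponential decay. *)
have step k : (k <= N)%N -> c k * (V * k.+1%:R ^+ n.-1) <=
    expR q * V * (D * expR (q / 2)) * N.+1%:R `^ a * z ^+ (N - k).
  move=> kN.
  have -> : c k * (V * k.+1%:R ^+ n.-1) =
      expR q * V * (expR (- (q * (N - k)%:R)) * k.+1%:R `^ a).
    rewrite /a powRD; last by rewrite pnatr_eq0 implybT.
    have -> : n%:R - 1 = n.-1%:R :> R by rewrite -[n in LHS]prednK// -natr1 addrK.
    by rewrite powR_mulrn// /c; ring.
  rewrite -!mulrA ler_wpM2l ?expR_ge0// ler_wpM2l//.
  have H : k.+1%:R `^ a <= (N - k).+1%:R `^ `|a| * N.+1%:R `^ a.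
    apply: powR_comparable; rewrite ?ltr0n// -natrM ler_nat.
      by rewrite mulSn; apply: leq_trans (leq_addr _ _); rewrite ltnS.
    rewrite -{1}(subnK kN); move: (N - k)%N => m.
    by rewrite mulSn mulnS addSn ltnS addnCA leq_add2l leq_addr.
  rewrite (le_trans (ler_wpM2l (expR_ge0 _) H))//.
  rewrite !mulrA [leRHS]mulrAC ler_wpM2r ?powR_ge0//.
  have := HD (N - k).+1%:R; rewrite ler1n => /(_ isT) {}H.
  rewrite (le_trans (ler_wpM2l (expR_ge0 _) H))// mulrCA -!mulrA ler_wpM2l//.
  rewrite /z -expRM_natr -!expRD ler_expR -[(N - k).+1%:R]natr1.
  by rewrite le_eqVlt; apply/orP; left; apply/eqP; field.
apply: (@le_trans _ _ (\sum_(k < N.+1)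
    expR q * V * (D * expR (q / 2)) * N.+1%:R `^ a * z ^+ (N - k))).
  by apply: ler_sum => k _; apply: step; rewrite -ltnS.
rewrite -mulr_sumr (reindex_inj rev_ord_inj)/=.
under eq_bigr => j _ do rewrite subSS (subKn (leq_ord j)).
have sz := geometric_sum_le N.+1 z01.
have Na : N.+1%:R `^ a <= 2 `^ `|a| * (1 + rho) `^ a.
  have ? : 0 <= N%:R :> R by [].
  by apply: powR_comparable; rewrite ?ltr0n// ?ltr_pwDl//; move: N2; rewrite -natr1 => ?; lra.
apply: (@le_trans _ _ (expR q * V * (D * expR (q / 2)) * (2 `^ `|a| * (1 + rho) `^ a) *
  (1 - z)^-1)).
  apply: ler_pM => //.
  - by rewrite !mulr_ge0 ?expR_ge0 ?powR_ge0.
  - by apply: sumr_ge0 => i _; rewrite exprn_ge0// expR_ge0.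
  - by rewrite ler_wpM2l// !mulr_ge0 ?expR_ge0.
by rewrite /K -/a le_eqVlt; apply/orP; left; apply/eqP; ring.
Qed.

End cone_integral.

(** * Radial and separated test functions *)

Section test_functions.
Context {R : realType}.

Lemma supp_sub (V : normedModType R) (f : V -> R) (A : set V) : closed A ->
  (forall x, f x != 0 -> A x) -> supp f `<=` A.
Proof.
move=> cA fA; rewrite [X in _ `<=` X](iffLR (closure_id _) cA).
by apply: closure_subset => x; exact: fA.
Qed.

Lemma compact_box n (rho : R) :
  compact [set x : 'rV[R]_n | forall i, `[- rho, rho]%classic (x ord0 i)].
Proof.
apply: (@rV_compact R n (fun=> `[- rho, rho]%classic)) => i.
exact: segment_compact.
Qed.

(** Supports are closures, and compact sets are closed. *)
Lemma supp_compact (V : normedModType R) (f : V -> R) (K : set V) : compact K ->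
  (forall x, f x != 0 -> K x) -> supp f `<=` K /\ compact (supp f).
Proof.
move=> cK fK; have sK : supp f `<=` K.
  by apply: supp_sub => //; apply: compact_closed => //; exact: norm_hausdorff.
by split => //; apply: (subclosed_compact _ cK sK); exact: closed_closure.
Qed.

Lemma test_function_derive (V : normedModType R) (f : V -> R) v :
  test_function f -> test_function (fun x => 'D_v f x).
Proof.
move=> [sf cf]; split; first exact: smooth_derive.
apply: (subclosed_compact _ cf); first exact: closed_closure.
apply: supp_sub; first exact: closed_closure.
move=> x; apply: contra_neqP => /= xf.
have nx : nbhs x (~` supp f).
  by apply: open_nbhs_nbhs; split => //; exact/closed_openC/closed_closure.
have f0 : \near x, cst 0 x = f x.
  apply: filterS nx => y yf; apply/esym/eqP; apply: contrapT => /negP fy.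
  by apply: yf; exact: subset_closure.
by have [_ ->] := near_eq_is_derive f0 (is_derive_cst (0:R) x v).
Qed.

Section radial.
Context {n : nat}.
Implicit Types (G : R -> R) (x : 'rV[R]_n).

Definition radial G x : R := G (eucl_norm x ^+ 2).

Lemma smooth_radial_comp (V : normedModType R) (L : V -> 'rV[R]_n) G :
  (forall i, smooth (fun z => L z ord0 i)) -> smooth G ->
  smooth (fun z => radial G (L z)).
Proof.
by move=> sL sG; apply: (smooth_comp sG); exact: smooth_sqr_eucl_norm_comp.
Qed.

Lemma smooth_radial G : smooth G -> smooth (radial G).
Proof. by move=> sG; apply: (smooth_comp sG); exact: smooth_sqr_eucl_norm. Qed.

Lemma is_derive_radial_comp (V : normedModType R) (L : V -> 'rV[R]_n) G z v :
  smooth G -> (forall i, scalar (fun z => L z ord0 i)) ->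
  is_derive z v (fun z => radial G (L z))
    ('D_1 G (eucl_norm (L z) ^+ 2) * (2 * \sum_i L z ord0 i * L v ord0 i)).
Proof.
move=> sG sL; have D := is_derive_sqr_eucl_norm z v sL.
by apply: (is_derive_comp D); apply: derivableP; exact: smooth_derivable.
Qed.

Lemma sum_coord_delta x i : \sum_j x ord0 j * ('e_i : 'rV[R]_n) ord0 j = x ord0 i.
Proof.
rewrite (bigD1 i)//= mxE !eqxx mulr1 big1 ?addr0// => j ji.
by rewrite mxE (negbTE ji) andbF mulr0.
Qed.

Lemma is_derive_radial G x (i : 'I_n) : smooth G ->
  is_derive x 'e_i (radial G) ('D_1 G (eucl_norm x ^+ 2) * (2 * x ord0 i)).
Proof.
move=> sG; have := @is_derive_radial_comp _ id G x 'e_i sG (@scalar_coord R n).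
by rewrite sum_coord_delta.
Qed.

Lemma derive_radial G (i : 'I_n) : smooth G ->
  (fun x => 'D_('e_i) (radial G) x) =
  fun x => radial (fun s => 'D_1 G s) x * (2 * x ord0 i).
Proof. by move=> sG; apply/funext => x; have [_ ->] := is_derive_radial x i sG. Qed.

Lemma laplacian_radial G x : smooth G ->
  \sum_(i < n) 'D_('e_i) (fun x => 'D_('e_i) (radial G) x) x =
  4 * eucl_norm x ^+ 2 * 'D_1 (fun s => 'D_1 G s) (eucl_norm x ^+ 2) +
  2 * n%:R * 'D_1 G (eucl_norm x ^+ 2).
Proof.
move=> sG; have sG1 := smooth_derive (1:R) sG.
transitivity (\sum_(i < n) (4 * 'D_1 (fun s => 'D_1 G s) (eucl_norm x ^+ 2) * x ord0 i ^+ 2 +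
    2 * 'D_1 G (eucl_norm x ^+ 2))).
  apply: eq_bigr => i _; rewrite derive_radial//.
  have D1 := is_derive_radial x i sG1.
  have D2 := is_derive_scalar x ('e_i : 'rV[R]_n) (@scalar_coord R n i).
  have D3 := is_deriveM D1 (is_deriveZ (2:R) D2).
  have [_ E] := D3; rewrite [LHS]E /radial /GRing.scale/= mxE !eqxx -[2 *: x ord0 i]/(2 * x ord0 i) /=; ring.
rewrite big_split/= -mulr_sumr -sqr_eucl_norm sumr_const card_ord -mulr_natl; ring.
Qed.

Lemma radial_supp G (B : R) x : 0 <= B -> (forall s, B <= s -> G s = 0) ->
  radial G x != 0 -> forall i, `[- (B + 1), B + 1]%classic (x ord0 i).
Proof.
move=> B0 GB; rewrite /radial => Gx i; rewrite /= in_itv/= -ler_norml.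
apply: (le_trans (coord_le_eucl_norm x i)).
have xB : eucl_norm x ^+ 2 < B.
  by rewrite ltNge; apply: contra_neqN Gx; exact: GB.
rewrite -ler_sqr ?nnegrE ?eucl_norm_ge0 ?addr_ge0// (le_trans (ltW xB))//.
rewrite sqrrD1 mulr2n; have := sqr_ge0 B; lra.
Qed.

Lemma test_radial G (B : R) : smooth G -> 0 <= B -> (forall s, B <= s -> G s = 0) ->
  test_function (radial G).
Proof.
move=> sG B0 GB; split; first exact: smooth_radial.
have [] // := @supp_compact _ (radial G) _ (@compact_box n (B + 1)).
by move=> x; exact: radial_supp.
Qed.

End radial.

Section spacetime.
Context {n : nat}.

Definition sep_prod (a G : R -> R) (z : R * 'rV[R]_n) : R := a z.1 * radial G z.2.

Let coord2_scalar (i : 'I_n) : scalar (fun z : R * 'rV[R]_n => z.2 ord0 i).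
Proof. by move=> k x y; rewrite !mxE. Qed.

Let coord2_smooth (i : 'I_n) : smooth (fun z : R * 'rV[R]_n => z.2 ord0 i).
Proof.
apply: smooth_scalar; first exact: coord2_scalar.
move=> z; apply: (@continuous_comp _ _ _ snd (fun x : 'rV[R]_n => x ord0 i)).
  exact: cvg_snd.
exact: coord_continuous.
Qed.

Let fst_scalar : scalar (fun z : R * 'rV[R]_n => z.1).
Proof. by []. Qed.

Let fst_smooth : smooth (fun z : R * 'rV[R]_n => z.1).
Proof. by apply: smooth_scalar; [exact: fst_scalar|move=> z; exact: cvg_fst]. Qed.

Lemma smooth_sep_prod a G : smooth a -> smooth G -> smooth (sep_prod a G).
Proof.
move=> sa sG; apply: smoothM; first exact: (smooth_comp sa fst_smooth).
exact: (@smooth_radial_comp n _ (snd : R * 'rV[R]_n -> 'rV[R]_n)).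
Qed.

Lemma is_derive_sep_prod a G s x k v : smooth a -> smooth G ->
  is_derive (s, x) (k, v) (sep_prod a G)
    (a s * ('D_1 G (eucl_norm x ^+ 2) * (2 * \sum_i x ord0 i * v ord0 i)) +
     'D_1 a s * k * radial G x).
Proof.
move=> sa sG.
have D1 := @is_derive_radial_comp n _ (snd : R * 'rV[R]_n -> 'rV[R]_n) G (s, x) (k, v)
  sG coord2_scalar.
have Da : is_derive ((s, x) : R * 'rV[R]_n).1 1 a ('D_1 a s).
  by apply: derivableP; exact: smooth_derivable.
have D2 := is_derive_comp (is_derive_scalar (s, x) (k, v) fst_scalar) Da.
by apply: (is_derive_eq (is_deriveM D2 D1)); rewrite /GRing.scale/=; ring.
Qed.

Lemma dt_sep_prod a G s x : smooth a -> smooth G ->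
  dt (sep_prod a G) s x = 'D_1 a s * radial G x.
Proof.
move=> sa sG; rewrite /dt; have [_ E] := is_derive_sep_prod s x 1 0 sa sG; rewrite [LHS]E.
rewrite big1 ?mulr0 ?add0r ?mulr1// => i _.
by rewrite mxE mulr0.
Qed.

Lemma dx_sep_prod a G i s x : smooth a -> smooth G ->
  dx i (sep_prod a G) s x = a s * 'D_('e_i) (radial G) x.
Proof.
move=> sa sG; rewrite /dx; have [_ E] := is_derive_sep_prod s x 0 'e_i sa sG; rewrite [LHS]E.
rewrite sum_coord_delta mulr0 mul0r addr0.
by have [_ ->] := is_derive_radial x i sG.
Qed.

(** The time factor has to vanish for large negative times as well, since the support
    is taken over all times. *)
Lemma spacetime_test_sep_prod (T : \bar R) (a G : R -> R) (tau B : R) :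
  smooth a -> smooth G -> 0 <= B -> (forall s, B <= s -> G s = 0) ->
  (forall t, tau <= `|t| -> a t = 0) -> (tau%:E < T)%E ->
  spacetime_test T (sep_prod a G).
Proof.
move=> sa sG B0 GB at0 tauT.
have cK : compact (`[- tau, tau]%classic `*`
    [set x : 'rV[R]_n | forall i, `[- (B + 1), B + 1]%classic (x ord0 i)]).
  by apply: compact_setX; [exact: segment_compact|exact: compact_box].
have [|sub cS] := @supp_compact _ (sep_prod a G) _ cK.
  move=> z; rewrite mulf_eq0 negb_or => /andP[az Gz]; split.
    suff : z.1 \in `[- tau, tau] by [].
    rewrite in_itv/= -ler_norml leNgt; apply: contra_neqN az => /ltW; exact: at0.
  exact: radial_supp Gz.
split; last first.
  move=> z /sub[+ _] /= => zt.
  have /itvP zt' : z.1 \in `[- tau, tau] by [].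
  by rewrite (le_lt_trans _ tauT)// lee_fin zt'.
by split; first exact: smooth_sep_prod.
Qed.

End spacetime.
End test_functions.

(** * Pairings with square-integrable functions *)

Section pairing.
Context {R : realType} {n : nat}.
Local Notation mu := (@lebesgue_rV R n).
Implicit Types (f g phi : 'rV[R]_n -> R).

Definition pairing f phi : R := \int[mu]_x (f x * phi x).

Lemma Lfun_measurable (p : \bar R) f : f \in Lfun mu p -> measurable_fun setT f.
Proof. by rewrite inE => /andP[/[!inE]]. Qed.

Lemma integrable_pairing f phi : f \in Lfun mu 2%:E -> phi \in Lfun mu 2%:E ->
  mu.-integrable setT (EFin \o (fun x => f x * phi x)).
Proof. by move=> f2 phi2; apply/Lfun1_integrable; exact: Lfun2_mul_Lfun1. Qed.

Lemma pairingB f g phi : f \in Lfun mu 2%:E -> g \in Lfun mu 2%:E ->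
  phi \in Lfun mu 2%:E ->
  pairing (fun x => f x - g x) phi = pairing f phi - pairing g phi.
Proof.
move=> f2 g2 p2; rewrite /pairing -RintegralB//; last 2 first.
- exact: integrable_pairing.
- exact: integrable_pairing.
by apply: eq_Rintegral => x _; rewrite mulrBl.
Qed.

Lemma pairingZl k f phi : f \in Lfun mu 2%:E -> phi \in Lfun mu 2%:E ->
  pairing (fun x => k * f x) phi = k * pairing f phi.
Proof.
move=> f2 p2; rewrite /pairing -RintegralZl//; last exact: integrable_pairing.
by apply: eq_Rintegral => x _; rewrite mulrA.
Qed.

Lemma Lfun_comb k f g : f \in Lfun mu 2%:E -> g \in Lfun mu 2%:E ->
  (fun x => k * f x + g x) \in Lfun mu 2%:E.
Proof.
have p1 : (1 <= 2%:E :> \bar R)%E by rewrite lee_fin ler1n.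
move=> f2 g2; have [_ H] := Lfun_submod_closed mu p1.
exact: (H k f g f2 g2).
Qed.

Lemma LfunB f g : f \in Lfun mu 2%:E -> g \in Lfun mu 2%:E ->
  (fun x => f x - g x) \in Lfun mu 2%:E.
Proof.
move=> f2 g2; rewrite (_ : (fun x => _) = (fun x => -1 * g x + f x)).
  exact: Lfun_comb.
by apply/funext => x; rewrite mulN1r addrC.
Qed.

Lemma pairing_le f phi : f \in Lfun mu 2%:E -> phi \in Lfun mu 2%:E ->
  (`|pairing f phi|%:E <= 'N[mu]_2%:E[EFin \o f] * 'N[mu]_2%:E[EFin \o phi])%E.
Proof.
move=> f2 p2; rewrite /pairing EFin_normr_Rintegral//; last exact: integrable_pairing.
have mf := Lfun_measurable f2; have mp := Lfun_measurable p2.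
have H := @hoelder _ _ _ mu f phi 2 2 mf mp.
apply: le_trans (H _ _ _) => //; last by rewrite [RHS]splitr !div1r.
rewrite Lnorm1; apply: le_abse_integral => //.
by apply/measurable_EFinP; exact: measurable_funM.
Qed.

Lemma Lnorm_fin f : f \in Lfun mu 2%:E -> ('N[mu]_2%:E[EFin \o f])%E \is a fin_num.
Proof.
move=> f2; rewrite ge0_fin_numE ?Lnorm_ge0//.
by move: f2; rewrite inE => /andP[_]; rewrite inE/=.
Qed.

Lemma sobolev_sqnorm_ge0 k f : (0 <= sobolev_sqnorm k f)%E.
Proof.
have N2 g : (0 <= 'N[mu]_2%:E[EFin \o g] ^+ 2)%E by rewrite expe_ge0// Lnorm_ge0.
elim: k f => [|k IH] f /=; first by rewrite adde0; exact: N2.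
by apply: adde_ge0 (N2 f) _; apply: sume_ge0.
Qed.

Lemma Lnorm_le_sobolev_norm k f :
  ('N[mu]_2%:E[EFin \o f] <= sobolev_norm k f)%E.
Proof.
rewrite -[leLHS]gee0_abs ?Lnorm_ge0// -sqrte_sqr /sobolev_norm.
rewrite lee_sqrt ?sobolev_sqnorm_ge0//.
by case: k => [|k] /=; rewrite leeDl// sume_ge0// => i _; exact: sobolev_sqnorm_ge0.
Qed.

Lemma sobolev_Lfun k f : sobolev k f -> f \in Lfun mu 2%:E.
Proof. by case: k => [|k] []. Qed.

(** By the Cauchy-Schwarz inequality: the Sobolev norm dominates the [L^2] norm. *)
Lemma pairing_cvg0 (F : set_system R) k (g : R -> 'rV[R]_n -> R) phi : Filter F ->
  phi \in Lfun mu 2%:E -> (\forall s \near F, g s \in Lfun mu 2%:E) ->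
  sobolev_norm k (g s) @[s --> F] --> 0%E ->
  pairing (g s) phi @[s --> F] --> 0.
Proof.
move=> FF p2 g2 /fine_cvgP[gfin gcvg].
pose c := fine ('N[mu]_2%:E[EFin \o phi])%E.
have c0 : 0 <= c by rewrite fine_ge0// Lnorm_ge0.
apply/cvgr0Pnorm_le => e e0.
have ec : 0 < e / (c + 1) by rewrite divr_gt0// ltr_wpDl.
move/cvgr0Pnorm_le : gcvg => /(_ _ ec) gcvg.
near=> s.
have gs : g s \in Lfun mu 2%:E by near: s.
have fs : sobolev_norm k (g s) \is a fin_num by near: s.
have : `|fine (sobolev_norm k (g s))| <= e / (c + 1) by near: s.
rewrite ger0_norm ?fine_ge0 ?sqrte_ge0// => H.
rewrite -lee_fin (le_trans (pairing_le gs p2))//.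
apply: (@le_trans _ _ ((e / (c + 1))%:E * c%:E)%E).
  apply: lee_pmul => //; rewrite ?Lnorm_ge0//; last by rewrite fineK// Lnorm_fin.
  by rewrite (le_trans (Lnorm_le_sobolev_norm k _))// -(fineK fs) lee_fin.
rewrite -EFinM lee_fin -mulrA ler_piMr ?(ltW e0)// mulrC ler_pdivrMr ?ltr_wpDl//.
by rewrite mul1r lerDl.
Unshelve. all: by end_near. Qed.

End pairing.

(** * Differentiation in time on the lifetime *)

Section time_filters.
Context {R : realType} (T : \bar R).
Implicit Types (t : R).

Lemma lifetime_right t : lifetime T t -> exists2 d : R, 0 < d & ((t + d)%:E < T)%E.
Proof.
move=> [_]; case: T => [x|_|//]; last by exists 1; rewrite ?ltry.
rewrite lte_fin => tx; exists ((x - t) / 2); first by rewrite divr_gt0 ?subr_gt0.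
by rewrite lte_fin; lra.
Qed.

(** The lifetime is a half-open interval, so every point of it, 0 included, is a limit of
    later times; this is what makes limits along it unique. *)
Lemma within_lifetime_proper t : lifetime T t ->
  ProperFilter (within (lifetime T) t^').
Proof.
move=> tT; apply: Build_ProperFilter => H.
move: (tT) => [t0 _]; have [d d0 dT] := lifetime_right tT.
have {}H : nbhs t [set s | s != t -> lifetime T s -> False] by exact: H.
have /nbhs_ballP[e /= e0 He] := H.
pose m := Num.min (e / 2) d.
have m0 : 0 < m by rewrite lt_min d0 divr_gt0.
apply: (He (t + m)).
- rewrite /ball/= opprD addrA subrr add0r normrN gtr0_norm// gt_min.
  by rewrite [X in X || _](_ : _ = true)//; lra.
- by rewrite gt_eqF// ltrDl.
- split; first by rewrite addr_ge0// ltW.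
  by rewrite (le_lt_trans _ dT)// lee_fin lerD2l ge_min lexx orbT.
Qed.

Lemma lifetime_nbhs t : 0 < t -> (t%:E < T)%E -> nbhs t (lifetime T).
Proof.
move=> t0 tT; have [|d d0 dT] := @lifetime_right t; first by split => //; exact: ltW.
apply/nbhs_ballP; exists (Num.min t d) => /=; first by rewrite lt_min t0.
move=> s; rewrite /ball/= lt_min !ltr_norml => /andP[/andP[s1 s2] /andP[s3 s4]].
split; first by lra.
by apply: lt_trans dT; rewrite lte_fin; lra.
Qed.

(** Convergence of the difference quotients inside the lifetime gives an ordinary
    derivative at interior times. *)
Lemma lifetime_is_derive (F : R -> R) t l : 0 < t -> (t%:E < T)%E ->
  (s - t)^-1 * (F s - F t) @[s --> within (lifetime T) t^'] --> l ->
  is_derive t (1:R) F l.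
Proof.
move=> t0 tT H.
suff : h^-1 *: ((F \o shift t) (h *: (1:R)) - F t) @[h --> 0^'] --> l.
  by move=> cv; split; [apply/cvg_ex; exists l|exact/cvg_lim].
apply/cvgrPdist_lt => e e0.
move/cvgrPdist_lt : H => /(_ e e0) H.
have {}H : nbhs t [set s | s != t -> lifetime T s ->
  `|l - (s - t)^-1 * (F s - F t)| < e] by exact: H.
have /nbhs_ballP[d /= d0 Hd] : nbhs t ([set s | s != t -> lifetime T s ->
    `|l - (s - t)^-1 * (F s - F t)| < e] `&` lifetime T).
  by apply: filterI => //; exact: lifetime_nbhs.
suff : nbhs (0:R) [set h | h != 0 ->
  `|l - h^-1 *: ((F \o shift t) (h *: (1:R)) - F t)| < e] by [].
apply/nbhs_ballP; exists d => //= h.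
rewrite /ball/= sub0r normrN => hd h0.
have [|Ht Hl] := Hd (h + t).
  by rewrite /ball/= opprD addrCA subrr addr0 normrN.
have := Ht _ Hl; rewrite addrK /GRing.scale/= mulr1; apply.
by rewrite -subr_eq0 addrK.
Qed.

End time_filters.

Section energy_pairing.
Context {R : realType} {n : nat} (T : \bar R).
Local Notation mu := (@lebesgue_rV R n).
Implicit Types (u v : R -> 'rV[R]_n -> R) (phi : 'rV[R]_n -> R).

Lemma pairing_continuous k u phi t : continuous_H k T u -> phi \in Lfun mu 2%:E ->
  lifetime T t ->
  pairing (u s) phi @[s --> within (lifetime T) (nbhs t)] --> pairing (u t) phi.
Proof.
move=> uc p2 tT; have [ut ucvg] := uc t tT.
have u2 s : lifetime T s -> u s \in Lfun mu 2%:E.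
  by move=> sT; have [/sobolev_Lfun] := uc s sT.
have nT : \forall s \near within (lifetime T) (nbhs t), lifetime T s.
  by rewrite near_withinE; exact: nearW.
apply/subr_cvg0.
apply: (@cvg_trans _ (pairing (u s \- u t) phi @[s --> within (lifetime T) (nbhs t)])).
  apply: near_eq_cvg; apply: filterS nT => s sT.
  by rewrite -pairingB ?u2.
apply: (pairing_cvg0 _ p2 _ ucvg); apply: filterS nT => s sT.
by apply: LfunB; exact: u2.
Qed.

Lemma pairing_derivative k u v phi t : (forall s, lifetime T s -> u s \in Lfun mu 2%:E) ->
  derivative_H k T u v -> phi \in Lfun mu 2%:E -> lifetime T t ->
  (s - t)^-1 * (pairing (u s) phi - pairing (u t) phi)
    @[s --> within (lifetime T) t^'] --> pairing (v t) phi.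
Proof.
move=> u2 du p2 tT; have [/sobolev_Lfun v2 dcvg] := du t tT.
have nT : \forall s \near within (lifetime T) t^', lifetime T s.
  by rewrite near_withinE; exact: nearW.
have q2 s : lifetime T s -> (fun x => (s - t)^-1 * (u s x - u t x)) \in Lfun mu 2%:E.
  move=> sT; rewrite (_ : (fun x => _) =
    (fun x => (s - t)^-1 * (u s x - u t x) + (u t x - u t x))).
    by apply: Lfun_comb; apply: LfunB; exact: u2.
  by apply/funext => x; rewrite subrr addr0.
apply/subr_cvg0.
apply: (@cvg_trans _ (pairing (fun x => (s - t)^-1 * (u s x - u t x) - v t x) phi
    @[s --> within (lifetime T) t^'])).
  apply: near_eq_cvg; apply: filterS nT => s sT.
  by rewrite pairingB ?q2// pairingZl ?LfunB ?u2// pairingB ?u2.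
apply: (pairing_cvg0 _ p2 _ dcvg); apply: filterS nT => s sT.
by apply: LfunB => //; exact: q2.
Qed.

End energy_pairing.

(** * Weak derivatives and supports *)

Section test_pairing.
Context {R : realType} {n : nat}.
Local Notation mu := (@lebesgue_rV R n).
Implicit Types (f g phi : 'rV[R]_n -> R).

Lemma compact_continuous_bounded (V : normedModType R) (K : set V) (g : V -> R) :
  compact K -> continuous g -> exists2 M : R, 0 <= M & forall x, K x -> `|g x| <= M.
Proof.
move=> cK cg; have cgK : {within K, continuous g} by exact: continuous_subspaceT.
have [M [_ HM]] := compact_bounded (continuous_compact cgK cK).
exists (`|M| + 1); first by rewrite addr_ge0.
by move=> x Kx; apply: (HM (`|M| + 1)); [rewrite ltr_pwDr// ler_norm|exists x].
Qed.

Lemma test_function_Lfun2 phi : test_function phi -> phi \in Lfun mu 2%:E.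
Proof.
move=> [sphi cphi]; have cont := smooth_continuous sphi.
have mphi := continuous_measurable_rV cont.
have [M M0 HM] := compact_continuous_bounded cphi cont.
have [B B0 HB] := compact_continuous_bounded cphi (@continuous_eucl_norm R n).
have phi0 x : ~ eucl_ball B x -> phi x = 0.
  move=> xB; apply/eqP/negPn/negP => phix; apply: xB.
  rewrite /eucl_ball/= -[leLHS]ger0_norm ?eucl_norm_ge0//; apply: HB.
  exact: subset_closure.
have phiM x : `|phi x| <= M.
  have [->|phix] := eqVneq (phi x) 0; first by rewrite normr0.
  by apply: HM; exact: subset_closure.
rewrite inE; apply/andP; split; rewrite inE//=.
rewrite /finite_norm unlock poweR_lty//=.
have bound : (\int[mu]_(x in eucl_ball B) (cst (M `^ 2)%:E x) < +oo)%E.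
  rewrite integral_cst; last exact: measurable_eucl_ball.
  by rewrite lte_mul_pinfty ?lee_fin ?powR_ge0// (le_lt_trans (lebesgue_eucl_ball_le B0))// ltry.
apply: le_lt_trans bound.
  rewrite [leRHS]integral_mkcond; apply: ge0_le_integral => //.
  - apply/measurable_EFinP; apply: (measurableT_comp (measurable_powR 2)).
    exact: measurableT_comp.
  - apply/(measurable_restrictT _ _).1; first exact: measurable_eucl_ball.
    exact: measurable_cst.
  - move=> x _; rewrite patchE; case: ifPn => [_|/negP].
      by rewrite lee_fin ge0_ler_powR ?nnegrE.
    by rewrite inE => /phi0->; rewrite normr0 powR0.
Qed.

Lemma weak_partialP (i : 'I_n) f : sobolev 1 f ->
  weak_partial i f \in Lfun mu 2%:E /\ is_weak_partial i f (weak_partial i f).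
Proof.
move=> [_ /(_ i)[g gP [g2 _]]].
by apply: (@xgetPex _ (cst 0) [set g | g \in Lfun mu 2%:E /\ is_weak_partial i f g]); exists g.
Qed.

Lemma Rintegral_sum (I : Type) (s : seq I) (F : I -> 'rV[R]_n -> R) :
  (forall i, mu.-integrable setT (EFin \o F i)) ->
  \int[mu]_x (\sum_(i <- s) F i x) = \sum_(i <- s) \int[mu]_x F i x.
Proof.
move=> iF; rewrite /Rintegral.
under eq_integral do rewrite -sumEFin.
rewrite (@integral_sum _ _ _ mu setT measurableT I (fun i x => (F i x)%:E))//.
transitivity (fine (\sum_(i <- s) (fine (\int[mu]_x (F i x)%:E))%:E)%E).
  congr fine; apply: eq_bigr => i _; rewrite fineK//.
  exact: integrable_fin_num (iF i).
by rewrite sumEFin.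
Qed.

Lemma pairing_sum (I : Type) (s : seq I) f (phi : I -> 'rV[R]_n -> R) :
  f \in Lfun mu 2%:E -> (forall i, phi i \in Lfun mu 2%:E) ->
  pairing f (fun x => \sum_(i <- s) phi i x) = \sum_(i <- s) pairing f (phi i).
Proof.
move=> f2 p2; rewrite /pairing -Rintegral_sum; last first.
  by move=> i; exact: integrable_pairing.
by apply: eq_Rintegral => x _; rewrite mulr_sumr.
Qed.

Lemma pairingZr k f phi : f \in Lfun mu 2%:E -> phi \in Lfun mu 2%:E ->
  pairing f (fun x => k * phi x) = k * pairing f phi.
Proof.
move=> f2 p2; rewrite /pairing -RintegralZl//; last exact: integrable_pairing.
by apply: eq_Rintegral => x _; rewrite mulrCA.
Qed.

Lemma Lfun2Zl k f : f \in Lfun mu 2%:E -> (fun x => k * f x) \in Lfun mu 2%:E.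
Proof.
move=> f2; rewrite (_ : (fun x => _) = (fun x => k * f x + (f x - f x))).
  by apply: Lfun_comb => //; exact: LfunB.
by apply/funext => x; rewrite subrr addr0.
Qed.

(** The spatial integrals of the weak formulation, for a separated test function:
    the weak derivatives are moved onto the spatial factor. *)
Lemma sep_prod_weak_integral f g (a G : R -> R) (B s : R) :
  sobolev 1 f -> g \in Lfun mu 2%:E -> smooth a -> smooth G ->
  0 <= B -> (forall t, B <= t -> G t = 0) ->
  \int[mu]_x (\sum_(i < n) weak_partial i f x * dx i (sep_prod a G) s x -
              g x * dt (sep_prod a G) s x) =
  - a s * pairing f (fun x => \sum_(i < n)
              'D_('e_i) (fun x => 'D_('e_i) (radial G) x) x)
  - 'D_1 a s * pairing g (radial G).
Proof.
move=> f1 g2 sa sG B0 GB; have f2 := sobolev_Lfun f1.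
have tG : test_function (radial G : 'rV[R]_n -> R) by exact: test_radial GB.
have tD (i : 'I_n) : test_function (fun x : 'rV[R]_n => 'D_('e_i) (radial G) x).
  exact: test_function_derive tG.
have tDD (i : 'I_n) :
    test_function (fun x : 'rV[R]_n => 'D_('e_i) (fun x => 'D_('e_i) (radial G) x) x).
  exact: test_function_derive (tD i).
have G2 := test_function_Lfun2 tG.
have D2 i := test_function_Lfun2 (tD i).
have DD2 i := test_function_Lfun2 (tDD i).
have Lw i : weak_partial i f \in Lfun mu 2%:E by have [] := weak_partialP i f1.
transitivity (\int[mu]_x (
    (\sum_(i < n) weak_partial i f x * (a s * 'D_('e_i) (radial G) x)) -
     g x * ('D_1 a s * radial G x))).
  apply: eq_Rintegral => x _; rewrite dt_sep_prod//; congr (_ - _).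
  by apply: eq_bigr => i _; rewrite dx_sep_prod.
rewrite RintegralB//; last 2 first.
- rewrite (_ : _ \o _ = fun x => (\sum_(i < n)
      (weak_partial i f x * (a s * 'D_('e_i) (radial G) x))%:E)%E).
    apply: (@integrable_sum _ _ _ mu _ _ _ _ _ (fun i x =>
      (weak_partial i f x * (a s * 'D_('e_i) (radial G) x))%:E)) => // i _.
    by apply: integrable_pairing => //; exact: Lfun2Zl.
  by apply/funext => x /=; rewrite sumEFin.
- by apply: integrable_pairing => //; exact: Lfun2Zl.
congr (_ - _); last exact: pairingZr.
rewrite (@Rintegral_sum _ _ (fun i x => weak_partial i f x * (a s * 'D_('e_i) (radial G) x))).
  rewrite pairing_sum// mulr_sumr; apply: eq_bigr => i _.
  rewrite -[LHS]/(pairing (weak_partial i f) (fun x => a s * 'D_('e_i) (radial G) x)).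
  rewrite pairingZr// mulNr -mulrN; congr (_ * _).
  have [_ /(_ _ (tD i)) E] := weak_partialP i f1.
  by rewrite /pairing E opprK.
by move=> i; apply: integrable_pairing => //; exact: Lfun2Zl.
Qed.

Lemma ae_eq_pairing f g phi psi :
  measurable_fun setT f -> measurable_fun setT g ->
  measurable_fun setT phi -> measurable_fun setT psi ->
  {ae mu, forall x, f x * phi x = g x * psi x} -> pairing f phi = pairing g psi.
Proof.
move=> mf mg mp mq H; rewrite /pairing /Rintegral; congr fine.
apply: ae_eq_integral => //.
- by apply/measurable_EFinP; exact: measurable_funM.
- by apply/measurable_EFinP; exact: measurable_funM.
- by apply: filterS H => x + _ => ->.
Qed.

(** Points outside the support have null neighbourhoods; countably many rational boxes
    suffice to cover them. *)
Lemma ess_supp_ae f (rho : R) : ess_supp f `<=` eucl_ball rho ->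
  {ae mu, forall x, ~ eucl_ball rho x -> f x = 0}.
Proof.
move=> sf.
pose P (c : 'rV[rat]_n * nat) (y : 'rV[R]_n) :=
  {ae mu, forall z, rat_box c z -> f z = 0} -> rat_box c y -> f y = 0.
have : {ae mu, forall y, forall m : nat, if unpickle m is Some c then P c y else True}.
  apply/ae_foralln => m; case: unpickle => [c|]; last exact: aeW.
  have [H|H] := pselect {ae mu, forall z, rat_box c z -> f z = 0}.
    by apply: filterS H => y + _.
  by apply: aeW => y.
apply: filterS => y Hy yr.
have [e e0 He] : exists2 e : R, 0 < e & {ae mu, forall z, ball y e z -> f z = 0}.
  apply: contrapT => H; apply: yr; apply: sf => e e0 He.
  by apply: H; exists e.
have [c cy ce] := rat_box_basis y e0.
have := Hy (pickle c); rewrite pickleK; apply => //.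
by apply: filterS He => z + /ce.
Qed.

End test_pairing.

(** * Regularity in time of the pairings of a solution *)

Section time_regularity.
Context {R : realType} {n : nat} (T : \bar R).
Local Notation mu := (@lebesgue_rV R n).
Variables u ut utt : R -> 'rV[R]_n -> R.
Hypothesis u_C2L2 : class_CH 2 0 T u.
Hypothesis u_C1H1 : class_CH 1 1 T u.
Hypothesis d_ut : derivative_H 1 T u ut.
Hypothesis d_utt : derivative_H 0 T ut utt.

Lemma u_sobolev1 t : lifetime T t -> sobolev 1 (u t).
Proof. by move=> tT; have [uc _] := u_C1H1; have [] := uc t tT. Qed.

Lemma ut_sobolev1 t : lifetime T t -> sobolev 1 (ut t).
Proof. by move=> tT; have [] := d_ut tT. Qed.

Lemma u_Lfun t : lifetime T t -> u t \in Lfun mu 2%:E.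
Proof. by move=> /u_sobolev1/sobolev_Lfun. Qed.

Lemma ut_Lfun t : lifetime T t -> ut t \in Lfun mu 2%:E.
Proof. by move=> /ut_sobolev1/sobolev_Lfun. Qed.

Lemma utt_Lfun t : lifetime T t -> utt t \in Lfun mu 2%:E.
Proof. by move=> tT; have [/sobolev_Lfun] := d_utt tT. Qed.

Lemma quotient_unique (F : R -> R) (t l l' : R) : lifetime T t ->
  (s - t)^-1 * (F s - F t) @[s --> within (lifetime T) t^'] --> l ->
  (s - t)^-1 * (F s - F t) @[s --> within (lifetime T) t^'] --> l' -> l = l'.
Proof.
move=> tT H1 H2; have PF := within_lifetime_proper tT.
exact: (cvg_unique _ H1 H2).
Qed.

(** The integrals of [u], [ut], [utt] against a fixed function behave as a [C^2]
    function of time and its derivatives; the derivatives exhibited by the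
    regularity classes agree with [ut] and [utt] as limits are unique. *)
Lemma pairing_C2 phi : phi \in Lfun mu 2%:E ->
  forall t, lifetime T t ->
  [/\ pairing (u s) phi @[s --> within (lifetime T) (nbhs t)] --> pairing (u t) phi,
      pairing (ut s) phi @[s --> within (lifetime T) (nbhs t)] --> pairing (ut t) phi,
      pairing (utt s) phi @[s --> within (lifetime T) (nbhs t)] --> pairing (utt t) phi,
      0 < t -> is_derive t (1:R) (fun s => pairing (u s) phi) (pairing (ut t) phi) &
      0 < t -> is_derive t (1:R) (fun s => pairing (ut s) phi) (pairing (utt t) phi)].
Proof.
move=> p2 t tT; have [uc [v dv [vc [w dw [wc _]]]]] := u_C2L2.
have v2 s : lifetime T s -> v s \in Lfun mu 2%:E.
  by move=> sT; have [/sobolev_Lfun] := vc s sT.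
have utv s : lifetime T s -> pairing (ut s) phi = pairing (v s) phi.
  move=> sT; apply: (quotient_unique sT).
    exact: (pairing_derivative u_Lfun d_ut p2 sT).
  exact: (pairing_derivative u_Lfun dv p2 sT).
have uttw s : lifetime T s -> pairing (utt s) phi = pairing (w s) phi.
  move=> sT; apply: (quotient_unique sT).
    exact: (pairing_derivative ut_Lfun d_utt p2 sT).
  apply: cvg_trans (pairing_derivative v2 dw p2 sT).
  apply: near_eq_cvg; rewrite near_withinE; apply: nearW => s' s'T.
  by rewrite !utv.
split.
- exact: pairing_continuous uc p2 tT.
- rewrite utv//; apply: cvg_trans (pairing_continuous vc p2 tT).
  apply: near_eq_cvg; rewrite near_withinE; apply: nearW => s sT.
  by rewrite utv.
- rewrite uttw//; apply: cvg_trans (pairing_continuous wc p2 tT).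
  apply: near_eq_cvg; rewrite near_withinE; apply: nearW => s sT.
  by rewrite uttw.
- have [_ tT'] := tT; move=> t0; apply: (lifetime_is_derive t0 tT').
  exact: (pairing_derivative u_Lfun d_ut p2 tT).
- have [_ tT'] := tT; move=> t0; apply: (lifetime_is_derive t0 tT').
  exact: (pairing_derivative ut_Lfun d_utt p2 tT).
Qed.

(** A relation that is linear in [u] and holds on a time interval may be differentiated in
    time; [ut] has no support property of its own from which to derive it directly. *)
Lemma pairing_ut_relation phi psi (k tau : R) :
  phi \in Lfun mu 2%:E -> psi \in Lfun mu 2%:E ->
  (forall t, lifetime T t -> t < tau -> pairing (u t) psi = k * pairing (u t) phi) ->
  forall t, lifetime T t -> t < tau -> pairing (ut t) psi = k * pairing (ut t) phi.
Proof.
move=> p2 q2 H t tT ttau; apply: (quotient_unique tT).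
  exact: (pairing_derivative u_Lfun d_ut q2 tT).
have D := pairing_derivative u_Lfun d_ut p2 tT.
have D' : k * ((s - t)^-1 * (pairing (u s) phi - pairing (u t) phi))
    @[s --> within (lifetime T) t^'] --> k * pairing (ut t) phi.
  by apply: cvgM D; exact: cvg_cst.
apply: cvg_trans D'; apply: near_eq_cvg; rewrite near_withinE.
have : \forall s \near t^', s < tau.
  by apply: cvg_within; exact: lt_nbhsl.
by apply: filterS => s stau sT; rewrite !H//; ring.
Qed.

End time_regularity.

(** * Integration by parts in the weak formulation *)

Section calculus_on_segment.
Context {R : realType}.
Implicit Types (f g : R -> R) (a b : R).

Lemma within_continuousM (A : set R) f g : {within A, continuous f} ->
  {within A, continuous g} -> {within A, continuous (fun x => f x * g x)}.
Proof. by move=> cf cg x; apply: continuousM; [exact: cf|exact: cg]. Qed.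

Lemma within_continuousD (A : set R) f g : {within A, continuous f} ->
  {within A, continuous g} -> {within A, continuous (fun x => f x + g x)}.
Proof. by move=> cf cg x; apply: continuousD; [exact: cf|exact: cg]. Qed.

Lemma derivable_continuous f df : (forall x : R, is_derive x (1:R) f (df x)) ->
  continuous f.
Proof.
move=> H x; apply: differentiable_continuous; apply/derivable1_diffP.
by have [] := H x.
Qed.

Lemma segment_integrable f a b : {within `[a, b], continuous f} ->
  lebesgue_measure.-integrable `[a, b] (EFin \o f).
Proof. by move=> cf; apply: continuous_compact_integrable => //; exact: segment_compact. Qed.

Lemma Rintegral_FTC2 (f F : R -> R) a b : a < b ->
  {within `[a, b], continuous f} -> {within `[a, b], continuous F} ->
  (forall x, a < x < b -> is_derive x (1:R) F (f x)) ->
  \int[lebesgue_measure]_(x in `[a, b]) f x = F b - F a.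
Proof.
move=> ab cf cF dF; rewrite /Rintegral (@continuous_FTC2 _ f F)//.
  have [_ Fa Fb] := (continuous_within_itvP F ab).1 cF.
  split => // x; rewrite in_itv/= => xab.
  by have [] := dF x xab.
move=> x; rewrite in_itv/= => xab; rewrite derive1E.
by have [] := dF x xab.
Qed.

End calculus_on_segment.

Lemma ge0_RintegralZl d (X : measurableType d) (R : realType)
    (m : {measure set X -> \bar R}) (c : R) (f : X -> R) :
  0 <= c -> measurable_fun setT f -> (forall x, 0 <= f x) ->
  \int[m]_x (c * f x) = c * \int[m]_x f x.
Proof.
move=> c0 mf f0; rewrite /Rintegral.
under eq_integral do rewrite EFinM.
rewrite ge0_integralZl_EFin//; last first.
- exact/measurable_EFinP.
- by move=> x _; rewrite lee_fin.
have : (0 <= \int[m]_x (f x)%:E)%E by apply: integral_ge0 => x _; rewrite lee_fin.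
case: (integral _ _ _) => [y| |//] _; first by rewrite -EFinM.
by have [->|cN0] := eqVneq c 0; rewrite ?mul0e ?mul0r// gt0_muley ?mulr0// lte_fin lt_neqAle eq_sym cN0.
Qed.

(** Replaces the seven integrals of the weak formulation by their values in one step. *)
Lemma weak_sum_congr (R : realType) (beta eps a1 a2 a3 a4 a5 a6 a7
    b1 b2 b3 b4 b5 b6 b7 : R) :
  a1 = b1 -> a2 = b2 -> a3 = b3 -> a4 = b4 -> a5 = b5 -> a6 = b6 -> a7 = b7 ->
  beta * a1 + a2 - beta * eps * a3 - eps * a4 + beta * a5 + a6 = a7 ->
  beta * b1 + b2 - beta * eps * b3 - eps * b4 + beta * b5 + b6 = b7.
Proof. by do 7!move->. Qed.

Section weak_identity.
Context {R : realType} {n : nat} (T : \bar R).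
Local Notation mu := (@lebesgue_rV R n).
Variables (beta p eps r kappa : R) (u0 u1 u2 : 'rV[R]_n -> R).
Variables u ut utt : R -> 'rV[R]_n -> R.
Hypothesis u_C2L2 : class_CH 2 0 T u.
Hypothesis u_C1H1 : class_CH 1 1 T u.
Hypothesis d_ut : derivative_H 1 T u ut.
Hypothesis d_utt : derivative_H 0 T ut utt.
Hypothesis u_init : {ae mu, forall x, u 0 x = eps * u0 x}.
Hypothesis ut_init : {ae mu, forall x, ut 0 x = eps * u1 x}.
Hypothesis u0_Lfun : u0 \in Lfun mu 2%:E.
Hypothesis u1_Lfun : u1 \in Lfun mu 2%:E.
Hypothesis u2_Lfun : u2 \in Lfun mu 2%:E.
Hypothesis weak : forall psi, spacetime_test T psi -> forall t, lifetime T t ->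
  beta * \int[mu]_x (utt t x * psi (t, x))
  + \int[mu]_x (ut t x * psi (t, x))
  - beta * eps * \int[mu]_x (u2 x * psi (0, x))
  - eps * \int[mu]_x (u1 x * psi (0, x))
  + beta * \int[lebesgue_measure]_(s in `[0, t]) \int[mu]_x
      (\sum_(i < n) weak_partial i (ut s) x * dx i psi s x
       - utt s x * dt psi s x)
  + \int[lebesgue_measure]_(s in `[0, t]) \int[mu]_x
      (\sum_(i < n) weak_partial i (u s) x * dx i psi s x
       - ut s x * dt psi s x)
  = \int[lebesgue_measure]_(s in `[0, t]) \int[mu]_x
      (`|u s x| `^ p * psi (s, x)).
Hypothesis u_supp : forall t, lifetime T t ->
  {ae mu, forall x, ~ eucl_ball (r + t) x -> u t x = 0}.
Variables (G : R -> R) (B T1 tau : R).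
Hypothesis sG : smooth G.
Hypothesis B_ge0 : 0 <= B.
Hypothesis G0 : forall s, B <= s -> G s = 0.
Hypothesis T1_gt0 : 0 < T1.
Hypothesis T1_tau : T1 < tau.
Hypothesis tauT : (tau%:E < T)%E.
Hypothesis eigen_G : forall s, 0 <= s -> s <= (r + tau) ^+ 2 ->
  4 * s * 'D_1 (fun s => 'D_1 G s) s + 2 * n%:R * 'D_1 G s = kappa * G s.
Variables z0 z1 z2 z3 : R -> R.
Hypothesis sz0 : smooth z0.
Hypothesis dz0 : forall s : R, is_derive s (1:R) z0 (z1 s).
Hypothesis dz1 : forall s : R, is_derive s (1:R) z1 (z2 s).
Hypothesis dz2 : forall s : R, is_derive s (1:R) z2 (z3 s).
Hypothesis cz3 : continuous z3.
Hypothesis z0_ge0 : forall s, 0 <= s <= T1 -> 0 <= z0 s.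
Hypothesis G_ge0 : forall s, 0 <= s -> 0 <= G s.
Hypothesis z0T : z0 T1 = 0.
Hypothesis z1T : z1 T1 = 0.
Hypothesis z2T : z2 T1 = 0.

Let phi : 'rV[R]_n -> R := radial G.
Let lap : 'rV[R]_n -> R :=
  fun x => \sum_(i < n) 'D_('e_i) (fun x => 'D_('e_i) (radial G) x) x.

Let phi_test : test_function phi.
Proof. exact: test_radial G0. Qed.

Let phi2 : phi \in Lfun mu 2%:E.
Proof. exact: test_function_Lfun2. Qed.

Let lap2 : lap \in Lfun mu 2%:E.
Proof.
have H i : (fun x : 'rV[R]_n => 'D_('e_i) (fun x => 'D_('e_i) (radial G) x) x) \in Lfun mu 2%:E.
  by apply: test_function_Lfun2; apply: test_function_derive; exact: test_function_derive phi_test.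
rewrite /lap; elim: (index_enum _) => [|i s IH].
  rewrite (_ : (fun x => _) = fun x => phi x - phi x); first exact: LfunB.
  by apply/funext => x; rewrite big_nil subrr.
rewrite (_ : (fun x => _) = fun x => 1 * 'D_('e_i) (fun x => 'D_('e_i) (radial G) x) x +
    \sum_(j <- s) 'D_('e_j) (fun x => 'D_('e_j) (radial G) x) x).
  exact: Lfun_comb.
by apply/funext => x; rewrite big_cons mul1r.
Qed.

Let in_lifetime t : 0 <= t -> t <= tau -> lifetime T t.
Proof. by move=> t0 tt; split => //; rewrite (le_lt_trans _ tauT)// lee_fin. Qed.

Let lap_u t : lifetime T t -> t < tau -> pairing (u t) lap = kappa * pairing (u t) phi.
Proof.
move=> tT ttau; have u2' := u_Lfun u_C1H1 tT; have mu' := Lfun_measurable u2'.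
have mp := Lfun_measurable phi2; have ml := Lfun_measurable lap2.
rewrite -pairingZr//; apply: ae_eq_pairing => //.
  by apply: measurable_funM => //; exact: measurable_cst.
apply: filterS (u_supp tT) => x xr.
have [xb|/xr ->] := pselect (eucl_ball (r + t) x); last by rewrite !mul0r.
congr (_ * _); rewrite /lap laplacian_radial//; apply: eigen_G; first exact: sqr_ge0.
have xt : eucl_norm x <= r + tau by apply: (le_trans xb); rewrite lerD2l ltW.
have x0 := eucl_norm_ge0 x.
by apply: lerXn2r => //; rewrite nnegrE//; exact: le_trans xt.
Qed.

Let lap_ut t : lifetime T t -> t < tau -> pairing (ut t) lap = kappa * pairing (ut t) phi.
Proof. exact: (pairing_ut_relation u_C1H1 d_ut phi2 lap2 lap_u). Qed.

(** Testing the weak formulation with [z0 (t) * phi (x)] and integrating by parts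
    in time moves all the derivatives onto [z0]. *)
Lemma weak_identity :
  \int[lebesgue_measure]_(s in `[0, T1]) (z0 s * \int[mu]_x (`|u s x| `^ p * phi x))
  + eps * z0 0 * (beta * pairing u2 phi + pairing u1 phi)
  - beta * (eps * pairing u1 phi * z1 0 - eps * pairing u0 phi * z2 0)
  - eps * pairing u0 phi * z1 0 - beta * kappa * z0 0 * (eps * pairing u0 phi)
  = \int[lebesgue_measure]_(s in `[0, T1])
      (pairing (u s) phi * (z2 s - beta * z3 s + beta * kappa * z1 s - kappa * z0 s))
  /\ measurable_fun `[0, T1] (fun s =>
      pairing (u s) phi * (z2 s - beta * z3 s + beta * kappa * z1 s - kappa * z0 s)).
Proof.
have tau_gt0 : 0 < tau by exact: lt_trans T1_tau.
have [tau2 tau_tau2 tau2T] : exists2 tau2 : R, tau < tau2 & (tau2%:E < T)%E.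
  have [|d d0 dT] := @lifetime_right R T tau; first by apply: in_lifetime => //; exact: ltW.
  by exists (tau + d) => //; rewrite ltrDl.
have tau2_gt0 : 0 < tau2 by exact: lt_trans tau_tau2.
have sq_tau : tau ^+ 2 < tau2 ^+ 2 by rewrite ltr_pXn2r// nnegrE ltW.
(* The test function must be compactly supported in time; cutting off [z0] in the variable
   [t ^ 2] leaves it unchanged on [- tau, tau], a neighbourhood of [0, T1]. *)
pose a (t : R) := z0 t * smooth_step (tau ^+ 2) (tau2 ^+ 2) (t ^+ 2).
have sid : smooth (id : R -> R) by apply: smooth_scalar => // x; exact: cvg_id.
have sa : smooth a.
  apply: smoothM => //; apply: (smooth_comp (@smooth_smooth_step R _ _)).
  exact: smoothM.
have a_z0 t : - tau < t < tau -> a t = z0 t.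
  move=> /andP[t1 t2]; rewrite /a smooth_step1// ?mulr1//.
  have tt : `|t| <= tau by rewrite ler_norml !ltW.
  by rewrite -[t ^+ 2]real_normK ?num_real// lerXn2r ?nnegrE// ltW.
have da t : 0 <= t <= T1 -> 'D_1 a t = z1 t.
  move=> /andP[t1 t2].
  have a_near : \near t, z0 t = a t.
    have : nbhs t `]- tau, tau[%classic.
      by apply: near_in_itvoo; rewrite in_itv/= (lt_le_trans _ t1) ?oppr_lt0// (le_lt_trans t2).
    by apply: filterS => s /=; rewrite in_itv/= => st; rewrite a_z0.
  by have [_ ->] := near_eq_is_derive a_near (dz0 t).
have aT1 : a T1 = 0 by rewrite a_z0// T1_tau (lt_trans _ T1_gt0)// oppr_lt0.
have a0 : a 0 = z0 0 by rewrite a_z0// oppr_lt0 tau_gt0.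
have psiT : spacetime_test T (sep_prod a G : R * 'rV[R]_n -> R).
  refine (@spacetime_test_sep_prod R n T a G tau2 B sa sG B_ge0 G0 _ tau2T) => t tau2t.
  rewrite /a smooth_step0 ?mulr0// -[t ^+ 2]real_normK ?num_real//.
  by rewrite lerXn2r ?nnegrE// ltW.
have life t : 0 <= t <= T1 -> lifetime T t /\ t < tau.
  move=> /andP[t1 t2]; split; last exact: le_lt_trans T1_tau.
  by apply: in_lifetime => //; rewrite (le_trans t2)// ltW.
have [T1T _] : lifetime T T1 /\ T1 < tau by apply: life; rewrite lexx ltW.
have [T0 _] : lifetime T 0 /\ 0 < tau by apply: life; rewrite lexx ltW.
have sep f t : f \in Lfun mu 2%:E ->
    \int[mu]_x (f x * (sep_prod a G) (t, x)) = a t * pairing f phi.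
  by move=> f2; rewrite -pairingZr.
have A1 := sep _ T1 (utt_Lfun d_utt T1T); have A2 := sep _ T1 (ut_Lfun d_ut T1T).
have A3 := sep _ 0 u2_Lfun; have A4 := sep _ 0 u1_Lfun.
pose F0 s := pairing (u s) phi; pose F1 s := pairing (ut s) phi.
pose F2 s := pairing (utt s) phi.
have FC2 := pairing_C2 u_C2L2 u_C1H1 d_ut d_utt phi2.
have sub : `[0, T1]%classic `<=` lifetime T.
  by move=> t /=; rewrite in_itv/= => /life[].
have cF0 : {within `[0, T1], continuous F0}.
  apply: (continuous_subspaceW sub); apply/subspace_continuousP => t tT.
  by have [] := FC2 t tT.
have cF1 : {within `[0, T1], continuous F1}.
  apply: (continuous_subspaceW sub); apply/subspace_continuousP => t tT.
  by have [] := FC2 t tT.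
have cF2 : {within `[0, T1], continuous F2}.
  apply: (continuous_subspaceW sub); apply/subspace_continuousP => t tT.
  by have [] := FC2 t tT.
have cz0 : {within `[0, T1], continuous z0}.
  by apply: continuous_subspaceT; exact: derivable_continuous dz0.
have cz1 : {within `[0, T1], continuous z1}.
  by apply: continuous_subspaceT; exact: derivable_continuous dz1.
have cz2 : {within `[0, T1], continuous z2}.
  by apply: continuous_subspaceT; exact: derivable_continuous dz2.
have cz3' : {within `[0, T1], continuous z3} by exact: continuous_subspaceT.
have cc (k : R) : {within `[0, T1], continuous (fun=> k)}.
  by apply: continuous_subspaceT; exact: cst_continuous.
have cM := @within_continuousM R `[0, T1]%classic.
have cD := @within_continuousD R `[0, T1]%classic.
pose X s := - kappa * (z0 s * F1 s) + - 1 * (z1 s * F2 s).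
pose Y s := - kappa * (z0 s * F0 s) + - 1 * (z1 s * F1 s).
pose Z s := z2 s + - beta * z3 s + (beta * kappa) * z1 s + - kappa * z0 s.
have cX : {within `[0, T1], continuous X}.
  exact: (cD _ _ (cM _ _ (cc (- kappa)) (cM _ _ cz0 cF1)) (cM _ _ (cc (- 1)) (cM _ _ cz1 cF2))).
have cY : {within `[0, T1], continuous Y}.
  exact: (cD _ _ (cM _ _ (cc (- kappa)) (cM _ _ cz0 cF0)) (cM _ _ (cc (- 1)) (cM _ _ cz1 cF1))).
have cFZ : {within `[0, T1], continuous (fun s => F0 s * Z s)}.
  exact: (cM _ _ cF0 (cD _ _ (cD _ _ (cD _ _ cz2 (cM _ _ (cc (- beta)) cz3')) (cM _ _ (cc (beta * kappa)) cz1)) (cM _ _ (cc (- kappa)) cz0))).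
(* [P] collects the boundary terms of all the integrations by parts in time. *)
pose P s := - beta * (F1 s * z1 s) + beta * (F0 s * z2 s) + - 1 * (F0 s * z1 s) +
  (- beta * kappa) * (z0 s * F0 s).
have cP : {within `[0, T1], continuous P}.
  exact: (cD _ _ (cD _ _ (cD _ _ (cM _ _ (cc (- beta)) (cM _ _ cF1 cz1)) (cM _ _ (cc (beta)) (cM _ _ cF0 cz2))) (cM _ _ (cc (- 1)) (cM _ _ cF0 cz1))) (cM _ _ (cc (- beta * kappa)) (cM _ _ cz0 cF0))).
have IX : \int[lebesgue_measure]_(s in `[0, T1]) \int[mu]_x
      (\sum_(i < n) weak_partial i (ut s) x * dx i (sep_prod a G) s x
       - utt s x * dt (sep_prod a G) s x) = \int[lebesgue_measure]_(s in `[0, T1]) X s.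
  apply: eq_Rintegral => s; rewrite inE/= in_itv/= => sT1.
  have [sT stau] := life s sT1; have /andP[s0 s1] := sT1.
  rewrite (sep_prod_weak_integral s (ut_sobolev1 d_ut sT) (utt_Lfun d_utt sT) sa sG B_ge0 G0).
  rewrite -/phi -/lap lap_ut// da// a_z0 /X /F1 /F2; first by ring.
  by rewrite (lt_le_trans _ s0) ?oppr_lt0.
have IY : \int[lebesgue_measure]_(s in `[0, T1]) \int[mu]_x
      (\sum_(i < n) weak_partial i (u s) x * dx i (sep_prod a G) s x
       - ut s x * dt (sep_prod a G) s x) = \int[lebesgue_measure]_(s in `[0, T1]) Y s.
  apply: eq_Rintegral => s; rewrite inE/= in_itv/= => sT1.
  have [sT stau] := life s sT1; have /andP[s0 s1] := sT1.
  rewrite (sep_prod_weak_integral s (u_sobolev1 u_C1H1 sT) (ut_Lfun d_ut sT) sa sG B_ge0 G0).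
  rewrite -/phi -/lap lap_u// da// a_z0 /Y /F0 /F1; first by ring.
  by rewrite (lt_le_trans _ s0) ?oppr_lt0.
have IN : \int[lebesgue_measure]_(s in `[0, T1]) \int[mu]_x
      (`|u s x| `^ p * (sep_prod a G) (s, x)) =
    \int[lebesgue_measure]_(s in `[0, T1]) (z0 s * \int[mu]_x (`|u s x| `^ p * phi x)).
  apply: eq_Rintegral => s; rewrite inE/= in_itv/= => sT1.
  have [sT stau] := life s sT1; have /andP[s0 s1] := sT1.
  have mus := Lfun_measurable (u_Lfun u_C1H1 sT).
  rewrite -ge0_RintegralZl ?z0_ge0//.
  - apply: eq_Rintegral => x _; rewrite /sep_prod/= a_z0; first by rewrite mulrCA.
    by rewrite (lt_le_trans _ s0) ?oppr_lt0.
  - apply: measurable_funM; last exact: Lfun_measurable phi2.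
    by apply: (measurableT_comp (measurable_powR p)); exact: measurableT_comp.
  - by move=> x; rewrite mulr_ge0 ?powR_ge0// G_ge0// sqr_ge0.
have FT : \int[lebesgue_measure]_(s in `[0, T1]) (beta * X s + Y s - F0 s * Z s) = P T1 - P 0.
  apply: Rintegral_FTC2 T1_gt0 _ cP _.
    rewrite (_ : (fun s => _) = fun s => beta * X s + Y s + - 1 * (F0 s * Z s)).
      exact: (cD _ _ (cD _ _ (cM _ _ (cc (beta)) cX) cY) (cM _ _ (cc (- 1)) cFZ)).
    by apply/funext => s; rewrite mulN1r.
  move=> s /andP[s0 s1].
  have [sT _] : lifetime T s /\ s < tau by apply: life; rewrite !ltW.
  have [_ _ _ /(_ s0) D0 /(_ s0) D1] := FC2 s sT.
  have E1 := is_deriveZ (- beta) (is_deriveM D1 (dz1 s)).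
  have E2 := is_deriveZ beta (is_deriveM D0 (dz2 s)).
  have E3 := is_deriveZ (- 1) (is_deriveM D0 (dz1 s)).
  have E4 := is_deriveZ (- beta * kappa) (is_deriveM (dz0 s) D0).
  have E := is_deriveD (is_deriveD (is_deriveD E1 E2) E3) E4.
  apply: (is_derive_eq E); rewrite /X /Y /Z /F0 /F1 /F2 /GRing.scale/=; ring.
have iX := segment_integrable cX; have iY := segment_integrable cY.
have iFZ := segment_integrable cFZ.
have ibX : lebesgue_measure.-integrable `[0, T1] (EFin \o (fun s => beta * X s)).
  exact: segment_integrable (cM _ _ (cc beta) cX).
have ibXY : lebesgue_measure.-integrable `[0, T1] (EFin \o (fun s => beta * X s + Y s)).
  exact: segment_integrable (cD _ _ (cM _ _ (cc beta) cX) cY).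
rewrite RintegralB// RintegralD// RintegralZl// in FT.
have PT1 : P T1 = 0 by rewrite /P z0T z1T z2T !mulr0 mul0r mulr0 !addr0.
have m0 := Lfun_measurable u0_Lfun; have m1 := Lfun_measurable u1_Lfun.
have mphi := Lfun_measurable phi2.
have F00 : F0 0 = eps * pairing u0 phi.
  rewrite -pairingZl//; apply: ae_eq_pairing => //.
  - exact: Lfun_measurable (u_Lfun u_C1H1 T0).
  - exact: measurable_funM.
  - by apply: filterS u_init => x ->.
have F10 : F1 0 = eps * pairing u1 phi.
  rewrite -pairingZl//; apply: ae_eq_pairing => //.
  - exact: Lfun_measurable (ut_Lfun d_ut T0).
  - exact: measurable_funM.
  - by apply: filterS ut_init => x ->.
have eqZ : (fun s => pairing (u s) phi *
    (z2 s - beta * z3 s + beta * kappa * z1 s - kappa * z0 s)) = (fun s => F0 s * Z s).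
  by apply/funext => s; congr (_ * _); rewrite /Z; ring.
rewrite eqZ; split; last first.
  by apply/measurable_EFinP; exact: measurable_int iFZ.
have W := weak_sum_congr A1 A2 A3 A4 IX IY IN (weak psiT T1T).
rewrite aT1 a0 !mul0r in W; rewrite -W.
move: FT; rewrite PT1 sub0r /P F00 F10 => FT.
move: FT; move: (\int[lebesgue_measure]_(s in `[0, T1]) (F0 s * Z s))
  (\int[lebesgue_measure]_(s in `[0, T1]) X s)
  (\int[lebesgue_measure]_(s in `[0, T1]) Y s) => fz x y FT.
by rewrite -[RHS](subKr (beta * x + y)) FT; ring.
Qed.

End weak_identity.

(** * The weighted Young inequality *)

Section young.
Context {R : realType} {n : nat}.
Local Notation mu := (@lebesgue_rV R n).

(** Young's inequality for [c f] and [(L / c) g]; the free factor [c] shifts weight from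
    one term to the other. The factors [1 / p] and [1 / q] are bounded by 1. *)
Lemma young_scaled (p q c f g L : R) : 1 < p -> 1 < q -> p^-1 + q^-1 = 1 ->
  0 < c -> 0 <= L -> 0 <= f -> 0 <= g ->
  L * (f * g) <= c `^ p * f `^ p + (L / c) `^ q * g `^ q.
Proof.
move=> p1 q1 pq c0 L0 f0 g0.
have p0 : 0 < p by exact: lt_trans p1.
have q0 : 0 < q by exact: lt_trans q1.
have Lc : 0 <= L / c by rewrite divr_ge0// ltW.
have := conjugate_powR (mulr_ge0 (ltW c0) f0) (mulr_ge0 Lc g0) p0 q0 pq.
have -> : c * f * (L / c * g) = L * (f * g) by field; rewrite gt_eqF.
move=> /le_trans; apply; rewrite -!powRM ?(ltW c0)//.
by apply: lerD; rewrite ler_piMr ?powR_ge0// invf_le1// ltW.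
Qed.

Lemma abs_Rintegral_le d (X : measurableType d) (m : {measure set X -> \bar R})
    (D : set X) (f : X -> R) : measurable D -> measurable_fun D f ->
  (`|\int[m]_(x in D) f x|%:E <= \int[m]_(x in D) `|f x|%:E)%E.
Proof.
move=> mD mf; apply: (@le_trans _ _ `|\int[m]_(x in D) (f x)%:E|%E).
  by rewrite /Rintegral; case: (integral _ _ _) => [x| |]//=; rewrite normr0 leey.
by apply: le_abse_integral => //; exact/measurable_EFinP.
Qed.

(** Integrated Young inequality: [f] lives in the ball, so [chi], which is at least 1
    there, may be inserted in front of [|f| ^ p], and the term with [g] needs to be
    integrated over the ball only. *)
Lemma pairing_young (p q c L rho : R) (f phi chi g : 'rV[R]_n -> R) :
  1 < p -> 1 < q -> p^-1 + q^-1 = 1 -> 0 < c -> 0 <= L ->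
  measurable_fun setT f -> measurable_fun setT phi ->
  measurable_fun setT chi -> measurable_fun setT g ->
  {ae mu, forall x, ~ eucl_ball rho x -> f x = 0} ->
  (forall x, 0 <= chi x) ->
  (forall x, eucl_ball rho x -> 1 <= chi x) ->
  (forall x, eucl_ball rho x -> `|phi x| <= g x) ->
  ((L * `|pairing f phi|)%:E <=
   (c `^ p)%:E * \int[mu]_x (`|f x| `^ p * chi x)%:E +
   ((L / c) `^ q)%:E * \int[mu]_(x in eucl_ball rho) (g x `^ q)%:E)%E.
Proof.
move=> p1 q1 pq c0 L0 mf mp mc mg f0 chi0 chi1 phig.
have mfp : measurable_fun setT (fun x => `|f x| `^ p * chi x).
  apply: measurable_funM => //; apply: (measurableT_comp (measurable_powR p)).
  exact: measurableT_comp.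
have mgq : measurable_fun setT (fun x => g x `^ q).
  exact: (measurableT_comp (measurable_powR q)).
have mB := measurable_eucl_ball rho : measurable (eucl_ball rho : set 'rV[R]_n).
have cp0 : 0 <= c `^ p by exact: powR_ge0.
have Lq0 : 0 <= (L / c) `^ q by exact: powR_ge0.
have mfphi : measurable_fun setT (fun x => (`|f x * phi x|)%:E).
  by apply/measurable_EFinP; apply: measurableT_comp => //; exact: measurable_funM.
have m1 : measurable_fun setT (fun x => (`|f x| `^ p * chi x)%:E) by exact/measurable_EFinP.
pose g1 : 'rV[R]_n -> \bar R := (fun x => (g x `^ q)%:E) \_ (eucl_ball rho).
have m2 : measurable_fun setT g1.
  apply/(measurable_restrictT _ _).1 => //; apply: measurable_funTS.
  exact/measurable_EFinP.
have h1 x : (0 <= (`|f x| `^ p * chi x)%:E)%E by rewrite lee_fin mulr_ge0 ?powR_ge0.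
have h2 x : (0 <= g1 x)%E.
  by rewrite /g1 patchE; case: ifP => // _; rewrite lee_fin powR_ge0.
have EA := @ge0_integralZl_EFin _ _ _ mu _ measurableT _
  (fun x _ => (normr_ge0 (f x * phi x) : (0 <= (`|f x * phi x|)%:E)%E)) mfphi L L0.
have E1 := @ge0_integralZl_EFin _ _ _ mu _ measurableT _ (fun x _ => h1 x) m1 _ cp0.
have E2 := @ge0_integralZl_EFin _ _ _ mu _ measurableT _ (fun x _ => h2 x) m2 _ Lq0.
have k1 x : (0 <= (c `^ p)%:E * (`|f x| `^ p * chi x)%:E)%E by rewrite mule_ge0.
have k2 x : (0 <= ((L / c) `^ q)%:E * g1 x)%E by rewrite mule_ge0.
have n1 := measurable_funeM (c `^ p)%:E m1.
have n2 := measurable_funeM ((L / c) `^ q)%:E m2.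
have ED := @ge0_integralD _ _ _ mu _ measurableT _ _ (fun x _ => k1 x) n1 (fun x _ => k2 x) n2.
rewrite [X in (_ <= _ + _ * X)%E]integral_mkcond -/g1 -E1 -E2 -ED.
rewrite EFinM; apply: (@le_trans _ _ (L%:E * \int[mu]_x (`|f x * phi x|)%:E)%E).
  by apply: lee_wpmul2l; rewrite ?lee_fin//; apply: abs_Rintegral_le => //; exact: measurable_funM.
rewrite -EA; apply: ae_ge0_le_integral => //.
- by move=> x _; rewrite mule_ge0.
- exact: measurable_funeM.
- by move=> x _; rewrite adde_ge0.
- exact: emeasurable_funD.
- apply: filterS f0 => x fx _.
  have [xB|/fx fx0] := pselect (eucl_ball rho x); last first.
    have -> : (L%:E * (`|f x * phi x|)%:E = 0)%E by rewrite fx0 mul0r normr0 mule0.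
    exact: adde_ge0.
  rewrite /g1 patchE mem_set// -!EFinM -EFinD lee_fin.
  have phi_g := phig x xB; have g0 := le_trans (normr_ge0 _) phi_g.
  apply: (@le_trans _ _ (L * (`|f x| * g x))).
    by rewrite normrM ler_wpM2l// ler_wpM2l.
  apply: le_trans (young_scaled p1 q1 pq c0 L0 (normr_ge0 _) g0) _.
  rewrite lerD2r ler_wpM2l// ler_peMr ?powR_ge0//; exact: chi1.
Qed.

End young.

(** * A polynomial cutoff in time *)

Section cutoff_polynomial.
Context {R : realType}.

Lemma horner_bounded01 (s : {poly R}) :
  exists2 A : R, 0 <= A & forall y : R, 0 <= y <= 1 -> `|s.[y]| <= A.
Proof.
exists (\sum_(i < size s) `|s`_i|); first exact: sumr_ge0.
move=> y /andP[y0 y1]; rewrite horner_coef (le_trans (ler_norm_sum _ _ _))//.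
apply: ler_sum => i _; rewrite normrM normrX (ger0_norm y0) ler_piMr//.
exact: exprn_ile1.
Qed.

(** Each derivative lowers by at most one the orders of vanishing, at 0 of the
    derivatives and at 1 of the cutoff; three derivatives leave the common weight
    [y ^ j] times the power [l / (l + 3)] of the cutoff. *)
Definition cutoff_poly (j l : nat) : {poly R} := (1 - 'X^(j.+3)) ^+ l.+3.

Definition cutoff_weight (j l : nat) (y : R) : R := y ^+ j * (1 - y ^+ j.+3) ^+ l.

Let deriv_factor (m a b : nat) (s : {poly R}) :
  exists s' : {poly R}, deriv ('X^(a.+1) * (1 - 'X^(m.+1)) ^+ b.+1 * s) =
    'X^a * (1 - 'X^(m.+1)) ^+ b * s'.
Proof.
set A : {poly R} := 1 - 'X^(m.+1).
exists (a.+1%:R * (A * s) + b.+1%:R * ('X * (deriv A * s)) + 'X * (A * deriv s)).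
rewrite !derivM derivXn deriv_exp -(mulr_natl _ a.+1) -(mulr_natl _ b.+1) /= !exprS.
move: ('X^a : {poly R}) (A ^+ b) (deriv A) (deriv s) ('X : {poly R})
  (a.+1%:R : {poly R}) (b.+1%:R : {poly R}) => Xa Ab dA ds x ka kb.
ring.
Qed.

Lemma cutoff_poly_derivs j l : exists2 A : R, 0 <= A & forall y, 0 <= y <= 1 ->
  let q := cutoff_poly j l in
  [/\ `|q^`().[y]| <= A * cutoff_weight j l y,
      `|q^`()^`().[y]| <= A * cutoff_weight j l y &
      `|q^`()^`()^`().[y]| <= A * cutoff_weight j l y].
Proof.
have [s1 E1] : exists s1 : {poly R},
    (cutoff_poly j l)^`() = 'X^(j.+2) * (1 - 'X^(j.+3)) ^+ l.+2 * s1.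
  exists (- (l.+3%:R * j.+3%:R)).
  rewrite /cutoff_poly deriv_exp derivB derivC derivXn sub0r.
  rewrite -(mulr_natl _ l.+3) -(mulr_natl _ j.+3) /=.
  move: ('X^(j.+2) : {poly R}) ((1 - 'X^(j.+3) : {poly R}) ^+ l.+2)
    (l.+3%:R : {poly R}) (j.+3%:R : {poly R}) => x y k1 k2.
  ring.
have [s2 E2] := deriv_factor j.+2 j.+1 l.+1 s1.
have [s3 E3] := deriv_factor j.+2 j l s2.
have {}E2 : (cutoff_poly j l)^`()^`() = 'X^(j.+1) * (1 - 'X^(j.+3)) ^+ l.+1 * s2.
  by rewrite E1.
have {}E3 : (cutoff_poly j l)^`()^`()^`() = 'X^j * (1 - 'X^(j.+3)) ^+ l * s3.
  by rewrite E2.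
have [A1 A10 H1] := horner_bounded01 s1.
have [A2 A20 H2] := horner_bounded01 s2.
have [A3 A30 H3] := horner_bounded01 s3.
exists (A1 + A2 + A3); first by rewrite !addr_ge0.
move=> y y01 q; have /andP[y0 y1] := y01; rewrite /q E3 E2 E1 /cutoff_weight.
have z0 : 0 <= 1 - y ^+ j.+3 by rewrite subr_ge0 exprn_ile1.
have z1 : 1 - y ^+ j.+3 <= 1 by rewrite gerBl exprn_ge0.
have gen a b (s : {poly R}) A : (j <= a)%N -> (l <= b)%N -> `|s.[y]| <= A ->
    `|('X^a * (1 - 'X^(j.+3)) ^+ b * s).[y]| <= A * (y ^+ j * (1 - y ^+ j.+3) ^+ l).
  move=> ja lb sA; rewrite !hornerM hornerXn horner_exp hornerD hornerN hornerXn hornerC.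
  rewrite normrM mulrC ler_pM// normrM !normrX !ger0_norm//.
  by rewrite ler_pM ?exprn_ge0// ler_wiXn2l.
have [B1 B2 B3] : [/\ `|s1.[y]| <= A1 + A2 + A3, `|s2.[y]| <= A1 + A2 + A3 &
    `|s3.[y]| <= A1 + A2 + A3].
  have := H1 y y01; have := H2 y y01; have := H3 y y01.
  by split; lra.
by split; apply: gen => //; rewrite -addn2 ?leq_addr// -addn1 leq_addr.
Qed.

End cutoff_polynomial.

(** * Local integrability of the nonlinear term *)

Section power_integral.
Context {R : realType} {n : nat}.
Local Notation mu := (@lebesgue_rV R n).

Lemma measurable_lifetime (T : \bar R) :
  measurable (lifetime T : set (measurableTypeR R)).
Proof.
case: T => [t| |].
- rewrite (_ : lifetime _ = `[0, t[%classic); first exact: measurable_itv.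
  by apply/seteqP; split => s /=; rewrite /lifetime/= in_itv/= lte_fin => /andP.
- rewrite (_ : lifetime _ = `[0, +oo[%classic); first exact: measurable_itv.
  apply/seteqP; split => s /=; rewrite /lifetime/= in_itv/= andbT; first by case.
  by split => //; exact: ltry.
- by rewrite (_ : lifetime _ = set0)//; apply/seteqP; split => s // [].
Qed.

(** Local integrability is only assumed on compact subsets of space-time; [N] involves
    the compact set [[0, T1]] times a box, and Fubini's theorem for nonnegative functions
    turns the space-time integral into an iterated one. *)
Lemma Lp_loc_power (T : \bar R) (p T1 rho : R) (u : R -> 'rV[R]_n -> R)
    (chi : 'rV[R]_n -> R) :
  Lp_loc p T u -> (T1%:E < T)%E -> measurable_fun setT chi ->
  (forall x, 0 <= chi x <= 1) ->
  (forall x, chi x != 0 -> forall i, `[- rho, rho]%classic (x ord0 i)) ->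
  let N s := (\int[mu]_x (`|u s x| `^ p * chi x)%:E)%E in
  measurable_fun (`[0, T1] : set (measurableTypeR R)) N /\
  (\int[lebesgue_measure]_(s in `[0%R, T1]) N s < +oo)%E.
Proof.
move=> [mU locU] T1T mchi chi01 chi_supp N.
have mI : measurable (`[0, T1]%classic : set (measurableTypeR R)) by exact: measurable_itv.
pose box := [set x : 'rV[R]_n | forall i, `[- rho, rho]%classic (x ord0 i)].
pose K : set (R * 'rV[R]_n) := `[0, T1]%classic `*` box.
have cK : compact K.
  by apply: compact_setX; [exact: segment_compact|exact: compact_box].
have I_life t : `[0, T1]%classic t -> lifetime T t.
  rewrite /= in_itv/= => /andP[t0 t1]; split => //.
  by rewrite (le_lt_trans _ T1T)// lee_fin.
have KQ : K `<=` lifetime T `*` setT by move=> z [/I_life z1 _]; split.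
have {locU} := locU K cK KQ; rewrite /=.
pose U := fun z : measurableTypeR R * 'rV[R]_n => u z.1 z.2.
pose D : set (measurableTypeR R * 'rV[R]_n) := `[0, T1]%classic `*` setT.
have mD : measurable D by exact: measurableX.
have mbox : measurable box.
  rewrite /box (_ : [set x | _] = \bigcap_(i in [set: 'I_n])
      ((fun x : 'rV[R]_n => x ord0 i) @^-1` `[- rho, rho]%classic)).
    apply: fin_bigcap_measurable => // i _; rewrite -[X in measurable X]setTI.
    by apply: measurable_coord.
  by apply/seteqP; split => x /= Ax i; [move=> _; exact: Ax|exact: (Ax i)].
have mK : measurable (K : set (measurableTypeR R * 'rV[R]_n)) by exact: measurableX.
have mUD : measurable_fun D (fun z => `|U z| `^ p).
  apply: (measurableT_comp (measurable_powR p)); apply: measurableT_comp => //.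
  apply: measurable_funS mU => //; first exact: measurableX (measurable_lifetime T) measurableT.
  by move=> z [/I_life z1 _]; split.
move=> locU.
pose f : measurableTypeR R * 'rV[R]_n -> \bar R :=
  (fun z => (`|U z| `^ p * chi z.2)%:E) \_ D.
have mf : measurable_fun setT f.
  have /measurable_EFinP m1 : measurable_fun D (fun z => `|U z| `^ p * chi z.2).
    apply: measurable_funM => //; apply: measurable_funTS.
    by apply: (measurableT_comp mchi); exact: measurable_snd.
  exact: (measurable_restrictT _ mD).1 m1.
have f0 z : (0 <= f z)%E.
  rewrite /f patchE; case: ifP => // _; rewrite lee_fin mulr_ge0 ?powR_ge0//.
  by case/andP: (chi01 z.2).
have fE s : s \in `[0, T1] -> fubini_F mu f s = N s.
  move=> sI; apply: eq_integral => x _; rewrite /f patchE mem_set//.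
have fE0 s : s \notin `[0, T1] -> fubini_F mu f s = 0%E.
  move=> sI; rewrite /fubini_F; under eq_integral => x _.
    rewrite /f patchE memNset; last by move=> [/= sI' _]; rewrite sI' in sI.
    over.
  exact: integral0.
have mF := @measurable_fun_fubini_tonelli_F _ _ _ _ _ mu f mf f0.
have mN : measurable_fun (`[0, T1] : set (measurableTypeR R)) N.
  apply: (eq_measurable_fun (fubini_F mu f)); last exact: measurable_funTS.
  by move=> s; rewrite inE/= => sI; exact: fE.
split => //.
have -> : (\int[lebesgue_measure]_(s in `[0%R, T1]) N s =
    \int[lebesgue_measure \x mu]_z f z)%E.
  rewrite (@fubini_tonelli1 _ _ _ _ _ lebesgue_measure mu f mf f0) integral_mkcond.
  apply: eq_integral => s _; rewrite patchE; case: ifPn => sI.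
    by rewrite fE//; move: sI; rewrite inE.
  by rewrite fE0//; apply: contraNN sI => sI; rewrite inE.
apply: le_lt_trans locU; rewrite [leRHS]integral_mkcond.
apply: ge0_le_integral => //.
- have /measurable_EFinP m1 : measurable_fun K (fun z => `|U z| `^ p).
    by apply: measurable_funS mUD => // z [z1 _]; split.
  exact: (measurable_restrictT _ mK).1 m1.
- move=> [s x] _; rewrite /f !patchE; case: ifPn => [|_]; last first.
    by case: ifP => // _; rewrite lee_fin powR_ge0.
  rewrite inE => -[/= sI _]; have /andP[c0 c1] := chi01 x.
  have [c00|cN0] := eqVneq (chi x) 0.
    by rewrite c00 mulr0; case: ifP => // _; rewrite lee_fin powR_ge0.
  rewrite mem_set; first by rewrite lee_fin ler_piMr ?powR_ge0.
  by split => //; exact: chi_supp.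
Qed.

End power_integral.

(** * Time factors of the test functions *)

Section time_functions.
Context {R : realType}.
Implicit Types (c T t : R) (w : {poly R}).

(** Differentiating a polynomial in [t / T] times [exp (- c t)] only changes the
    polynomial, by [time_deriv]. *)
Definition time_fun c T w t : R := expR (- (c * t)) * w.[t / T].

Definition time_deriv c T w : {poly R} := T^-1 *: w^`() - c *: w.

Lemma is_derive_time_fun c T w t :
  is_derive t (1:R) (time_fun c T w) (time_fun c T (time_deriv c T w) t).
Proof.
have D1 : is_derive t (1:R) (fun t => - (c * t)) (- c).
  have -> : (fun s => - (c * s)) = (- c) \*: (id : R -> R).
    by apply/funext => s; exact/esym/mulNr.
  by apply: is_derive_eq; rewrite /GRing.scale/= mulr1.
have D2 := is_derive_comp D1 (is_derive_expR _).
have D3 : is_derive t (1:R) (fun t => t / T) T^-1.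
  have -> : (fun s => s / T) = T^-1 \*: (id : R -> R).
    by apply/funext => s; exact: mulrC.
  by apply: is_derive_eq; rewrite /GRing.scale/= mulr1.
have D4 := is_derive_comp D3 (is_derive_poly w _).
apply: (is_derive_eq (is_deriveM D2 D4)).
by rewrite /time_fun /time_deriv !hornerE /GRing.scale/=; ring.
Qed.

Lemma smooth_time_fun c T w : smooth (time_fun c T w).
Proof.
apply: (@smooth_coinduction1 R [set f | exists w, f = time_fun c T w]); last by exists w.
  move=> _ [v ->]; exists (time_fun c T (time_deriv c T v)).
    by exists (time_deriv c T v).
  by move=> x; exact: is_derive_time_fun.
move=> _ k [v ->]; exists (k *: v); apply/funext => x.
by rewrite /time_fun hornerZ mulrCA.
Qed.

Lemma continuous_time_fun c T w : continuous (time_fun c T w).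
Proof. by apply: smooth_continuous; exact: smooth_time_fun. Qed.

Lemma time_funE0 T w t : time_fun 0 T w t = w.[t / T].
Proof. by rewrite /time_fun mul0r oppr0 expR0 mul1r. Qed.

Section operator.
Variables (beta A : R) (j l : nat).
Hypothesis beta_ge0 : 0 <= beta.
Hypothesis A_ge0 : 0 <= A.
Let q := cutoff_poly j l : {poly R}.
Hypothesis qA : forall y : R, 0 <= y <= 1 ->
  [/\ `|q^`().[y]| <= A * cutoff_weight j l y,
      `|q^`()^`().[y]| <= A * cutoff_weight j l y &
      `|q^`()^`()^`().[y]| <= A * cutoff_weight j l y].

(** The adjoint of the equation applied to a time factor [z], when the spatial
    factor satisfies [Laplacian phi = c phi]. *)
Definition adjoint_time c T t : R :=
  let D := time_deriv c T in
  time_fun c T (D (D q)) t - beta * time_fun c T (D (D (D q))) t +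
  beta * c * time_fun c T (D q) t - c * time_fun c T q t.

Let T_inv_le1 T : 1 <= T -> 0 <= T^-1 <= 1.
Proof. by move=> T1; rewrite invr_ge0 (le_trans ler01)// invf_le1// (lt_le_trans ltr01). Qed.

Lemma cutoff_weight_ge0 y : 0 <= y <= 1 -> 0 <= cutoff_weight j l y :> R.
Proof.
by move=> /andP[y0 y1]; rewrite mulr_ge0 ?exprn_ge0// subr_ge0 exprn_ile1.
Qed.

(** Without exponential, only second and third derivatives of the cutoff occur, each with
    its power of [1 / T]. *)
Lemma adjoint_time0_le T t : 1 <= T -> 0 <= t <= T ->
  `|adjoint_time 0 T t| <= (1 + beta) * A * T ^- 2 * cutoff_weight j l (t / T).
Proof.
move=> T1 /andP[t0 tT]; have T0 : 0 < T by exact: lt_le_trans T1.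
have y01 : 0 <= t / T <= 1 by rewrite divr_ge0 ?(ltW T0)//= ler_pdivrMr// mul1r.
have [_ q2 q3] := qA y01; have w0 := cutoff_weight_ge0 y01.
have /andP[i0 i1] := T_inv_le1 T1.
have -> : adjoint_time 0 T t = T ^- 2 * (q^`()^`().[t / T] - beta * T^-1 * q^`()^`()^`().[t / T]).
  rewrite /adjoint_time !time_funE0 /time_deriv !scale0r !subr0 !derivZ !hornerZ -exprVn; ring.
rewrite normrM -exprVn ger0_norm ?exprn_ge0//.
rewrite [leRHS](_ : _ = T^-1 ^+ 2 * ((1 + beta) * (A * cutoff_weight j l (t / T)))); last by ring.
rewrite ler_wpM2l ?exprn_ge0// (le_trans (ler_normB _ _))// mulrDl mul1r lerD//.
by rewrite !normrM (ger0_norm beta_ge0) (ger0_norm i0) -mulrA ler_wpM2l// -[leRHS]mul1r ler_pM.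
Qed.

(** The exponential [exp (- t)] is annihilated by the adjoint operator, so every term that
    remains has a derivative of the cutoff and thereby a factor [1 / T]. *)
Lemma adjoint_time1_le T t : 1 <= T -> 0 <= t <= T ->
  `|adjoint_time 1 T t| <=
  expR (- t) * (6 * (1 + beta) * A * T^-1) * cutoff_weight j l (t / T).
Proof.
move=> T1 /andP[t0 tT]; have T0 : 0 < T by exact: lt_le_trans T1.
have y01 : 0 <= t / T <= 1 by rewrite divr_ge0 ?(ltW T0)//= ler_pdivrMr// mul1r.
have [] := qA y01; have w0 := cutoff_weight_ge0 y01.
have /andP[i0 i1] := T_inv_le1 T1.
have -> : adjoint_time 1 T t = expR (- t) * (T^-1 *
    ((T^-1 * q^`()^`().[t / T] - 2 * q^`().[t / T]) -
     beta * (T^-1 * (T^-1 * q^`()^`()^`().[t / T]) - 3 * (T^-1 * q^`()^`().[t / T]) +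
             2 * q^`().[t / T]))).
  rewrite /adjoint_time /time_fun /time_deriv !mul1r !scale1r.
  rewrite !(derivB, derivZ, hornerZ, hornerD, hornerN); ring.
set W := A * _; move: (q^`().[_]) (q^`()^`().[_]) (q^`()^`()^`().[_]) => x1 x2 x3 h1 h2 h3.
have W0 : 0 <= W by rewrite mulr_ge0.
rewrite !normrM (ger0_norm (expR_ge0 _)) (ger0_norm i0) -!mulrA ler_wpM2l ?expR_ge0//.
rewrite [leRHS](_ : _ = T^-1 * (6 * (1 + beta) * W)); last by rewrite /W; ring.
rewrite ler_wpM2l//; move: (T^-1) i0 i1 => i i0 i1.
have ih (x : R) : `|x| <= W -> `|i * x| <= W.
  by move=> xW; rewrite normrM ger0_norm// -[leRHS]mul1r ler_pM.
have i2 := ih _ h2; have i3 := ih _ (ih _ h3).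
have B1 : `|i * x2 - 2 * x1| <= 3 * W.
  move: h1 i2; rewrite !ler_norml => /andP[? ?] /andP[? ?]; apply/andP; split; lra.
have B2 : `|i * (i * x3) - 3 * (i * x2) + 2 * x1| <= 6 * W.
  move: h1 i2 i3; rewrite !ler_norml => /andP[? ?] /andP[? ?] /andP[? ?].
  by apply/andP; split; lra.
rewrite (le_trans (ler_normB _ _))// normrM (ger0_norm beta_ge0).
have := ler_wpM2l beta_ge0 B2; move: B1; lra.
Qed.

Hypothesis j_gt0 : (0 < j)%N.
Hypothesis l_gt0 : (0 < l)%N.

Lemma cutoff_poly_at0 : q.[0] = 1.
Proof. by rewrite /q /cutoff_poly !hornerE expr0n/= subr0 expr1n. Qed.

Lemma cutoff_poly_at1 : q.[1] = 0.
Proof. by rewrite /q /cutoff_poly !hornerE expr1n subrr expr0n. Qed.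

Let vanish (y : R) : 0 <= y <= 1 -> cutoff_weight j l y = 0 :> R ->
  q^`().[y] = 0 /\ q^`()^`().[y] = 0.
Proof.
by move=> y01 w0; have [] := qA y01; rewrite w0 mulr0 !normr_le0 => /eqP-> /eqP->.
Qed.

Lemma time_deriv_at0 c T : (time_deriv c T q).[0] = - c.
Proof.
have [||e1 _] := @vanish 0 _ _; first by rewrite lexx ler01.
  by rewrite /cutoff_weight expr0n gtn_eqF// mul0r.
by rewrite /time_deriv !(hornerZ, hornerD, hornerN) e1 cutoff_poly_at0; ring.
Qed.

Lemma time_deriv2_at0 c T : (time_deriv c T (time_deriv c T q)).[0] = c ^+ 2.
Proof.
have [||e1 e2] := @vanish 0 _ _; first by rewrite lexx ler01.
  by rewrite /cutoff_weight expr0n gtn_eqF// mul0r.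
rewrite /time_deriv !(derivB, derivZ, hornerZ, hornerD, hornerN) e1 e2 cutoff_poly_at0.
by ring.
Qed.

Lemma time_deriv_at1 c T : (time_deriv c T q).[1] = 0.
Proof.
have [||e1 _] := @vanish 1 _ _; first by rewrite lexx ler01.
  by rewrite /cutoff_weight !expr1n subrr expr0n gtn_eqF// mulr0.
by rewrite /time_deriv !(hornerZ, hornerD, hornerN) e1 cutoff_poly_at1; ring.
Qed.

Lemma time_deriv2_at1 c T : (time_deriv c T (time_deriv c T q)).[1] = 0.
Proof.
have [||e1 e2] := @vanish 1 _ _; first by rewrite lexx ler01.
  by rewrite /cutoff_weight !expr1n subrr expr0n gtn_eqF// mulr0.
rewrite /time_deriv !(derivB, derivZ, hornerZ, hornerD, hornerN) e1 e2 cutoff_poly_at1.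
by ring.
Qed.

Lemma cutoff_poly_01 y : 0 <= y <= 1 -> 0 <= q.[y] <= 1.
Proof.
move=> /andP[y0 y1]; rewrite /q /cutoff_poly !hornerE.
have z0 : 0 <= 1 - y ^+ j.+3 by rewrite subr_ge0 exprn_ile1.
by rewrite exprn_ge0//= exprn_ile1// gerBl exprn_ge0.
Qed.

(** The condition on [l] says that [(l + 3) / p <= l]: the weight is dominated by the
    power [1 / p] of the cutoff, which the Young inequality can absorb. *)
Lemma cutoff_weight_le (p y : R) : 1 < p -> 3 <= l%:R * (p - 1) -> 0 <= y <= 1 ->
  cutoff_weight j l y <= y ^+ j * q.[y] `^ p^-1.
Proof.
move=> p1 lp /andP[y0 y1]; rewrite /cutoff_weight ler_wpM2l ?exprn_ge0//.
have z0 : 0 <= 1 - y ^+ j.+3 by rewrite subr_ge0 exprn_ile1.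
have z1 : 1 - y ^+ j.+3 <= 1 by rewrite gerBl exprn_ge0.
rewrite /q /cutoff_poly !hornerE; move: z0 z1; set z := 1 - _ => z0 z1.
rewrite -[z ^+ l.+3]powR_mulrn// -[z ^+ l]powR_mulrn// -powRrM.
have p0 : 0 < p by exact: lt_trans p1.
have [zE|zN0] := eqVneq z 0.
  by rewrite zE powR0 ?powR_ge0// pnatr_eq0 -lt0n.
rewrite ger_powR ?z1 ?lt_neqAle ?z0 1?eq_sym ?zN0//.
rewrite ler_pdivrMr// -addn3 natrD; lra.
Qed.

End operator.
End time_functions.

(** * Estimates of time integrals *)

Section weighted_time_integral.
Context {R : realType}.
Local Notation leb := (@lebesgue_measure R).

(** The inner integral [N] is finite for almost every time only, whence the passage through
    [fine]. *)
Lemma weighted_integral (T1 : R) (eta : R -> R) (N : R -> \bar R) :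
  measurable_fun (`[0, T1] : set (measurableTypeR R)) N ->
  (forall s, (0 <= N s)%E) ->
  (\int[leb]_(s in `[0%R, T1]) N s < +oo)%E ->
  measurable_fun (`[0, T1] : set (measurableTypeR R)) eta ->
  (forall s, 0 <= s <= T1 -> 0 <= eta s <= 1) ->
  (\int[leb]_(s in `[0, T1]) (eta s * fine (N s)))%:E =
  (\int[leb]_(s in `[0%R, T1]) ((eta s)%:E * N s))%E.
Proof.
move=> mN N0 Noo meta eta01.
have mI : measurable (`[0, T1]%classic : set (measurableTypeR R)) by exact: measurable_itv.
have inI s : `[0, T1]%classic s -> 0 <= eta s <= 1.
  by rewrite /= in_itv/=; exact: eta01.
have mEN : measurable_fun (`[0, T1] : set (measurableTypeR R)) (fun s => ((eta s)%:E * N s)%E).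
  by apply: emeasurable_funM => //; exact/measurable_EFinP.
have EN0 s : `[0, T1]%classic s -> (0 <= (eta s)%:E * N s)%E.
  by move=> /inI/andP[e0 _]; rewrite mule_ge0.
have ENoo : (\int[leb]_(s in `[0%R, T1]) ((eta s)%:E * N s) < +oo)%E.
  apply: le_lt_trans Noo; apply: ge0_le_integral => // s /inI/andP[e0 e1].
  by rewrite -[leRHS]mul1e lee_wpmul2r.
have iN : leb.-integrable `[0, T1] N.
  apply/integrableP; split => //; apply: le_lt_trans Noo.
  by apply: ge0_le_integral => // [|s _]; [exact: measurableT_comp|rewrite gee0_abs].
rewrite /Rintegral (_ : integral _ _ _ = (\int[leb]_(s in `[0%R, T1]) ((eta s)%:E * N s))%E).
  by rewrite fineK// ge0_fin_numE// integral_ge0.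
have fN := integrable_ae mI iN.
apply: ge0_ae_eq_integral => //.
- apply/measurable_EFinP; apply: measurable_funM => //.
  by apply: measurableT_comp => //; exact: measurable_fine.
- by move=> s /inI/andP[e0 _]; rewrite lee_fin mulr_ge0// fine_ge0.
- by apply: filterS fN => s + sI => /(_ sI) fin; rewrite EFinM fineK.
Qed.

Lemma abs_integral_le_weighted (T1 c D : R) (eta H : R -> R) (N : R -> \bar R) :
  0 < T1 -> 0 <= c -> 0 <= D ->
  measurable_fun (`[0, T1] : set (measurableTypeR R)) N ->
  (forall s, (0 <= N s)%E) ->
  (\int[leb]_(s in `[0%R, T1]) N s < +oo)%E ->
  measurable_fun (`[0, T1] : set (measurableTypeR R)) eta ->
  (forall s, 0 <= s <= T1 -> 0 <= eta s <= 1) ->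
  measurable_fun (`[0, T1] : set (measurableTypeR R)) H ->
  (forall s, 0 <= s <= T1 -> (`|H s|%:E <= (c * eta s)%:E * N s + D%:E)%E) ->
  `|\int[leb]_(s in `[0, T1]) H s| <=
    c * \int[leb]_(s in `[0, T1]) (eta s * fine (N s)) + D * T1.
Proof.
move=> T1_gt0 c0 D0 mN N0 Noo meta eta01 mH HN.
have mI : measurable (`[0, T1]%classic : set (measurableTypeR R)) by exact: measurable_itv.
have inI s : `[0, T1]%classic s -> 0 <= s <= T1 by rewrite /= in_itv.
have mEN : measurable_fun (`[0, T1] : set (measurableTypeR R)) (fun s => ((eta s)%:E * N s)%E).
  by apply: emeasurable_funM => //; exact/measurable_EFinP.
have EN0 s : `[0, T1]%classic s -> (0 <= (eta s)%:E * N s)%E.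
  by move=> /inI/eta01/andP[e0 _]; rewrite mule_ge0.
have cEN0 s : `[0, T1]%classic s -> (0 <= c%:E * ((eta s)%:E * N s))%E.
  by move=> sI; rewrite mule_ge0// EN0.
have mcEN := measurable_funeM c%:E mEN.
rewrite -lee_fin (le_trans (abs_Rintegral_le leb mI mH))//.
rewrite EFinD EFinM (weighted_integral mN N0 Noo meta eta01).
rewrite -(ge0_integralZl_EFin leb mI EN0 mEN c0).
have -> : ((D * T1)%:E = \int[leb]_(s in `[0%R, T1]) (cst D%:E s))%E.
  have muI : leb `[0, T1]%classic = T1%:E.
    by rewrite [LHS]lebesgue_measure_itv/= lte_fin T1_gt0 oppr0 adde0.
  by rewrite (integral_cst leb mI) EFinM; congr (_ * _)%E; exact/esym.
have D0' s : `[0, T1]%classic s -> (0 <= cst D%:E s :> \bar R)%E by rewrite lee_fin.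
rewrite -(ge0_integralD leb mI cEN0 mcEN D0' (measurable_cst _)).
apply: ge0_le_integral => //.
- by apply/measurable_EFinP; exact: measurableT_comp.
- by apply: emeasurable_funD => //; exact: measurable_cst.
- move=> s /inI sI; rewrite (le_trans (HN s sI))// muleA -EFinM.
  exact: lexx.
Qed.

End weighted_time_integral.

(** * Pairings with nonnegative functions *)

Section pairing_sign.
Context {R : realType} {n : nat}.
Local Notation mu := (@lebesgue_rV R n).
Implicit Types (f phi : 'rV[R]_n -> R).

Lemma pairing_ge0 f phi : measurable_fun setT f -> measurable_fun setT phi ->
  {ae mu, forall x, 0 <= f x} -> (forall x, 0 <= phi x) -> 0 <= pairing f phi.
Proof.
move=> mf mp f0 p0; rewrite /pairing /Rintegral.
have mfp : measurable_fun setT (fun x => f x * phi x) by exact: measurable_funM.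
rewrite (_ : integral _ _ _ = \int[mu]_x (`|f x * phi x|)%:E)%E.
  by rewrite fine_ge0// integral_ge0// => x _; rewrite lee_fin.
apply: ae_eq_integral => //.
- exact/measurable_EFinP.
- by apply/measurable_EFinP; exact: measurableT_comp.
- by apply: filterS f0 => x fx _; rewrite ger0_norm// mulr_ge0.
Qed.

Lemma pairing_le_ge0 f phi psi : f \in Lfun mu 2%:E -> phi \in Lfun mu 2%:E ->
  psi \in Lfun mu 2%:E -> {ae mu, forall x, 0 <= f x} ->
  (forall x, phi x <= psi x) -> pairing f phi <= pairing f psi.
Proof.
move=> f2 p2 q2 f0 pq; rewrite -subr_ge0.
have -> : pairing f psi - pairing f phi = pairing f (fun x => psi x - phi x).
  rewrite /pairing -RintegralB//; [|exact: integrable_pairing..].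
  by apply: eq_Rintegral => x _; rewrite mulrBr.
apply: pairing_ge0 => //; [exact: Lfun_measurable f2| |by move=> x; rewrite subr_ge0].
by apply: measurable_funB; [exact: Lfun_measurable q2|exact: Lfun_measurable p2].
Qed.

(** A nonnegative function with vanishing pairing is zero almost everywhere where [phi] is
    positive, in particular on the ball that carries it. *)
Lemma pairing_gt0 f phi (rho : R) : f \in Lfun mu 2%:E -> phi \in Lfun mu 2%:E ->
  {ae mu, forall x, 0 <= f x} -> (forall x, 0 <= phi x) ->
  {ae mu, forall x, ~ eucl_ball rho x -> f x = 0} ->
  (forall x, eucl_ball rho x -> phi x = 1) ->
  ~ {ae mu, forall x, f x = 0} -> 0 < pairing f phi.
Proof.
move=> f2 p2 f0 p0 frho prho fN0.
have mf := Lfun_measurable f2; have mp := Lfun_measurable p2.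
have mfp : measurable_fun setT (fun x => f x * phi x) by exact: measurable_funM.
rewrite lt_neqAle pairing_ge0// andbT; apply/eqP => /esym E; apply: fN0.
have I0 : (\int[mu]_x `|(f x * phi x)%:E| = 0)%E.
  have iF := integrable_fin_num measurableT (integrable_pairing f2 p2).
  rewrite (_ : (\int[mu]_x `|(f x * phi x)%:E| = \int[mu]_x (f x * phi x)%:E)%E).
    by rewrite -[LHS]fineK// [fine _]E.
  apply: ae_eq_integral => //.
  - by apply: measurableT_comp => //; exact/measurable_EFinP.
  - exact/measurable_EFinP.
  - by apply: filterS f0 => x fx _; rewrite gee0_abs// lee_fin mulr_ge0.
have /ae_eq_integral_abs : measurable_fun setT (EFin \o (fun x => f x * phi x)).
  exact/measurable_EFinP.
move=> /(_ mu measurableT) [H _]; have {}H := H I0.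
apply: filterS2 H frho => x /(_ I) /= fp fx.
have [xr|/fx//] := pselect (eucl_ball rho x).
by case: fp; rewrite prho// mulr1.
Qed.

End pairing_sign.

(** * Spatial factors of the test functions *)

Section spatial_modes.
Context {R : realType} (n : nat).
Implicit Types (a s : R) (c : bool).

Lemma derive_eq_lt (f g : R -> R) a s : (forall t, t < a -> f t = g t) -> s < a ->
  'D_1 f s = 'D_1 g s.
Proof.
by move=> fg sa; apply: near_eq_derive; apply: filterS (lt_nbhsl sa) => t; exact: fg.
Qed.

(** The radial profiles of the two spatial test functions, in the variable [|x| ^ 2]:
    up to [a] they are the constant solution of [Laplacian phi = 0] and the growing
    solution of [Laplacian phi = phi]; the flag [c] is the eigenvalue. *)
Definition spatial_mode a c s : R :=
  smooth_step a (a + 1) s * (if c then eigen_fun n s else 1).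

Hypothesis n_gt0 : (0 < n)%N.

Lemma smooth_spatial_mode a c : smooth (spatial_mode a c).
Proof.
apply: smoothM; first exact: smooth_smooth_step.
by case: c; [exact: smooth_eigen_fun|exact: smooth_cst].
Qed.

Lemma spatial_mode0 a c s : a + 1 <= s -> spatial_mode a c s = 0.
Proof. by move=> h; rewrite /spatial_mode smooth_step0// mul0r. Qed.

Lemma spatial_mode_ge0 a c s : 0 <= s -> 0 <= spatial_mode a c s.
Proof.
move=> s0; rewrite mulr_ge0 ?smooth_step_ge0//; case: c => //.
by rewrite (le_trans ler01)// eigen_fun_ge1.
Qed.

Lemma spatial_mode_le a s : 0 <= s -> spatial_mode a true s <= eigen_fun n s.
Proof.
move=> s0; rewrite /spatial_mode -[leRHS]mul1r ler_wpM2r//.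
  by rewrite (le_trans ler01)// eigen_fun_ge1.
by rewrite smooth_step_le1// ltrDl.
Qed.

Lemma spatial_mode_eigen a c s : s < a ->
  4 * s * 'D_1 (fun s => 'D_1 (spatial_mode a c) s) s +
  2 * n%:R * 'D_1 (spatial_mode a c) s = c%:R * spatial_mode a c s.
Proof.
move=> sa; pose h : R -> R := if c then eigen_fun n else cst 1.
have E0 t : t < a -> spatial_mode a c t = h t.
  move=> ta; rewrite /spatial_mode smooth_step1 ?ltrDl// ?ltW// mul1r /h.
  by rewrite /h; case: (c).
have E1 t : t < a -> 'D_1 (spatial_mode a c) t = 'D_1 h t.
  by move=> ta; exact: derive_eq_lt E0 ta.
rewrite (derive_eq_lt E1 sa) (E1 _ sa) (E0 _ sa) /h; case: c {E0 E1 h} => /=.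
  have [f1 [f2 [d1 d2 ode _]]] := @eigen_fun_ode R n n_gt0.
  have -> : (fun t => 'D_1 (eigen_fun n) t) = f1.
    by apply/funext => t; have d := d1 t; exact: derive_val.
  have -> : 'D_1 (eigen_fun n) s = f1 s by have d := d1 s; exact: derive_val.
  have -> : 'D_1 f1 s = f2 s by have d := d2 s; exact: derive_val.
  by rewrite ode mul1r.
have -> : (fun t : R => 'D_1 (cst (1:R)) t) = (cst 0 : R -> R).
  by apply/funext => t; exact: derive_cst.
by rewrite !derive_cst; ring.
Qed.

End spatial_modes.

(** * The two test function estimates *)

Section test_estimates.
Context {R : realType} {n : nat} (T : \bar R).
Local Notation mu := (@lebesgue_rV R n).
Local Notation leb := (@lebesgue_measure R).
Variables (beta p q eps r : R) (u0 u1 u2 : 'rV[R]_n -> R) (u : R -> 'rV[R]_n -> R).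
Hypothesis n_gt0 : (0 < n)%N.
Hypothesis beta_gt0 : 0 < beta.
Hypothesis p_gt1 : 1 < p.
Hypothesis q_gt1 : 1 < q.
Hypothesis pq : p^-1 + q^-1 = 1.
Hypothesis r_gt0 : 0 < r.
Hypothesis eps_gt0 : 0 < eps.
Hypothesis u0_Lfun : u0 \in Lfun mu 2%:E.
Hypothesis u1_Lfun : u1 \in Lfun mu 2%:E.
Hypothesis u2_Lfun : u2 \in Lfun mu 2%:E.
Hypothesis u0_ge0 : {ae mu, forall x, 0 <= u0 x}.
Hypothesis u1_ge0 : {ae mu, forall x, 0 <= u1 x}.
Hypothesis u2_ge0 : {ae mu, forall x, 0 <= u2 x}.
Hypothesis u0_supp : ess_supp u0 `<=` eucl_ball r.
Hypothesis sol : energy_solution beta p eps u0 u1 u2 T u.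
Hypothesis cone : supp_in_cone r T u.
Variables (T1 tau A : R) (j l : nat).
Hypothesis T1_ge1 : 1 <= T1.
Hypothesis T1_tau : T1 < tau.
Hypothesis tauT : (tau%:E < T)%E.
Hypothesis A_ge0 : 0 <= A.
Hypothesis j_gt0 : (0 < j)%N.
Hypothesis l_gt0 : (0 < l)%N.
Hypothesis lp : 3 <= l%:R * (p - 1).
Let w := cutoff_poly j l : {poly R}.
Hypothesis wA : forall y : R, 0 <= y <= 1 ->
  [/\ `|w^`().[y]| <= A * cutoff_weight j l y,
      `|w^`()^`().[y]| <= A * cutoff_weight j l y &
      `|w^`()^`()^`().[y]| <= A * cutoff_weight j l y].

Let T1_gt0 : 0 < T1. Proof. exact: lt_le_trans T1_ge1. Qed.
Let p_gt0 : 0 < p. Proof. exact: lt_trans p_gt1. Qed.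
Let q_gt0 : 0 < q. Proof. exact: lt_trans q_gt1. Qed.

(** Strictly larger than the squared radius of the light cone at time [tau], so that the
    step functions are constant in a neighbourhood of the ball. *)
Let a0 : R := (r + tau) ^+ 2 + 1.
Let phi (c : bool) : 'rV[R]_n -> R := radial (spatial_mode n a0 c).
Let a0_gt0 : 0 < a0. Proof. by rewrite ltr_wpDl// sqr_ge0. Qed.

Let phi_test c : test_function (phi c).
Proof.
apply: (@test_radial R n _ (a0 + 1)); first exact: smooth_spatial_mode.
  by rewrite addr_ge0// ltW.
by move=> s; exact: spatial_mode0.
Qed.

Let phi_Lfun c : phi c \in Lfun mu 2%:E. Proof. exact: test_function_Lfun2. Qed.

Let phi_measurable c : measurable_fun setT (phi c).
Proof. exact: Lfun_measurable (phi_Lfun c). Qed.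

Let phi_ge0 c x : 0 <= phi c x. Proof. by apply: spatial_mode_ge0 => //; exact: sqr_ge0. Qed.

Let y01 s : 0 <= s <= T1 -> 0 <= s / T1 <= 1.
Proof.
by move=> /andP[s0 sT]; rewrite divr_ge0 ?(ltW T1_gt0)//= ler_pdivrMr// mul1r.
Qed.

Let in_lifetime s : 0 <= s <= T1 -> lifetime T s.
Proof.
move=> /andP[s0 sT]; split => //; apply: lt_trans tauT.
by rewrite lte_fin (le_lt_trans sT).
Qed.

Lemma solution_Lfun t : lifetime T t -> u t \in Lfun mu 2%:E.
Proof. by case: sol => -[[uC _] _ _ _] _ /uC[ut2 _]; exact: sobolev_Lfun ut2. Qed.

Lemma solution_supp t : lifetime T t ->
  {ae mu, forall x, ~ eucl_ball (r + t) x -> u t x = 0}.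
Proof.
move=> [t0 tT]; have [tp|] := ltP 0 t; first exact: ess_supp_ae (cone tp tT).
move=> tn; have -> : t = 0 by apply/eqP; rewrite eq_le tn.
case: sol => _ [ut [utt [_ _ ui _ _]]]; rewrite addr0.
by apply: filterS2 ui (ess_supp_ae u0_supp) => x -> h /h ->; rewrite mulr0.
Qed.

(** The cut-off power norm; its integral against the time cutoff is the quantity
    that both test functions control. *)
Let N s : \bar R := (\int[mu]_x (`|u s x| `^ p * phi false x)%:E)%E.
Let eta s : R := w.[s / T1].
Let I : R := \int[leb]_(s in `[0, T1]) (eta s * fine (N s)).
Let H c s : R := pairing (u s) (phi c) * adjoint_time beta j l c%:R T1 s.

Let phi_false_le1 x : 0 <= phi false x <= 1.
Proof. by rewrite phi_ge0/= /phi /radial /spatial_mode mulr1 smooth_step_le1// ltrDl. Qed.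

Let phi_false1 x : eucl_ball (r + tau) x -> phi false x = 1.
Proof.
move=> xr; rewrite /phi /radial /spatial_mode mulr1 smooth_step1// ?ltrDl//.
by rewrite ler_wpDr// lerXn2r// ?nnegrE ?eucl_norm_ge0// (le_trans (eucl_norm_ge0 x)).
Qed.

Let N_measurable : measurable_fun (`[0, T1] : set (measurableTypeR R)) N /\
  (\int[leb]_(s in `[0%R, T1]) N s < +oo)%E.
Proof.
case: sol => -[_ _ _ uL] _.
apply: (@Lp_loc_power R n T p T1 (a0 + 1 + 1) u (phi false) uL) => //.
  by rewrite (lt_trans _ tauT)// lte_fin.
move=> x; apply: radial_supp; first by rewrite addr_ge0// ltW.
by move=> s; exact: spatial_mode0.
Qed.

Let N_ge0 s : (0 <= N s)%E.
Proof. by apply: integral_ge0 => x _; rewrite lee_fin mulr_ge0 ?powR_ge0. Qed.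

Let eta01 s : 0 <= s <= T1 -> 0 <= eta s <= 1.
Proof. by move=> /y01; exact: cutoff_poly_01. Qed.

Let eta_measurable : measurable_fun (`[0, T1] : set (measurableTypeR R)) eta.
Proof.
apply: measurable_funTS; apply: continuous_measurable_fun => s.
have := @continuous_time_fun R 0 T1 w s; rewrite (_ : time_fun 0 T1 w = eta)//.
by apply/funext => t; rewrite time_funE0.
Qed.

(** The values of the time factor and of its first two derivatives at 0 are 1, [- c] and
    [c ^ 2 = c]; they collect the data into one nonnegative combination. *)
Lemma tested_identity (c : bool) :
  \int[leb]_(s in `[0, T1]) (time_fun c%:R T1 w s * \int[mu]_x (`|u s x| `^ p * phi c x))
  + eps * (beta * pairing u2 (phi c) + (1 + beta * c%:R) * pairing u1 (phi c)
           + c%:R * pairing u0 (phi c))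
  = \int[leb]_(s in `[0, T1]) H c s /\
  measurable_fun (`[0, T1] : set (measurableTypeR R)) (H c).
Proof.
case: (sol) => -[_ C1 C2 _] [ut [utt [d1 d2 ui uti weak]]].
have B0 : 0 <= a0 + 1 by rewrite addr_ge0// ltW.
have d := is_derive_time_fun c%:R T1.
have eig s : 0 <= s -> s <= (r + tau) ^+ 2 ->
    4 * s * 'D_1 (fun s => 'D_1 (spatial_mode n a0 c) s) s +
    2 * n%:R * 'D_1 (spatial_mode n a0 c) s = c%:R * spatial_mode n a0 c s.
  by move=> _ sr; apply: spatial_mode_eigen => //; rewrite (le_lt_trans sr)// ltrDl.
have z0_ge0 s : 0 <= s <= T1 -> 0 <= time_fun c%:R T1 w s.
  by move=> /eta01/andP[e0 _]; rewrite mulr_ge0 ?expR_ge0.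
have TT : T1 / T1 = 1 by rewrite divff// gt_eqF.
have z0T : time_fun c%:R T1 w T1 = 0 by rewrite /time_fun TT cutoff_poly_at1 mulr0.
have z1T : time_fun c%:R T1 (time_deriv c%:R T1 w) T1 = 0.
  by rewrite /time_fun TT (time_deriv_at1 wA l_gt0) mulr0.
have z2T : time_fun c%:R T1 (time_deriv c%:R T1 (time_deriv c%:R T1 w)) T1 = 0.
  by rewrite /time_fun TT (time_deriv2_at1 wA l_gt0) mulr0.
have [E mE] := weak_identity C2 C1 d1 d2 ui uti u0_Lfun u1_Lfun u2_Lfun weak
  solution_supp (@smooth_spatial_mode R n n_gt0 a0 c) B0 (@spatial_mode0 R n a0 c)
  T1_gt0 T1_tau tauT eig (@smooth_time_fun R c%:R T1 w) (d _) (d _) (d _)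
  (@continuous_time_fun R c%:R T1 _) z0_ge0 (@spatial_mode_ge0 R n n_gt0 a0 c)
  z0T z1T z2T.
split => //; rewrite -[RHS]E.
have at0 v : time_fun c%:R T1 v 0 = v.[0].
  by rewrite /time_fun mulr0 oppr0 expR0 mul1r mul0r.
rewrite !at0 cutoff_poly_at0 (time_deriv_at0 wA j_gt0) (time_deriv2_at0 wA j_gt0).
rewrite -/(phi c); case: c {d eig z0_ge0 z0T z1T z2T E mE at0} => /=; ring.
Qed.

(** Of the data, only the term with [u0] is kept. *)
Lemma tested_le (c : bool) :
  \int[leb]_(s in `[0, T1]) (time_fun c%:R T1 w s * \int[mu]_x (`|u s x| `^ p * phi c x))
  + c%:R * (eps * pairing u0 (phi c)) <= `|\int[leb]_(s in `[0, T1]) H c s|.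
Proof.
have [<- _] := tested_identity c; apply: le_trans (ler_norm _).
have P1 : 0 <= pairing u1 (phi c) by apply: pairing_ge0 => //; exact: Lfun_measurable u1_Lfun.
have P2 : 0 <= pairing u2 (phi c) by apply: pairing_ge0 => //; exact: Lfun_measurable u2_Lfun.
rewrite lerD2l [_ * (eps * _)]mulrCA ler_pM2l// lerDr.
by rewrite addr_ge0// mulr_ge0// ?addr_ge0// ?mulr_ge0// ltW.
Qed.

(** At each time the Young inequality is used with the constant [k * eta ^ (1 / p)], so
    that [|u| ^ p] appears with the very cutoff of the quantity [I]; where [eta] vanishes,
    so does the adjoint factor. *)
Lemma adjoint_integral_le (c : bool) (L : R -> R) (g : 'rV[R]_n -> R) (k D : R) :
  0 < k -> 0 <= D -> measurable_fun setT g ->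
  (forall x, phi c x <= g x) ->
  (forall s, 0 <= s <= T1 -> 0 <= L s /\
     `|adjoint_time beta j l c%:R T1 s| <= L s * eta s `^ p^-1) ->
  (forall s, 0 <= s <= T1 ->
     (((L s / k) `^ q)%:E * \int[mu]_(x in eucl_ball (r + s)%R) (g x `^ q)%:E <= D%:E)%E) ->
  `|\int[leb]_(s in `[0, T1]) H c s| <= k `^ p * I + D * T1.
Proof.
move=> k0 D0 mg pg ZL LD; have [mN Noo] := N_measurable.
have [_ mH] := tested_identity c.
apply: abs_integral_le_weighted => //; first exact: powR_ge0.
move=> s sT; have [e0 e1] := andP (eta01 sT); have [L0 ZLs] := ZL _ sT.
have sl := in_lifetime sT; have us := solution_Lfun sl.
rewrite /H normrM mulrC.
have [eE|eN] := eqVneq (eta s) 0.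
  move: ZLs; rewrite eE powR0 ?invr_neq0 ?gt_eqF// mulr0 normr_le0 => /eqP ->.
  by rewrite normr0 mul0r mulr0 mul0e add0e lee_fin.
have ep : 0 < eta s by rewrite lt_neqAle eq_sym eN.
pose C := k * eta s `^ p^-1; have C0 : 0 < C by rewrite mulr_gt0// powR_gt0.
have Cp : C `^ p = k `^ p * eta s.
  by rewrite powRM ?powR_ge0 ?(ltW k0)// -powRrM mulVf ?gt_eqF// powRr1.
have s_tau : s <= tau by case/andP: sT => _ /le_trans; apply; exact: ltW.
have Y := @pairing_young R n p q C `|adjoint_time beta j l c%:R T1 s| (r + s)
  (u s) (phi c) (phi false) g p_gt1 q_gt1 pq C0 (normr_ge0 _) (Lfun_measurable us)
  (phi_measurable c) (phi_measurable false) mg (solution_supp sl) (phi_ge0 false).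
apply: le_trans (Y _ _) _.
- move=> x xs; rewrite phi_false1//; apply: eucl_ball_le xs; by rewrite lerD2l.
- by move=> x _; rewrite ger0_norm.
rewrite Cp; apply: leeD => //.
apply: le_trans (LD _ sT); apply: lee_wpmul2r.
  by apply: integral_ge0 => x _; rewrite lee_fin powR_ge0.
rewrite lee_fin; apply: ge0_ler_powR; rewrite ?nnegrE ?(ltW q_gt0)//.
- by rewrite divr_ge0// ltW.
- by rewrite divr_ge0// ltW.
by rewrite ler_pdivrMr// /C mulrA divfK ?gt_eqF.
Qed.

Lemma pow_le1 (x : R) (k : nat) : 0 <= x <= 1 -> 0 <= x ^+ k <= 1.
Proof. by move=> /andP[x0 x1]; rewrite exprn_ge0// exprn_ile1. Qed.

(** With the constant mode the power integral [I] is the left-hand side itself: choosing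
    [k ^ p = 1 / 2], half of it is absorbed, and what remains is [T1 ^ (- 2 q)] times
    the space-time volume of the cone. *)
Lemma power_integral_le :
  I <= 2 * ((((1 + beta) * A) / 2^-1 `^ p^-1) `^ q * (2 * (r + 1)) ^+ n) *
    T1 `^ (1 - 2 * q + n%:R).
Proof.
pose M : R := (1 + beta) * A * T1 ^- 2; pose k : R := 2^-1 `^ p^-1.
have b1 : 0 <= 1 + beta by rewrite addr_ge0// ltW.
have M0 : 0 <= M by rewrite !mulr_ge0 ?invr_ge0 ?exprn_ge0// ltW.
have k0 : 0 < k by rewrite powR_gt0.
pose D := (M / k) `^ q * (2 * (r + 1) * T1) ^+ n.
have D0 : 0 <= D.
  by rewrite mulr_ge0 ?powR_ge0// exprn_ge0// !mulr_ge0 ?addr_ge0// ltW.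
have kp : k `^ p = 2^-1 by rewrite -powRrM mulVf ?gt_eqF// powRr1.
have h : `|\int[leb]_(s in `[0, T1]) H false s| <= k `^ p * I + D * T1.
  apply: (@adjoint_integral_le false (cst M) (cst 1) k D k0 D0 (measurable_cst _)).
  - by move=> x; case/andP: (phi_false_le1 x).
  - move=> s sT; split => //; have y1 := y01 sT.
    apply: le_trans (adjoint_time0_le (ltW beta_gt0) wA T1_ge1 sT) _.
    rewrite ler_wpM2l//; apply: le_trans (cutoff_weight_le j l_gt0 p_gt1 lp y1) _.
    by rewrite -[leRHS]mul1r ler_wpM2r ?powR_ge0//; case/andP: (pow_le1 j y1).
  - move=> s /andP[s0 sT]; rewrite EFinM; apply: lee_wpmul2l.
      by rewrite lee_fin powR_ge0.
    rewrite (_ : (fun x => _) = cst 1%:E); last by apply/funext => x /=; rewrite powR1.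
    rewrite integral_cst ?mul1e; last exact: measurable_eucl_ball.
    have rs0 : 0 <= r + s by rewrite addr_ge0// ltW.
    apply: le_trans (lebesgue_eucl_ball_le rs0) _; rewrite lee_fin.
    rewrite lerXn2r ?nnegrE ?mulr_ge0 ?addr_ge0// ?(ltW r_gt0) ?(ltW T1_gt0)//.
    rewrite -mulrA ler_wpM2l//; rewrite mulrDl mul1r lerD//.
    by rewrite ler_peMr// ltW.
rewrite kp in h; have := tested_le false; rewrite mul0r addr0 => h'.
have EI : \int[leb]_(s in `[0, T1]) (time_fun 0 T1 w s *
    \int[mu]_x (`|u s x| `^ p * phi false x)) = I.
  by rewrite /I; congr Rintegral; apply/funext => s; rewrite time_funE0.
have {h h'} : I <= 2 * (D * T1).
  by have := le_trans h' h; rewrite EI; lra.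
move/le_trans; apply.
rewrite -[leRHS]mulrA ler_pM2l// /D /M -/k.
have T1n0 : T1 != 0 by rewrite gt_eqF.
rewrite (_ : (1 + beta) * A * T1 ^- 2 / k = ((1 + beta) * A / k) * T1 `^ (- 2)); last first.
  by rewrite powRN powR_mulrn ?(ltW T1_gt0)// mulrAC.
have PT : T1 `^ (- 2) `^ q * T1 ^+ n * T1 = T1 `^ (1 - 2 * q + n%:R).
  rewrite [LHS](_ : _ = T1 `^ (- 2 * q) * T1 `^ n%:R * T1 `^ 1).
    by rewrite -!powRD ?T1n0 ?implybT//; congr (_ `^ _); ring.
  by rewrite powRr1 ?(ltW T1_gt0)// powR_mulrn ?(ltW T1_gt0)// powRrM.
rewrite powRM ?powR_ge0//; last by rewrite !mulr_ge0 ?invr_ge0// ltW.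
by rewrite exprMn -PT le_eqVlt; apply/orP; left; apply/eqP; ring.
Qed.

(** The growth exponents of the eigenfunction and of its [L^q] mass in the cone. *)
Let b : R := (n%:R - 1) / 2.
Let a : R := (n%:R - 1) - b * q.

(** With the growing mode the left-hand side dominates the initial datum. The factor
    [exp (- s)] balances the growth of the eigenfunction on the sphere of radius [r + s],
    and the mass left is a power of [1 + r + s]. *)
Lemma data_integral_le (C K k : R) : 0 < C -> 0 <= K -> 0 < k -> `|a| <= j%:R ->
  (forall rho, 0 <= rho ->
     eigen_fun n (rho ^+ 2) <= C * expR rho * (1 + rho) `^ (- b)) ->
  (forall rho : R, 0 <= rho ->
     (\int[mu]_(x in eucl_ball rho)
       ((expR (eucl_norm x - rho) * (1 + eucl_norm x) `^ (- b)) `^ q)%:E <=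
     (K * (1 + rho) `^ a)%:E)%E) ->
  eps * pairing u0 (phi true) <= k `^ p * I +
    (6 * (1 + beta) * A * T1^-1 * C * expR r / k) `^ q *
    (K * (2 + r) `^ `|a|) * T1 `^ a * T1.
Proof.
move=> C0 K0 k0 aj phiC intK.
pose M : R := 6 * (1 + beta) * A * T1^-1.
have b1 : 0 <= 1 + beta by rewrite addr_ge0// ltW.
have M0 : 0 <= M by rewrite !mulr_ge0// ?invr_ge0// ltW.
pose L s := expR (- s) * M * (s / T1) ^+ j.
pose g (x : 'rV[R]_n) := C * expR (eucl_norm x) * (1 + eucl_norm x) `^ (- b).
have mb : measurable_fun setT (fun x : 'rV[R]_n => (1 + eucl_norm x) `^ (- b)).
  apply: (measurableT_comp (measurable_powR _)); apply: measurable_funD => //.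
  exact: measurable_eucl_norm.
have me : measurable_fun setT (fun x : 'rV[R]_n => expR (eucl_norm x)).
  by apply: (measurableT_comp (@measurable_expR R)); exact: measurable_eucl_norm.
have mg : measurable_fun setT g.
  by apply: measurable_funM => //; exact: measurable_funM.
pose D := (M * C * expR r / k) `^ q * (K * (2 + r) `^ `|a|) * T1 `^ a.
have D0 : 0 <= D by rewrite !mulr_ge0 ?powR_ge0.
have h := tested_le true.
have pos : 0 <= \int[leb]_(s in `[0, T1]) (time_fun 1 T1 w s *
    \int[mu]_x (`|u s x| `^ p * phi true x)).
  apply: Rintegral_ge0 => s; rewrite /= in_itv/= => /eta01/andP[e0 _].
  rewrite mulr_ge0 ?mulr_ge0 ?expR_ge0//; apply: Rintegral_ge0 => x _.
  by rewrite mulr_ge0 ?powR_ge0.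
have {h pos} h : eps * pairing u0 (phi true) <= `|\int[leb]_(s in `[0, T1]) H true s|.
  by move: h pos; rewrite !mul1r; lra.
apply: le_trans h _.
apply: (@adjoint_integral_le true L g k D) => //.
- move=> x; apply: le_trans (spatial_mode_le _ _ _) _ => //; first exact: sqr_ge0.
  by apply: phiC; exact: eucl_norm_ge0.
- move=> s sT; have y1 := y01 sT; have /andP[y0 _] := y1.
  split.
    by apply: mulr_ge0; [apply: mulr_ge0|]; rewrite ?expR_ge0 ?exprn_ge0.
  apply: le_trans (adjoint_time1_le (ltW beta_gt0) A_ge0 wA T1_ge1 sT) _.
  rewrite -/M /L -[leRHS]mulrA; apply: ler_wpM2l; last exact: cutoff_weight_le.
  by apply: mulr_ge0; rewrite ?expR_ge0.
move=> s sT; have /andP[s0 sT1] := sT; have /andP[y0 y1] := y01 sT.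
set y := s / T1 in y0 y1 *.
have rs0 : 0 <= r + s by rewrite addr_ge0// ltW.
have w0 (x : 'rV[R]_n) : 0 <= expR (eucl_norm x - (r + s)) * (1 + eucl_norm x) `^ (- b).
  by rewrite mulr_ge0 ?expR_ge0 ?powR_ge0.
have gE x : g x `^ q = (C * expR (r + s)) `^ q *
    (expR (eucl_norm x - (r + s)) * (1 + eucl_norm x) `^ (- b)) `^ q.
  rewrite -powRM// ?mulr_ge0 ?expR_ge0// ?(ltW C0)//; congr (_ `^ _).
  by rewrite mulrA -[C * _ * _]mulrA -expRD addrC subrK.
have gint : (\int[mu]_(x in eucl_ball (r + s)%R) (g x `^ q)%:E <=
    ((C * expR (r + s)) `^ q * (K * (1 + (r + s)) `^ a))%:E)%E.
  under eq_integral do rewrite gE EFinM.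
  rewrite ge0_integralZl_EFin//; last 4 first.
  - exact: measurable_eucl_ball.
  - by move=> x _; rewrite lee_fin powR_ge0.
  - apply: measurable_funTS; apply/measurable_EFinP.
    apply: (measurableT_comp (measurable_powR _)); apply: measurable_funM => //.
    apply: (measurableT_comp (@measurable_expR R)); apply: measurable_funB => //.
    exact: measurable_eucl_norm.
  - exact: powR_ge0.
  by rewrite EFinM; apply: lee_wpmul2l; [rewrite lee_fin powR_ge0|exact: intK].
apply: le_trans (lee_wpmul2l _ gint) _; first by rewrite lee_fin powR_ge0.
rewrite -EFinM lee_fin.
have ys : y `^ (j%:R * q) * (1 + (r + s)) `^ a <= (2 + r) `^ `|a| * T1 `^ a.
  have [yE|yN] := eqVneq y 0.
    rewrite yE powR0 ?mul0r ?mulr_ge0 ?powR_ge0//.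
    by rewrite mulf_neq0 ?gt_eqF// ltr0n.
  have yp : 0 < y by rewrite lt_neqAle eq_sym yN.
  have r2 : 0 < 2 + r by rewrite addr_gt0.
  have sE : s = y * T1 by rewrite /y divfK// gt_eqF.
  have rT : r <= r * T1 by rewrite ler_peMr// ltW.
  (* [1 + r + s] and [T1] are comparable up to [(2 + r) / y], and [y ^ (j q)] compensates
     the power of [1 / y]. *)
  have c1 : 1 + (r + s) <= (2 + r) / y * T1.
    rewrite mulrAC ler_pdivlMr//; apply: (@le_trans _ _ (1 + (r + s))).
      by rewrite ler_piMr// addr_ge0.
    move: T1_ge1 sT1 rT; lra.
  have c2 : T1 <= (2 + r) / y * (1 + (r + s)).
    rewrite mulrAC ler_pdivlMr// mulrC -sE.
    apply: (@le_trans _ _ (1 * (1 + (r + s)))).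
      by rewrite mul1r; move: (ltW r_gt0); lra.
    by rewrite ler_wpM2r ?addr_ge0//; move: (ltW r_gt0); lra.
  have rs1 : 0 < 1 + (r + s) by rewrite ltr_pwDl.
  apply: (@le_trans _ _ (y `^ (j%:R * q) * (((2 + r) / y) `^ `|a| * T1 `^ a))).
    by rewrite ler_wpM2l ?powR_ge0//; exact: powR_comparable.
  rewrite powRM ?invr_ge0 ?(ltW r2)// -powR_inv1// -powRrM mulN1r.
  rewrite [leLHS](_ : _ = (y `^ (j%:R * q) * y `^ (- `|a|)) * ((2 + r) `^ `|a| * T1 `^ a));
    last by ring.
  rewrite -[leRHS]mul1r ler_wpM2r ?mulr_ge0 ?powR_ge0//.
  rewrite -powRD ?yN ?implybT//.
  rewrite [leRHS](_ : 1 = y `^ 0); last by rewrite powRr0.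
  apply: ger_powR; first by rewrite yp.
  rewrite subr_ge0 (le_trans aj)// ler_peMr// ltW//.
have -> : L s / k = M * expR (- s) * y ^+ j / k by rewrite /L -/y; ring.
have Lk : (M * expR (- s) * y ^+ j / k) `^ q * (C * expR (r + s)) `^ q =
    (M * C * expR r / k) `^ q * y `^ (j%:R * q).
  have p1 : 0 <= C * expR (r + s) by rewrite mulr_ge0 ?expR_ge0// ltW.
  have p2 : 0 <= M * C * expR r / k.
    by rewrite !mulr_ge0 ?expR_ge0 ?invr_ge0// ltW.
  have p3 : 0 <= M * expR (- s) * y ^+ j / k.
    by rewrite !mulr_ge0 ?expR_ge0 ?exprn_ge0 ?invr_ge0// ltW.
  rewrite powRrM powR_mulrn// -!powRM ?exprn_ge0//; congr (_ `^ _).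
  have es : expR (- s) * expR s = 1 :> R by rewrite -expRD addNr expR0.
  by rewrite expRD -[RHS]mul1r -es; ring.
rewrite [leLHS]mulrA Lk /D.
have c0 : 0 <= (M * C * expR r / k) `^ q * K by rewrite mulr_ge0 ?powR_ge0.
have := ler_wpM2l c0 ys.
rewrite [X in X <= _ -> _](_ : _ = (M * C * expR r / k) `^ q * y `^ (j%:R * q) *
  (K * (1 + (r + s)) `^ a)); last by ring.
by move/le_trans; apply; rewrite !mulrA.
Qed.

(** A lower bound by a pairing that depends on the data only: the growing mode is at least
    1 on the ball where the step function of the left-hand side lives. *)
Lemma data_pairing_ge :
  pairing u0 (radial (spatial_mode n (r ^+ 2) false)) <= pairing u0 (phi true).
Proof.
apply: pairing_le_ge0 => //.
  apply: test_function_Lfun2; apply: (@test_radial R n _ (r ^+ 2 + 1)).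
  - exact: smooth_spatial_mode.
  - by rewrite addr_ge0 ?sqr_ge0.
  - by move=> s; exact: spatial_mode0.
move=> x; rewrite /phi /radial /spatial_mode mulr1.
have [xr|xr] := leP (r ^+ 2 + 1) (eucl_norm x ^+ 2).
  rewrite smooth_step0// mulr_ge0 ?smooth_step_ge0// (le_trans ler01)//.
  by rewrite eigen_fun_ge1// sqr_ge0.
have tau0 : 0 <= tau by rewrite ltW// (lt_trans T1_gt0).
rewrite [smooth_step a0 _ _]smooth_step1 ?ltrDl//; last first.
  by rewrite (le_trans (ltW xr))// lerD2r lerXn2r ?nnegrE ?addr_ge0 ?lerDl// ltW.
rewrite mul1r (@le_trans _ _ 1)//; first by rewrite smooth_step_le1// ltrDl.
by rewrite eigen_fun_ge1// sqr_ge0.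
Qed.

End test_estimates.

(** * The upper bound for the lifespan *)

Section lifespan.
Context {R : realType}.

(** The quadratic polynomial [- theta] vanishes at the Strauss exponent [s] and its
    roots have opposite signs; multiplying by [s] and subtracting [p] times the equation
    of [s] makes the factor [s - p] appear. *)
Lemma theta_gt0 (p : R) (n : nat) : (1 <= n)%N -> 1 < p ->
  ((2 <= n)%N -> p < strauss_exponent n) -> 0 < theta p n.
Proof.
move=> n1 p1 ps; have [n2|] := leqP 2 n; last first.
  move=> nlt; have -> : n = 1%N by apply/eqP; rewrite eqn_leq n1 -ltnS nlt.
  by rewrite /theta subrr mul0r subr0; lra.
have [s0 sE] := @strauss_exponentP R n n2; have {}ps := ps n2.
set s := strauss_exponent n in s0 sE ps.
have nn : 0 < n%:R - 1 :> R by rewrite subr_gt0 (ltr_nat R 1 n).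
have E : s * theta p n = (s - p) * ((n%:R - 1) * p * s + 2).
  have -> : s * theta p n = s * theta p n +
    p * ((n%:R - 1) * s ^+ 2 - (n%:R + 1) * s - 2) by rewrite sE mulr0 addr0.
  by rewrite /theta; ring.
rewrite -(pmulr_rgt0 _ s0) E mulr_gt0 ?subr_gt0//.
by rewrite addr_gt0// !mulr_gt0// (lt_trans ltr01).
Qed.

(** Balancing the two estimates: the free parameter of the Young inequality is the
    power of [T1] for which both terms grow alike. *)
Lemma lifespan_inequality (n : nat) (beta p r : R) (u0 u1 u2 : 'rV[R]_n -> R) :
  (1 <= n)%N -> 0 < beta -> 1 < p -> 0 < r ->
  sobolev 2 u0 -> sobolev 1 u1 -> sobolev 0 u2 ->
  {ae lebesgue_rV n, forall x, 0 <= u0 x} ->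
  {ae lebesgue_rV n, forall x, 0 <= u1 x} ->
  {ae lebesgue_rV n, forall x, 0 <= u2 x} ->
  ess_supp u0 `<=` eucl_ball r ->
  ~ {ae lebesgue_rV n, forall x, u0 x = 0} ->
  exists2 c : R, 0 < c & forall eps T u, 0 < eps ->
    energy_solution beta p eps u0 u1 u2 T u -> supp_in_cone r T u ->
    forall T1 : R, 1 <= T1 -> (T1%:E < T)%E ->
    eps <= c * T1 `^ (- (theta p n / (2 * p * (p - 1)))).
Proof.
move=> n1 beta0 p1 r0 su0 su1 su2 u00 u10 u20 u0s u0N.
have p0 : 0 < p by exact: lt_trans p1.
have pm : 0 < p - 1 by rewrite subr_gt0.
pose q := p / (p - 1).
have q1 : 1 < q by rewrite /q ltr_pdivlMr// mul1r gtrBl.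
have pq : p^-1 + q^-1 = 1 by rewrite /q; field; rewrite !gt_eqF.
have q0 : 0 < q by exact: lt_trans q1.
have nn : 0 <= n%:R - 1 :> R by rewrite subr_ge0 (ler_nat R 1 n).
pose b : R := (n%:R - 1) / 2; pose a : R := (n%:R - 1) - b * q.
have b0 : 0 <= b by rewrite divr_ge0.
(* [j] makes the weight [y ^ j] compensate the power [a], of either sign; [l] is
   large enough for the power [1 / p] of the cutoff. *)
pose j := (Num.truncn `|a|).+1; pose l := (Num.truncn (3 / (p - 1))).+1.
have aj : `|a| <= j%:R by rewrite ltW// truncnS_gt.
have lp : 3 <= l%:R * (p - 1) by rewrite -ler_pdivrMr// ltW// truncnS_gt.
have [A A0 wA] := @cutoff_poly_derivs R j l.
have [C C0 phiC] := @eigen_fun_growth R n n1.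
have [K K0 intK] := @cone_weight_integral R n q b n1 q0 b0.
have [u0L u1L u2L] : [/\ u0 \in Lfun (lebesgue_rV n) 2%:E,
    u1 \in Lfun (lebesgue_rV n) 2%:E & u2 \in Lfun (lebesgue_rV n) 2%:E].
  by split; [exact: sobolev_Lfun su0|exact: sobolev_Lfun su1|exact: sobolev_Lfun su2].
pose c0 := pairing u0 (radial (spatial_mode n (r ^+ 2) false)).
have c00 : 0 < c0.
  apply: (@pairing_gt0 R n _ _ r) => //.
  - apply: test_function_Lfun2; apply: (@test_radial R n _ (r ^+ 2 + 1)).
    + exact: smooth_spatial_mode.
    + by rewrite addr_ge0 ?sqr_ge0.
    + by move=> s; exact: spatial_mode0.
  - by move=> x; rewrite /radial /spatial_mode mulr1 smooth_step_ge0.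
  - exact: ess_supp_ae.
  - move=> x xr; rewrite /radial /spatial_mode mulr1 smooth_step1 ?ltrDl//.
    by rewrite lerXn2r ?nnegrE ?eucl_norm_ge0// ltW.
pose K1 : R := 2 * ((((1 + beta) * A) / 2^-1 `^ p^-1) `^ q * (2 * (r + 1)) ^+ n).
pose X : R := 6 * (1 + beta) * A * C * expR r.
pose K2 : R := X `^ q * (K * (2 + r) `^ `|a|).
have bp : 0 <= 1 + beta by rewrite addr_ge0// ltW.
have X0 : 0 <= X.
  rewrite /X; apply: mulr_ge0; last exact: expR_ge0.
  by apply: mulr_ge0; [rewrite !mulr_ge0|exact: ltW].
have K10 : 0 <= K1.
  by rewrite /K1 !mulr_ge0 ?powR_ge0// exprn_ge0// mulr_ge0// addr_ge0// ltW.
have K20 : 0 <= K2 by rewrite /K2 !mulr_ge0 ?powR_ge0.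
pose om : R := - (theta p n / (2 * p * (p - 1))).
(* With [k = T1 ^ sg], both terms of the estimate are of order [T1 ^ om]. *)
pose sg : R := (om - 1 + 2 * q - n%:R) / p.
have om1 : sg * p + (1 - 2 * q + n%:R) = om by rewrite /sg divfK ?gt_eqF//; ring.
have om2 : - q - sg * q + a + 1 = om.
  rewrite /sg /om /a /b /theta /q; field.
  by rewrite !gt_eqF.
exists ((K1 + K2 + 1) / c0); first by rewrite divr_gt0// ltr_pwDr// addr_ge0.
move=> eps T u eps0 sol cone T1 T11 T1T.
have T10 : 0 < T1 by exact: lt_le_trans T11.
have T1N : T1 != 0 by rewrite gt_eqF.
have [|d d0 dT] := @lifetime_right R T T1; first by split => //; exact: ltW.
have T1t : T1 < T1 + d by rewrite ltrDl.
have j0 : (0 < j)%N by []; have l0 : (0 < l)%N by [].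
pose k := T1 `^ sg; have k0 : 0 < k by exact: powR_gt0.
have E1 := power_integral_le n1 beta0 p1 q1 pq r0 eps0 u0L u1L u2L u10 u20 u0s
  sol cone T11 T1t dT A0 j0 l0 lp wA.
have E2 := data_integral_le n1 beta0 p1 q1 pq r0 eps0 u0L u1L u2L u10 u20 u0s
  sol cone T11 T1t dT A0 j0 l0 lp wA C0 K0 k0 aj phiC intK.
have E3 := data_pairing_ge n1 r0 u0L u00 T11 T1t.
rewrite -/om mulrAC ler_pdivlMr//.
apply: le_trans (_ : eps * c0 <= (K1 + K2) * T1 `^ om) _; last first.
  by rewrite ler_wpM2r ?powR_ge0// lerDl.
apply: (le_trans (ler_wpM2l (ltW eps0) E3)); apply: (le_trans E2).
rewrite [leRHS]mulrDl; apply: lerD.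
  apply: (le_trans (ler_wpM2l (powR_ge0 _ _) E1)).
  rewrite -/K1 mulrCA ler_wpM2l// /k -powRrM -powRD ?T1N ?implybT//.
  by rewrite om1.
rewrite (_ : 6 * (1 + beta) * A * T1^-1 * C * expR r / k = X * (T1 `^ (- 1) * T1 `^ (- sg))).
  rewrite -[T1 `^ (- 1) * _]powRD ?T1N ?implybT//.
  rewrite [(X * _) `^ _]powRM ?powR_ge0// -powRrM.
  rewrite -om2 /K2.
  rewrite (_ : - q - sg * q + a + 1 = (-1 - sg) * q + a + 1); last by ring.
  have PT : T1 `^ ((-1 - sg) * q) * T1 `^ a * T1 `^ 1 = T1 `^ ((-1 - sg) * q + a + 1).
    by rewrite -!powRD ?T1N ?implybT.
  rewrite powRr1 ?(ltW T10)// in PT; rewrite -PT -/b -/a.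
  by rewrite le_eqVlt; apply/orP; left; apply/eqP; ring.
by rewrite !powRN powRr1 ?(ltW T10)// /X /k; ring.
Qed.

End lifespan.

Theorem theorem4p1 (R : realType) (n : nat) (beta p r : R)
    (u0 u1 u2 : 'rV[R]_n -> R)
    (n_ge1 : (1 <= n)%N) (beta_gt0 : 0 < beta)
    (p_gt1 : 1 < p) (p_lt : (2 <= n)%N -> p < strauss_exponent n)
    (r_gt0 : 0 < r)
    (u0_H2 : sobolev 2 u0) (u1_H1 : sobolev 1 u1) (u2_L2 : sobolev 0 u2)
    (u0_ge0 : {ae lebesgue_rV n, forall x, 0 <= u0 x})
    (u1_ge0 : {ae lebesgue_rV n, forall x, 0 <= u1 x})
    (u2_ge0 : {ae lebesgue_rV n, forall x, 0 <= u2 x})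
    (u0_supp : ess_supp u0 `<=` eucl_ball r)
    (u1_supp : ess_supp u1 `<=` eucl_ball r)
    (u2_supp : ess_supp u2 `<=` eucl_ball r)
    (u0_neq0 : ~ {ae lebesgue_rV n, forall x, u0 x = 0}) :
  exists eps0 : R, 0 < eps0 /\
  exists C : R, 0 < C /\
  forall eps : R, 0 < eps -> eps <= eps0 ->
  forall (T : \bar R) (u : R -> 'rV[R]_n -> R), (0 < T)%E ->
    energy_solution beta p eps u0 u1 u2 T u ->
    is_lifespan beta p eps r u0 u1 u2 T u ->
    supp_in_cone r T u ->
    (T < +oo)%E /\
    (T <= (C * eps `^ (- (2 * p * (p - 1) / theta p n)))%:E)%E.
Proof.
have th0 := theta_gt0 n_ge1 p_gt1 p_lt.
have [c c0 main] := lifespan_inequality n_ge1 beta_gt0 p_gt1 r_gt0 u0_H2 u1_H1 u2_L2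
  u0_ge0 u1_ge0 u2_ge0 u0_supp u0_neq0.
have pp0 : 0 < 2 * p * (p - 1).
  by rewrite !mulr_gt0// ?subr_gt0// (lt_trans ltr01).
set e := 2 * p * (p - 1) / theta p n.
have e0 : 0 < e by rewrite divr_gt0.
exists 1; split => //; exists (1 + c `^ e); split.
  by rewrite ltr_pwDl// powR_ge0.
move=> eps eps0 eps1 T u T0 sol _ cone.
set B := (1 + c `^ e) * eps `^ (- e).
have epsN : 1 <= eps `^ (- e).
  rewrite -[leLHS](@powRr0 _ eps); apply: ger_powR; first by rewrite eps0.
  by rewrite oppr_le0 ltW.
have B1 : 1 <= B.
  by rewrite /B -[leLHS]mul1r ler_pM// lerDl powR_ge0.
suff TB : (T <= B%:E)%E by split => //; exact: le_lt_trans TB (ltry _).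
rewrite leNgt; apply/negP => BT.
(* If [T] were larger than the bound, some later [B + d] would still be in the lifetime,
   contradicting the inequality at [T1 = B + d]. *)
have [|d d0 dT] := @lifetime_right R T B.
  by split => //; exact: le_trans B1.
have T11 : 1 <= B + d by rewrite (le_trans B1)// lerDl ltW.
have T10 : 0 < B + d by exact: lt_le_trans T11.
have := main eps T u eps0 sol cone _ T11 dT.
rewrite -/e powRN => H.
have h1 : eps * (B + d) `^ e^-1 <= c.
  by move: H; rewrite ler_pdivlMr ?powR_gt0// /e invf_div.
have h2 : (eps * (B + d) `^ e^-1) `^ e <= c `^ e.
  apply: ge0_ler_powR => //; rewrite ?nnegrE; [exact: ltW| |exact: ltW].
  by rewrite mulr_ge0 ?powR_ge0// ltW.
have h3 : B + d <= c `^ e * eps `^ (- e).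
  rewrite powRN ler_pdivlMr ?powR_gt0//; move: h2.
  by rewrite powRM ?powR_ge0 ?(ltW eps0)// -powRrM mulVf ?gt_eqF// powRr1 ?(ltW T10)// mulrC.
have := powR_ge0 eps (- e); move: h3; rewrite /B mulrDl; lra.
Qed.
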